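(* Let $m\in\mathbb{Z}_{>0}$, $a\in\{0,1,\dots,m-1\}$, $N\in\mathbb{Z}_{>0}$ and $\omega=e^{2\pi i/N}$. Define \[ X_m^{(a)}(\omega)=\sum_{0\le k_1,\dots,k_m\le N-1}(\omega)_{k_m}\,\omega^{k_1^2+\cdots+k_{m-1}^2+k_{a+1}+\cdots+k_{m-1}}\Big(\prod_{\substack{i=1\\ i\ne a}}^{m-1}\begin{bmatrix} k_{i+1}\\ k_i\end{bmatrix}\Big)\begin{bmatrix} k_{a+1}+1\\ k_a\end{bmatrix}, \] where the Gaussian binomials are evaluated at $q=\omega$ and for $a=0$ the factor $\begin{bmatrix} k_{a+1}+1\\ k_a\end{bmatrix}$ is taken to be $1$. Then, as $N\to\infty$, $X_m^{(a)}(\omega)$ has the asymptotic expansion \[ X_m^{(a)}(\omega)\simeq\frac{2}{\sqrt{2m+1}}N^{3/2}e^{\frac{\pi i}{4}-\frac{\pi i}{N}\frac{(2m-2a-1)^2}{4(2m+1)}}\sum_{k=0}^{m-1}(-1)^k(m-k)\sin\Big((a+1)\frac{2k+1}{2m+1}\pi\Big)e^{-N\pi i\frac{(2k+1)^2}{4(2m+1)}} +e^{-\frac{\pi i}{N}\frac{(2m-2a-1)^2}{4(2m+1)}}\sum_{n=0}^\infty\frac{T_m^{(a)}(n)}{n!}\Big(\frac{\pi}{4(2m+1)Ni}\Big)^n, \] where $T_m^{(a)}(n)=\tfrac12(-1)^{n+1}L(-2n-1,\chi_{8m+4}^{(a)})$.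
   Context: Notation: $(\omega)_n=\prod_{j=1}^n(1-\omega^j)$ (which vanishes for $n\ge N$), and $\begin{bmatrix} n\\ c\end{bmatrix}$ denotes the Gaussian polynomial $\frac{(q)_n}{(q)_c(q)_{n-c}}$ (for $0\le c\le n$, $0$ otherwise), $(q)_n=\prod_{j=1}^n(1-q^j)$, evaluated at $q=\omega$. The symbol $\simeq$ denotes an asymptotic expansion as $N\to\infty$: the first (oscillatory, order $N^{3/2}$) term plus the power series in $1/N$ approximates $X_m^{(a)}(\omega)$ to arbitrarily high order in $1/N$. The periodic function $\chi_{8m+4}^{(a)}$ (period $8m+4$) takes the value $1$ at $n\equiv 2m-2a-1$, $-1$ at $n\equiv 2m+2a+3$, $-1$ at $n\equiv 6m-2a+1$, $1$ at $n\equiv 6m+2a+5\pmod{8m+4}$, and $0$ otherwise. $L(s,\chi)=\sum_{n\ge1}\chi(n)n^{-s}$ for $\operatorname{Re}s>1$, analytically continued to an entire function.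
   Formalization: The sum defining X runs over 0 ≤ k_1,…,k_m ≤ N (all nonzero terms) instead of ≤ N−1; for a = 0 this is the same, but for a ≥ 1 the displayed range omits terms totalling aN (e.g. m=2, a=1: k_1=N, k_2=N−1 gives N), so the expansion would fail. *)

(* Defs.v *)
From HB Require Import structures.
From mathcomp Require Import all_boot all_order all_algebra.
From mathcomp Require Import all_classical all_reals all_analysis.
From mathcomp Require Import complex.

Set Implicit Arguments.
Unset Strict Implicit.
Unset Printing Implicit Defensive.

Import Order.TTheory GRing.Theory Num.Theory.
Import numFieldNormedType.Exports.

Local Open Scope classical_set_scope.
Local Open Scope ring_scope.
Local Open Scope complex_scope.

Definition cexp (R : realType) (z : R[i]) : R[i] :=
  (expR (complex.Re z))%:C * (cos (complex.Im z) +i* sin (complex.Im z)).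

Definition qpoch (A : nzRingType) (q : A) (n : nat) : A :=
  \prod_(1 <= j < n.+1) (1 - q ^+ j).

(* The quotient is taken in the polynomial ring, where it is exact, and only
   then evaluated: (q)_c (q)_(n-c) may vanish at a root of unity. *)
Definition gauss_poly (F : fieldType) (n c : nat) : {poly F} :=
  if (c <= n)%N then qpoch 'X n %/ (qpoch 'X c * qpoch 'X (n - c)) else 0.

Definition omega (R : realType) (N : nat) : R[i] :=
  cexp ((2 * pi / N%:R)%:C * 'i%C).

(* k_i for 1 <= i <= m, where k = (k_1, ..., k_m). *)
Definition entry (m M : nat) (k : m.-tuple 'I_M) (i : nat) : nat :=
  nth 0%N [seq val x | x <- k] i.-1.

(* The q-series summed over all k_1, ..., k_m >= 0, at q = w. The summand
   vanishes unless k_m <= N - 1 (because of (w)_(k_m)), and then unless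
   k_i <= N - 1 for a < i and k_i <= N for i <= a (because of the binomials),
   so that [0, N]^m contains its support. For a = 0 one may replace [0, N] by
   [0, N - 1]; for a > 0 one may not: k_a = N, k_(a+1) = N - 1 is possible, and
   the terms with an entry equal to N add up to exactly a * N. *)
Definition X (R : realType) (m a N : nat) : R[i] :=
  let w := omega R N in
  \sum_(k : m.-tuple 'I_N.+1)
    qpoch w (entry k m)
    * w ^+ (\sum_(1 <= i < m) entry k i ^ 2 + \sum_(a.+1 <= i < m) entry k i)
    * (\prod_(1 <= i < m | i != a)
         (gauss_poly R[i] (entry k i.+1) (entry k i)).[w])
    * (if a == 0%N then 1
       else (gauss_poly R[i] (entry k a.+1).+1 (entry k a)).[w]).

Definition chi (m a n : nat) : int :=
  if n == 2 * m - 2 * a - 1 %[mod 8 * m + 4] then 1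
  else if n == 2 * m + 2 * a + 3 %[mod 8 * m + 4] then -1
  else if n == 6 * m - 2 * a + 1 %[mod 8 * m + 4] then -1
  else if n == 6 * m + 2 * a + 5 %[mod 8 * m + 4] then 1
  else 0.

Definition analytic_at (R : realType) (f : R[i] -> R[i]) (z0 : R[i]) : Prop :=
  exists (c : nat -> R[i]) (r : R), 0 < r /\
    forall z : R[i], `|z - z0| < r%:C ->
      series (fun n => c n * (z - z0) ^+ n : R[i]^o) @ \oo --> (f z : R[i]^o).

Definition entire (R : realType) (f : R[i] -> R[i]) : Prop :=
  forall z0 : R[i], analytic_at f z0.

Definition dirichlet_term (R : realType) (c : nat -> int) (s : R[i]) (n : nat)
    : R[i] :=
  (c n)%:~R * cexp (- s * (ln n%:R)%:C).

(* The index of the series is shifted: its n-th term is c(n+1) (n+1)^(-s). *)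
Definition L_continuation (R : realType) (c : nat -> int) (L : R[i] -> R[i])
    : Prop :=
  entire L /\
  forall s : R[i], 1 < complex.Re s ->
    series (fun n => dirichlet_term c s n.+1 : R[i]^o) @ \oo
      --> (L s : R[i]^o).

(* The entire continuation of the Dirichlet series, unique if it exists. *)
Definition L_function (R : realType) (c : nat -> int) : R[i] -> R[i] :=
  xget (fun=> 0) [set L : R[i] -> R[i] | L_continuation c L].

Definition T (R : realType) (m a n : nat) : R[i] :=
  2^-1 * (-1) ^+ n.+1 * L_function (chi m a) (- (2 * n + 1)%:R).

(* Main.v *)
Require Import Defs.
From HB Require Import structures.
From mathcomp Require Import all_boot all_order all_algebra.
From mathcomp Require Import all_classical all_reals all_analysis.
From mathcomp Require Import complex ring lra zify.

Set Implicit Arguments.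
Unset Strict Implicit.
Unset Printing Implicit Defensive.

Import Order.TTheory GRing.Theory Num.Theory.
Import numFieldNormedType.Exports.

Local Open Scope classical_set_scope.
Local Open Scope ring_scope.
Local Open Scope complex_scope.

(** Write Q = 2m+1, M = 4QN, h(n) = e^(pi i n^2/M) and n0 = 2m-2a-1.

    The nested sum is evaluated by a Bailey chain for generic q, with base
    A = q^(-2N); a change of base A -> Aq at level a accounts for the shifted
    binomial. Up to a power of q both sides are polynomials in q, so they agree
    as polynomials; the derivative at q = omega gives
      X = h(n0)^(-1) / (2M) * sum_(n < 2QN) chi(n) (n^2 - Mn) h(n).

    Expanding chi in cosines turns this into a combination, with coefficients
    antisymmetric under k -> 2m-k, of W(K)/h(K) at K = (2k+1)N, where
    W(K) = sum_(n < M) h(n-K) (n^2 - Mn) has second difference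
    2 G - 2M h(K) with G = sqrt(M) e^(pi i/4) the quadratic Gauss sum. The part
    (K^2 - MK) G of W yields the oscillating term. The rest solves the
    difference equation with right-hand side -2M h(K), for which
      -2M h(K) sum_r (i eta/2)^r / r! Li_(-2r-1)(e^(i eta K)),  eta = 2 pi/M,
    is a formal solution; its truncation is a solution up to a controlled error
    and up to a constant, which the antisymmetric coefficients annihilate.

    The Dirichlet series of chi is the same combination of polylogarithms.
    Repeated Abel summation continues these to entire functions of s, whose
    values at s = -k are the rational functions Li_(-k); the identity theorem
    shows that this continuation is L(s, chi). *)

(** * Gaussian binomials *)

(** At q = omega itself the chain cannot be run, because its kernels divide by factors 1 - q^j that
    vanish there. For generic q the choice x = q^(-N), A = x^2 makes the outer sum stop at N, while
    (xq)_n and the weights x^(2k) return to (omega)_n and 1 at q = omega. The price is a factor 1 -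
    x on the left, which also becomes 0: at omega the left side vanishes, and X sits in the first
    derivative. Differentiation brings down the exponents of q; after completing the square they
    form the weight n^2 - Mn.

    The series of polylogarithms is only formal, so its truncation error has to be measured without
    a sum to compare with. In the step variable t this error satisfies a differential recursion;
    since it vanishes at t = 0, it is small to the order of the truncation. Solving the difference
    equation outwards from the symmetric point K = M/2 sums the errors twice and costs a factor of
    order N^2, so the truncation is taken two orders beyond the target. *)

Fixpoint qbin (A : comNzRingType) (q : A) (n k : nat) : A :=
  match n, k with
  | _, 0 => 1
  | 0, _.+1 => 0
  | n'.+1, k'.+1 => qbin q n' k'.+1 + q ^+ (n' - k') * qbin q n' k'
  end.

Section QBinomialRing.
Variables (A : comNzRingType) (q : A).

Lemma qbin0 n : qbin q n 0 = 1. Proof. by case: n. Qed.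

Lemma qbinS n k :
  qbin q n.+1 k.+1 = qbin q n k.+1 + q ^+ (n - k) * qbin q n k.
Proof. by []. Qed.

Lemma qbin_small n k : (n < k)%N -> qbin q n k = 0.
Proof.
elim: n k => [|n IH] [|k] //= lk.
by rewrite !IH ?mulr0 ?addr0 //; lia.
Qed.

Lemma qbin_absorb n k : (k <= n)%N ->
  (1 - q ^+ k.+1) * qbin q n k.+1 = (1 - q ^+ (n - k)) * qbin q n k.
Proof.
elim: n k => [|n IH] k lk.
  by move: lk; case: k => //= _; rewrite subnn expr0 subrr mulr0 mul0r.
have [->|ne] := eqVneq k n.+1.
  by rewrite subnn expr0 subrr mul0r qbin_small ?mulr0.
have lkn : (k <= n)%N by lia.
have -> : (1 - q ^+ k.+1) * qbin q n.+1 k.+1 = (1 - q ^+ n.+1) * qbin q n k.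
  rewrite qbinS mulrDr IH //.
  have -> : q ^+ n.+1 = q ^+ (n - k) * q ^+ k.+1 by rewrite -exprD; congr (_ ^+ _); lia.
  by ring.
case: k lk ne lkn => [|k] lk ne lkn; first by rewrite !qbin0 subn0.
have h := IH k (ltnW lkn).
rewrite qbinS subSS mulrDr.
have -> : (1 - q ^+ (n - k)) * (q ^+ (n - k) * qbin q n k) =
    q ^+ (n - k) * ((1 - q ^+ k.+1) * qbin q n k.+1) by rewrite h; ring.
have -> : q ^+ n.+1 = q ^+ (n - k) * q ^+ k.+1 by rewrite -exprD; congr (_ ^+ _); lia.
by ring.
Qed.

Lemma qbinS2 n k : (k <= n)%N ->
  qbin q n.+1 k.+1 = q ^+ k.+1 * qbin q n k.+1 + qbin q n k.
Proof.
move=> lk; have := qbin_absorb lk.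
rewrite qbinS !mulrBl !mul1r => h.
rewrite -[qbin q n k.+1 in LHS](subrK (q ^+ k.+1 * qbin q n k.+1)) h.
by ring.
Qed.

Lemma qpoch0 : qpoch q 0 = 1.
Proof. by rewrite /qpoch big_geq. Qed.

Lemma qpochS n : qpoch q n.+1 = qpoch q n * (1 - q ^+ n.+1).
Proof. by rewrite /qpoch big_nat_recr. Qed.

Lemma qbin_qpoch n k : (k <= n)%N ->
  qbin q n k * (qpoch q k * qpoch q (n - k)) = qpoch q n.
Proof.
elim: n k => [|n IH] [|k] lk.
- by rewrite qbin0 !qpoch0 !mul1r.
- by [].
- by rewrite qbin0 qpoch0 !mul1r subn0.
rewrite subSS qbinS mulrDl qpochS.
have -> : q ^+ (n - k) * qbin q n k * (qpoch q k * (1 - q ^+ k.+1) * qpoch q (n - k)) =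
   (q ^+ (n - k) * (1 - q ^+ k.+1)) * qpoch q n.
  by rewrite -(IH k) //; ring.
have -> : qbin q n k.+1 * (qpoch q k * (1 - q ^+ k.+1) * qpoch q (n - k)) =
   (1 - q ^+ (n - k)) * qpoch q n.
  have [->|ne] := eqVneq k n.
    by rewrite subnn expr0 subrr mul0r qbin_small ?mul0r.
  rewrite -(IH k) //.
  transitivity ((1 - q ^+ k.+1) * qbin q n k.+1 * (qpoch q k * qpoch q (n - k))); first by ring.
  by rewrite qbin_absorb //; ring.
rewrite qpochS -mulrDl [RHS]mulrC; congr (_ * _).
by have -> : n.+1 = ((n - k) + k.+1)%N by [lia]; rewrite exprD; ring.
Qed.

Lemma qbin_sum M (F : nat -> A) :
  \sum_(j < M.+2) qbin q M.+1 j * F j =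
  \sum_(j < M.+1) qbin q M j * F j +
  \sum_(j < M.+1) qbin q M j * (q ^+ (M - j) * F j.+1).
Proof.
rewrite big_ord_recl qbin0.
under eq_bigr do rewrite lift0 qbinS mulrDl.
rewrite big_split addrA; congr (_ + _); last by apply: eq_bigr => i _; ring.
rewrite [in RHS]big_ord_recl qbin0; congr (_ + _).
rewrite big_ord_recr /= qbin_small // mul0r addr0.
by apply: eq_bigr.
Qed.

Definition qfac (b : A) n : A := \prod_(j < n) (1 - b * q ^+ j).

Lemma qfac0 b : qfac b 0 = 1. Proof. exact: big_ord0. Qed.

Lemma qfacSr b n : qfac b n.+1 = qfac b n * (1 - b * q ^+ n).
Proof. exact: big_ord_recr. Qed.

Lemma qfacSl b n : qfac b n.+1 = (1 - b) * qfac (b * q) n.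
Proof.
rewrite /qfac big_ord_recl expr0 mulr1; congr (_ * _).
by apply: eq_bigr => i _; rewrite lift0 exprS mulrA.
Qed.

Lemma qfac_cat b m n : qfac b (m + n) = qfac b m * qfac (b * q ^+ m) n.
Proof.
rewrite /qfac big_split_ord; congr (_ * _).
by apply: eq_bigr => i _ /=; rewrite exprD mulrA.
Qed.

(** Finite form of Cauchy's Durfee square identity, with denominators cleared so that it holds in
    any commutative ring. In the induction the two halves of Pascal's rule give 1 - B q^(M+1), from
    the base B, and B q^(M+1), from the base B q. *)
Lemma durfee M B :
  \sum_(j < M.+1) qbin q M j * (B ^+ j * q ^+ (j ^ 2) * qfac (B * q ^+ j.+1) (M - j)) = 1.
Proof.
elim: M B => [|M IH] B.
  by rewrite big_ord1 /= qfac0 !mulr1.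
rewrite (qbin_sum M (fun j => B ^+ j * q ^+ (j ^ 2) * qfac (B * q ^+ j.+1) (M.+1 - j))).
rewrite -[RHS](subrK (B * q ^+ M.+1)); congr (_ + _).
  rewrite -[RHS]mul1r -{1}(IH B) mulr_suml.
  apply: eq_bigr => j _.
  rewrite subSn; last by rewrite -ltnS.
  rewrite qfacSr -(mulrA B) -exprD.
  have -> : (j.+1 + (M - j) = M.+1)%N by have := ltn_ord j; lia.
  by ring.
rewrite -[RHS]mulr1 -[X in _ = _ * X](IH (B * q)) mulr_sumr.
apply: eq_bigr => j _; rewrite subSS.
have e : (M - j + j.+1 ^ 2 = M.+1 + j + j ^ 2)%N by have := ltn_ord j; lia.
have -> : B * q * q ^+ j.+1 = B * q ^+ j.+2 by rewrite (exprS _ j.+1); ring.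
have -> : q ^+ (M - j) * (B ^+ j.+1 * q ^+ (j.+1 ^ 2) * qfac (B * q ^+ j.+2) (M - j)) = B ^+ j.+1 * q ^+ (M - j + j.+1 ^ 2) * qfac (B * q ^+ j.+2) (M - j) by rewrite exprD; ring.
by rewrite e !exprD exprMn (exprS B); ring.
Qed.

(** The q-Chu-Vandermonde sum with denominators cleared; the second half of Pascal's rule is the
    same sum with b q in place of b. *)
Lemma qvandermonde M b z :
  \sum_(j < M.+1) qbin q M j *
     ((-1) ^+ j * q ^+ 'C(j, 2) * z ^+ j * qfac b j * qfac (b * z * q ^+ j) (M - j))
  = qfac z M.
Proof.
elim: M b z => [|M IH] b z.
  by rewrite big_ord1 /= !qfac0 !expr0 !mulr1.
rewrite (qbin_sum M (fun j => (-1) ^+ j * q ^+ 'C(j, 2) * z ^+ j * qfac b j * qfac (b * z * q ^+ j) (M.+1 - j))).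
have -> : \sum_(j < M.+1) qbin q M j * ((-1) ^+ j * q ^+ 'C(j, 2) * z ^+ j *
    qfac b j * qfac (b * z * q ^+ j) (M.+1 - j)) = qfac z M * (1 - b * z * q ^+ M).
  rewrite -{1}(IH b z) mulr_suml; apply: eq_bigr => j _.
  rewrite subSn; last by rewrite -ltnS.
  rewrite qfacSr -(mulrA (b * z)) -exprD subnKC; last by rewrite -ltnS.
  by rewrite !mulrA.
have -> : \sum_(j < M.+1) qbin q M j * (q ^+ (M - j) * ((-1) ^+ j.+1 * q ^+ 'C(j.+1, 2) * z ^+ j.+1 *
    qfac b j.+1 * qfac (b * z * q ^+ j.+1) (M.+1 - j.+1))) = - (z * (1 - b) * q ^+ M) * qfac z M.
  rewrite -{1}(IH (b * q) z) mulr_sumr; apply: eq_bigr => j _.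
  rewrite subSS qfacSl.
  have -> : b * q * z * q ^+ j = b * z * q ^+ j.+1 by rewrite exprS; ring.
  have -> : q ^+ 'C(j.+1, 2) = q ^+ 'C(j, 2) * q ^+ j by rewrite -exprD binS bin1.
  have -> : q ^+ M = q ^+ (M - j) * q ^+ j by rewrite -exprD subnK // -ltnS.
  rewrite (exprS (-1)) (exprS z); ring.
rewrite qfacSr; ring.
Qed.

End QBinomialRing.

Lemma rmorph_qbin (A B : comNzRingType) (f : {rmorphism A -> B}) q n k :
  f (qbin q n k) = qbin (f q) n k.
Proof.
elim: n k => [|n IH] [|k] /=; rewrite ?rmorph1 ?rmorph0 //.
by rewrite rmorphD rmorphM rmorphXn !IH.
Qed.

Lemma horner_qbin (F : comNzRingType) (w : F) n k : (qbin 'X n k).[w] = qbin w n k.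
Proof. by rewrite -[LHS]/(horner_eval w _) rmorph_qbin /= /horner_eval hornerX. Qed.

Lemma qpochX_neq0 (F : fieldType) n : qpoch ('X : {poly F}) n != 0.
Proof.
elim: n => [|n IH]; first by rewrite qpoch0 oner_neq0.
rewrite qpochS mulf_neq0 //; rewrite -opprB oppr_eq0.
by rewrite -size_poly_eq0 size_XnsubC.
Qed.

(** [qbin] follows Pascal's rule without any division, so it commutes with evaluation at a root of
    unity; over polynomials [qbin_qpoch] identifies it with the exact quotient. *)
Lemma horner_gauss_poly (F : fieldType) (w : F) n k :
  (gauss_poly F n k).[w] = qbin w n k.
Proof.
rewrite -horner_qbin /gauss_poly; case: leqP => h; last by rewrite qbin_small.
by rewrite -(qbin_qpoch 'X h) mulpK // mulf_neq0 ?qpochX_neq0.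
Qed.

(** * The Bailey chain *)

Section BaileyChain.
Variables (F : fieldType) (q : F).

Definition facs (A : F) a b : F := \prod_(a <= j < b) (1 - A * q ^+ j).

Lemma facs_shift A a b : facs (A * q) a b = facs A a.+1 b.+1.
Proof.
rewrite /facs [RHS]big_add1; apply: eq_bigr => j _.
by rewrite -mulrA -exprS.
Qed.

Lemma facs_cat A a b c : (a <= b <= c)%N -> facs A a c = facs A a b * facs A b c.
Proof. by case/andP=> ab bc; exact: big_cat_nat. Qed.

Lemma facs_neq0 A a b : (forall j, (a <= j < b)%N -> 1 - A * q ^+ j != 0) ->
  facs A a b != 0.
Proof.
move=> h; rewrite /facs big_seq prodf_seq_neq0.
by apply/allP => j; rewrite mem_index_iota => hj; rewrite hj /= h.
Qed.

Lemma facsr A a b : (a <= b)%N -> facs A a b.+1 = facs A a b * (1 - A * q ^+ b).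
Proof. by move=> ab; rewrite /facs big_nat_recr. Qed.

Lemma facsl A a b : (a < b)%N -> facs A a b = (1 - A * q ^+ a) * facs A a.+1 b.
Proof. by move=> ab; rewrite /facs big_ltn. Qed.

Lemma facs_nil A a : facs A a a = 1.
Proof. by rewrite /facs big_geq. Qed.

Lemma facs_qfac A a n : facs A a (a + n) = qfac q (A * q ^+ a) n.
Proof.
elim: n => [|n IH]; first by rewrite addn0 facs_nil qfac0.
by rewrite addnS facsr ?leq_addr // IH qfacSr exprD mulrA.
Qed.

(* [bterm A r n] is the kernel 1/((q)_(n-r) (Aq)_(n+r)) of a Bailey pair relative
   to A, normalised by (q)_n and by the r-th unit coefficient; the factor
   1 - A q^(2r) is kept out because it vanishes for A = q^(-2N), r = N. *)
Definition bterm (A : F) r n : F :=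
  qbin q n r / (facs A r (2 * r) * facs A (2 * r).+1 (n + r).+1).

Definition bterm' (A : F) r n : F := bterm A r n / (1 - A * q ^+ (2 * r)).

Lemma bterm_small A r n : (n < r)%N -> bterm A r n = 0.
Proof. by move=> h; rewrite /bterm qbin_small // mul0r. Qed.

Lemma bterm_conv0 A n : bterm A 0 n.+1 = bterm' (A * q) 0 n.
Proof.
rewrite /bterm' /bterm !qbin0 !muln0 expr0 mulr1 !facs_shift !facs_nil !mul1r !addn0.
by rewrite (facsl _ (isT : (1 < n.+2)%N)) expr1 invfM mulrC.
Qed.

(** Change of base: a kernel of index n + 1 relative to A splits into two kernels of index n
    relative to A q, with the factor kept apart now restored in the denominator. *)
Lemma bterm_convS A r n : (r <= n)%N ->
  (forall j, (0 < j <= (2 * n).+1)%N -> 1 - A * q ^+ j != 0) ->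
  bterm A r.+1 n.+1 = q ^+ r.+1 * bterm' (A * q) r.+1 n + bterm' (A * q) r n.
Proof.
move=> rn nz; rewrite /bterm' /bterm !facs_shift -!(mulrA A) -!exprS.
have -> : (2 * r.+1 = (2 * r).+2)%N by lia.
have [->|rn1] := eqVneq r n.
  rewrite (qbin_small q (ltnSn n)) !mul0r mulr0 add0r.
  have -> : qbin q n n = qbin q n.+1 n.+1 by rewrite /= (qbin_small q (ltnSn n)) subnn expr0 mul1r add0r.
  have -> : (n.+1 + n.+1 = (2 * n).+2)%N by lia.
  have -> : (n + n = 2 * n)%N by lia.
  rewrite !facs_nil !mulr1 -mulrA -invfM; congr (_ / _).
  by rewrite facsr; [|lia].
have {}rn1 : (r < n)%N by lia.
set u := 1 - A * q ^+ r.+1; set w := 1 - A * q ^+ (n + r).+2.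
set t := 1 - A * q ^+ (2 * r).+2; set t1 := 1 - A * q ^+ (2 * r).+1.
set P1 := facs A r.+2 (2 * r).+2; set P2 := facs A (2 * r).+3 (n + r).+2.
have nz1 : u != 0 by apply: nz; lia.
have nz2 : w != 0 by apply: nz; lia.
have nz3 : t != 0 by apply: nz; lia.
have nz4 : t1 != 0 by apply: nz; lia.
have nz5 : P1 != 0 by apply: facs_neq0 => j hj; apply: nz; lia.
have nz6 : P2 != 0 by apply: facs_neq0 => j hj; apply: nz; lia.
have e1 : facs A r.+1 (2 * r).+2 = u * P1 by rewrite (facsl _ (_ : r.+1 < _)%N) //; lia.
have e2 : facs A (2 * r).+3 (n.+1 + r.+1).+1 = P2 * w.
  by rewrite addSn addnS facsr //; lia.
have e3 : facs A r.+2 (2 * r).+3 = P1 * t by rewrite facsr //; lia.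
have e4 : facs A (2 * r).+4 (n + r.+1).+2 * (1 - A * q ^+ (2 * r).+3) = P2 * w.
  rewrite -e2 addSn addnS (facsl A (_ : (2 * r).+3 < _)%N) 1?mulrC //; lia.
have e5 : facs A r.+1 (2 * r).+1 * t1 = u * P1.
  by rewrite -e1 (@facsr A r.+1 (2 * r).+1) //; lia.
have e6 : facs A (2 * r).+2 (n + r).+2 = t * P2 by rewrite facsl //; lia.
rewrite e1 e2 e3 e6.
have -> : qbin q n r.+1 / (P1 * t * facs A (2 * r).+4 (n + r.+1).+2) / (1 - A * q ^+ (2 * r).+3)
   = qbin q n r.+1 / (P1 * t * (P2 * w)).
  by rewrite -e4 -mulrA -invfM !mulrA.
have -> : qbin q n r / (facs A r.+1 (2 * r).+1 * (t * P2)) / t1 = qbin q n r / (u * P1 * (t * P2)).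
  by rewrite -e5 -mulrA -invfM; congr (_ / _); ring.
(* Denominators are cleared. The constant part of t uses one form of Pascal's rule, [qbinS2], and
   the part with A uses the other, [qbinS]. *)
have key : qbin q n.+1 r.+1 * t = q ^+ r.+1 * qbin q n r.+1 * u + qbin q n r * w.
  rewrite /t mulrBr mulr1 {1}qbinS2 // {1}qbinS /u /w.
  have -> : q ^+ (n + r).+2 = q ^+ (n - r) * q ^+ (2 * r).+2 by rewrite -exprD; congr (_ ^+ _); lia.
  have -> : q ^+ (2 * r).+2 = q ^+ r.+1 * q ^+ r.+1 by rewrite -exprD; congr (_ ^+ _); lia.
  by ring.
have -> : qbin q n.+1 r.+1 = (q ^+ r.+1 * qbin q n r.+1 * u + qbin q n r * w) / t.
  by rewrite -key mulfK.
by field; do ?[apply/andP; split].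
Qed.

(** Summation by parts along the change of base. It absorbs the upper entry n + 1 of the shifted
    binomial, and it gives 0 for coefficients with c_(r+1) = - q^r c_r. *)
Lemma bailey_conv (A : F) (c : nat -> F) n :
  (forall j, (0 < j <= (2 * n).+1)%N -> 1 - A * q ^+ j != 0) ->
  \sum_(r < n.+2) c r * bterm A r n.+1 =
  \sum_(r < n.+1) (q ^+ r * c r + c r.+1) * bterm' (A * q) r n.
Proof.
move=> nz; rewrite big_ord_recl bterm_conv0.
rewrite (eq_bigr (fun i : 'I_n.+1 => c i.+1 * (q ^+ i.+1 * bterm' (A * q) i.+1 n) +
    c i.+1 * bterm' (A * q) i n)); last first.
  by move=> i _; rewrite lift0 bterm_convS ?mulrDr // -ltnS.
rewrite big_split /= addrA.
under [in RHS]eq_bigr do rewrite mulrDl.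
rewrite big_split /=; congr (_ + _).
rewrite [in RHS]big_ord_recl expr0 mul1r; congr (_ + _).
rewrite big_ord_recr /= {2}/bterm' bterm_small // mul0r !mulr0 addr0.
by apply: eq_bigr => i _; rewrite mulrCA mulrA.
Qed.

Hypothesis qN1 : forall j, (0 < j)%N -> q ^+ j != 1.

Lemma qpoch_neq0 n : qpoch q n != 0.
Proof.
elim: n => [|n IH]; first by rewrite qpoch0 oner_neq0.
by rewrite qpochS mulf_neq0 // subr_eq0 eq_sym qN1.
Qed.

Lemma qbin_mul n k r : (r <= k <= n)%N ->
  qbin q n k * qbin q k r = qbin q n r * qbin q (n - r) (k - r).
Proof.
case/andP=> rk kn.
have e n' k' : (k' <= n')%N -> qbin q n' k' = qpoch q n' / (qpoch q k' * qpoch q (n' - k')).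
  by move=> h; rewrite -(qbin_qpoch q h) mulfK // mulf_neq0 ?qpoch_neq0.
rewrite !e; try lia.
have -> : (n - r - (k - r) = n - k)%N by lia.
by field; rewrite !qpoch_neq0.
Qed.

(** The Bailey lemma with both parameters sent to infinity. Since [n, k] [k, r] = [n, r]
    [n - r, k - r], it is [durfee] with n - r for M and A q^(2r) for B. *)
Lemma bailey_chain (A : F) r n : (r <= n)%N ->
  (forall j, ((2 * r).+1 <= j <= n + r)%N -> 1 - A * q ^+ j != 0) ->
  \sum_(k < n.+1) A ^+ k * q ^+ (k ^ 2) * qbin q n k * bterm A r k =
  A ^+ r * q ^+ (r ^ 2) * bterm A r n.
Proof.
move=> rn nz.
rewrite -(big_mkord xpredT (fun k => A ^+ k * q ^+ (k ^ 2) * qbin q n k * bterm A r k)).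
rewrite (@big_cat_nat _ _ _ r) //=; last by lia.
rewrite big_nat_cond big1 ?add0r; last first.
  by move=> k; rewrite andbT => /andP[_ h]; rewrite bterm_small ?mulr0.
rewrite -{1}[r]add0n big_addn subSn // big_mkord.
have nz' : facs A (2 * r).+1 (n + r).+1 != 0.
  by apply: facs_neq0 => j hj; apply: nz.
rewrite -[RHS]mulr1 -[X in _ = _ * X](durfee q (n - r) (A * q ^+ (2 * r))) mulr_sumr.
apply: eq_bigr => j _; have jn := ltn_ord j.
rewrite /bterm.
have -> : facs A (2 * r).+1 (n + r).+1 = facs A (2 * r).+1 (j + r + r).+1 * qfac q (A * q ^+ (2 * r) * q ^+ j.+1) (n - r - j).
  rewrite (@facs_cat _ _ (j + r + r).+1); last by lia.
  have -> : ((n + r).+1 = (j + r + r).+1 + (n - r - j))%N by lia.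
  rewrite facs_qfac -mulrA -exprD; congr (_ * qfac _ (_ * _ ^+ _) _); lia.
have nz1 : facs A (2 * r).+1 (j + r + r).+1 != 0.
  by apply: facs_neq0 => i hi; apply: nz; lia.
have nz2 : qfac q (A * q ^+ (2 * r) * q ^+ j.+1) (n - r - j) != 0.
  rewrite -mulrA -exprD -facs_qfac; apply: facs_neq0 => i hi; apply: nz; lia.
have h := @qbin_mul n (j + r) r; rewrite addnK in h.
transitivity (A ^+ (j + r) * q ^+ ((j + r) ^ 2) * (qbin q n (j + r) * qbin q (j + r) r) /
   (facs A r (2 * r) * facs A (2 * r).+1 (j + r + r).+1)); first by ring.
rewrite h; last by lia.
have -> : ((j + r) ^ 2 = r ^ 2 + j ^ 2 + 2 * r * j)%N by lia.
set u := qfac _ _ _ in nz2 *; rewrite 2!exprD exprMn -exprM.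
rewrite !invfM exprD; set v := (facs A r (2 * r))^-1.
by field; rewrite nz1 nz2.
Qed.

End BaileyChain.

(* Level i of the nested sum: k_i = n is fixed, k_1, ..., k_(i-1) are summed over,
   with k_0 = 0, and every entry carries an extra weight [wt]. *)
Fixpoint lev (A : comNzRingType) (a : nat) (q : A) (wt : nat -> A) (i n : nat) : A :=
  if i is i'.+1 then
    \sum_(k < (n + (i' == a)).+1)
      wt k * q ^+ (k ^ 2 + (a < i') * k) * qbin q (n + (i' == a)) k * lev a q wt i' k
  else (n == 0)%:R.

Lemma rmorph_lev (A B : comNzRingType) (f : {rmorphism A -> B}) a q wt i n :
  f (lev a q wt i n) = lev a (f q) (f \o wt) i n.
Proof.
elim: i n => [|i IH] n /=; first by rewrite rmorph_nat.
rewrite rmorph_sum; apply: eq_bigr => k _.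
by rewrite !rmorphM rmorphXn rmorph_qbin IH.
Qed.

(** Serves to clear negative powers of q: the weights x^(2k) = q^(-2Nk) become polynomial after
    multiplication by q^(2 N^2). The shifted binomial lets entries reach n + 1, whence the term
    [(a < i)] in the bound. *)
Lemma lev_scale (A : comNzRingType) a (q s : A) wt wt' N i n :
  (forall k, (k <= N)%N -> wt' k = s * wt k) -> (n + (a < i) <= N)%N ->
  lev a q wt' i n = s ^+ i * lev a q wt i n.
Proof.
move=> hw; elim: i n => [|i IH] n hn; first by rewrite expr0 mul1r.
rewrite /= mulr_sumr; apply: eq_bigr => k _.
have kn := ltn_ord k.
rewrite hw; last by lia.
rewrite IH ?exprS; first by ring.
by lia.
Qed.

Section LevClosedForm.
Variables (F : fieldType) (q : F).
Hypothesis qN1 : forall j, (0 < j)%N -> q ^+ j != 1.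

Lemma bailey_step (A : F) (c l : nat -> F) n :
  (forall j, (0 < j < 2 * n)%N -> 1 - A * q ^+ j != 0) ->
  (forall k, (k <= n)%N -> l k = \sum_(r < k.+1) c r * bterm q A r k) ->
  \sum_(k < n.+1) A ^+ k * q ^+ (k ^ 2) * qbin q n k * l k =
  \sum_(r < n.+1) c r * (A ^+ r * q ^+ (r ^ 2)) * bterm q A r n.
Proof.
move=> nz hl.
rewrite (eq_bigr (fun k : 'I_n.+1 => \sum_(r < n.+1)
    A ^+ k * q ^+ (k ^ 2) * qbin q n k * (c r * bterm q A r k))); last first.
  move=> k _; rewrite hl; last by rewrite -ltnS.
  rewrite mulr_sumr.
  rewrite (big_ord_widen n.+1 (fun r => A ^+ k * q ^+ (k ^ 2) * qbin q n k * (c r * bterm q A r k))) //.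
  rewrite big_mkcond; apply: eq_bigr => r _.
  by case: leqP => // h; rewrite bterm_small ?mulr0.
rewrite exchange_big; apply: eq_bigr => r _.
rewrite -mulrA -(bailey_chain qN1); first 2 last.
- by move=> j hj; apply: nz; have := ltn_ord r; lia.
- by rewrite mulr_sumr; apply: eq_bigr => k _; ring.
by rewrite -ltnS.
Qed.

Variables (A : F) (N a : nat).
Hypothesis Anz : forall j, (0 < j < 2 * N)%N -> 1 - A * q ^+ j != 0.

Let unitc r : F := (-1) ^+ r * q ^+ 'C(r, 2).

Let unitcS r : unitc r.+1 = - (q ^+ r * unitc r).
Proof. by rewrite /unitc binS bin1 exprS exprD; ring. Qed.

(** The unit Bailey pair: for positive index the coefficients q^r c_r + c_(r+1) of [bailey_conv] all
    vanish. *)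
Lemma lev_unit n : (n <= N)%N ->
  (n == 0)%:R = \sum_(r < n.+1) unitc r * bterm q A r n.
Proof.
case: n => [_|n nN].
  rewrite big_ord1 /unitc /bterm !expr0 /= muln0 !facs_nil.
  by rewrite !mulr1 invr1 !mulr1.
rewrite bailey_conv; last by move=> j hj; apply: Anz; lia.
by rewrite big1 // => r _; rewrite unitcS subrr mul0r.
Qed.

Lemma lev_le i n : (i <= a)%N -> (n <= N)%N ->
  lev a q (GRing.exp A) i n =
  \sum_(r < n.+1) unitc r * (A ^+ r * q ^+ (r ^ 2)) ^+ i * bterm q A r n.
Proof.
elim: i n => [|i IH] n ia nN.
  by rewrite [LHS]/= lev_unit //; apply: eq_bigr => r _; rewrite expr0 mulr1.
rewrite [LHS]/=.
have -> : (i == a) = false by lia.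
have -> : (a < i)%N = false by lia.
rewrite addn0.
rewrite (eq_bigr (fun k : 'I_n.+1 => A ^+ k * q ^+ (k ^ 2) * qbin q n k * lev a q (GRing.exp A) i k)); last first.
  by move=> k _; rewrite mul0n addn0.
rewrite (@bailey_step _ (fun r => unitc r * (A ^+ r * q ^+ (r ^ 2)) ^+ i)).
- by apply: eq_bigr => r _; rewrite exprSr !mulrA.
- by move=> j hj; apply: Anz; lia.
by move=> k kn; apply: IH; lia.
Qed.

(** The coefficient q^r c_r + c_(r+1) of [bailey_conv] for c_r = unitc r (A^r q^(r^2))^(a+1). Its
    last factor is the source of the two opposite spikes of chi in each block of length 2Q. *)
Let midc r : F := q ^+ r * unitc r * (A ^+ r * q ^+ (r ^ 2)) ^+ a.+1 *
  (1 - (A * q ^+ (2 * r).+1) ^+ a.+1).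

Lemma lev_mid n : (n < N)%N ->
  lev a q (GRing.exp A) a.+1 n = \sum_(r < n.+1) midc r * bterm' q (A * q) r n.
Proof.
move=> nN; rewrite [LHS]/= eqxx ltnn addn1.
rewrite (eq_bigr (fun k : 'I_n.+2 => A ^+ k * q ^+ (k ^ 2) * qbin q n.+1 k * lev a q (GRing.exp A) a k)); last first.
  by move=> k _; rewrite mul0n addn0.
rewrite (@bailey_step _ (fun r => unitc r * (A ^+ r * q ^+ (r ^ 2)) ^+ a)).
- rewrite (bailey_conv (fun r => unitc r * (A ^+ r * q ^+ (r ^ 2)) ^+ a * (A ^+ r * q ^+ (r ^ 2)))).
    apply: eq_bigr => r _; congr (_ * _).
    rewrite unitcS /midc.
    have -> : A ^+ r.+1 * q ^+ (r.+1 ^ 2) = (A ^+ r * q ^+ (r ^ 2)) * (A * q ^+ (2 * r).+1).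
      rewrite exprS; have -> : (r.+1 ^ 2 = r ^ 2 + (2 * r).+1)%N by lia.
      by rewrite exprD; ring.
    set D := A ^+ r * _; set E := A * _.
    by rewrite (exprMn _ D) !(exprSr _ a); ring.
  by move=> j hj; apply: Anz; lia.
- by move=> j hj; apply: Anz; lia.
by move=> k kn; apply: lev_le; lia.
Qed.

(** Above level a the extra q^k of the summand turns A^k into (A q)^k, so the chain continues
    relative to the base reached by [lev_mid]. *)
Lemma lev_closed j n : (n < N)%N ->
  lev a q (GRing.exp A) (j + a.+1) n =
  \sum_(r < n.+1) midc r * ((A * q) ^+ r * q ^+ (r ^ 2)) ^+ j * bterm' q (A * q) r n.
Proof.
elim: j n => [|j IH] n nN.
  by rewrite lev_mid //; apply: eq_bigr => r _; rewrite expr0 mulr1.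
rewrite addSn [LHS]/=.
have -> : (j + a.+1 == a) = false by lia.
have -> : (a < j + a.+1)%N = true by lia.
rewrite addn0.
rewrite (eq_bigr (fun k : 'I_n.+1 => (A * q) ^+ k * q ^+ (k ^ 2) * qbin q n k * lev a q (GRing.exp A) (j + a.+1) k)); last first.
  by move=> k _; rewrite mul1n exprD exprMn; ring.
(* The division by 1 - A q q^(2r) passes from [bterm'] to [bterm], to which the chain applies. *)
rewrite (@bailey_step _ (fun r => midc r * ((A * q) ^+ r * q ^+ (r ^ 2)) ^+ j / (1 - A * q * q ^+ (2 * r)))).
- by apply: eq_bigr => r _; rewrite exprSr /bterm'; ring.
- by move=> i hi; rewrite -mulrA -exprS; apply: Anz; lia.
move=> k kn; rewrite IH; last by lia.
by apply: eq_bigr => r _; rewrite /bterm'; ring.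
Qed.

End LevClosedForm.

Section FinalSum.
Variables (F : fieldType) (q x : F) (N : nat).
Hypothesis qN1 : forall j, (0 < j)%N -> q ^+ j != 1.
Hypothesis xqN : x * q ^+ N = 1.

Lemma qfac_qpoch r j : qpoch q (r + j) = qpoch q r * qfac q (q ^+ r.+1) j.
Proof.
elim: j => [|j IH]; first by rewrite addn0 qfac0 mulr1.
by rewrite addnS qpochS IH qfacSr -exprD addSn mulrA.
Qed.

(** As x = q^(-N), the factor 1 - x^2 q^j with j > 0 could vanish only for j = 2N. *)
Lemma xsq_neq0 j : (0 < j < 2 * N)%N -> 1 - x ^+ 2 * q ^+ j != 0.
Proof.
move=> hj; have q0 : q != 0.
  apply/eqP => e; move: xqN; rewrite e expr0n.
  have -> : (N == 0)%N = false by lia.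
  by rewrite mulr0 => /esym/eqP; rewrite oner_eq0.
have e : x ^+ 2 * q ^+ (2 * N) = 1 by rewrite mulnC exprM -exprMn xqN expr1n.
rewrite subr_eq0; apply/negP => /eqP h.
have /negP[] := @qN1 (2 * N - j) ltac:(lia).
apply/eqP/(mulfI (_ : x ^+ 2 * q ^+ j != 0)); first by rewrite -h oner_neq0.
by rewrite -mulrA -exprD subnKC ?e ?mulr1 //; lia.
Qed.

(** Here x q^(r+1) = q^(-M), so this is the reversal formula for (q^(-M))_j against (q)_(M-j). *)
Lemma final_aux r M j : N = (M + r).+1 -> (j <= M)%N ->
  qfac q (x * q ^+ r.+1) j * x ^+ j * qpoch q (M - j) =
  (-1) ^+ j * q ^+ 'C(j, 2) * (x ^+ 2 * q ^+ r.+1) ^+ j * qpoch q M.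
Proof.
move=> eN; elim: j => [|j IH] jM; first by rewrite qfac0 subn0 !expr0 !mul1r.
have e : (1 - x * q ^+ r.+1 * q ^+ j) * x = - (1 - q ^+ (M - j)) * q ^+ j * (x ^+ 2 * q ^+ r.+1).
  have h : x * (q ^+ (M - j) * q ^+ j * q ^+ r.+1) = 1.
    by rewrite -!exprD; have -> : (M - j + j + r.+1 = N)%N by lia.
  rewrite -[X in (X - _) * _]h; ring.
rewrite qfacSr (exprSr x) (exprS (-1)) binS bin1 exprD (exprSr (_ * _)).
transitivity (qfac q (x * q ^+ r.+1) j * x ^+ j * ((1 - x * q ^+ r.+1 * q ^+ j) * x) * qpoch q (M - j.+1)); first by ring.
rewrite e.
have := IH (ltnW jM); have -> : (M - j = (M - j.+1).+1)%N by lia.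
rewrite qpochS => h.
transitivity (- q ^+ j * (x ^+ 2 * q ^+ r.+1) * (qfac q (x * q ^+ r.+1) j * x ^+ j * (qpoch q (M - j.+1) * (1 - q ^+ (M - j.+1).+1)))); first by ring.
by rewrite h; ring.
Qed.

(** Shifting n by r leaves a terminating sum, which [final_aux] brings to the q-Vandermonde sum with
    b = q^(r+1) and z = x^2 q^(r+1). *)
Lemma final_sum r : (r < N)%N -> 1 - x != 0 ->
  \sum_(n < N) qfac q (x * q) n * x ^+ n * bterm' q (x ^+ 2 * q) r n = x ^+ r / (1 - x).
Proof.
move=> rN x1.
rewrite -(big_mkord xpredT (fun n => qfac q (x * q) n * x ^+ n * bterm' q (x ^+ 2 * q) r n)).
rewrite (@big_cat_nat _ _ _ r) //=; last by lia.
rewrite big_nat_cond big1 ?add0r; last first.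
  by move=> k; rewrite andbT => /andP[_ h]; rewrite /bterm' bterm_small // mul0r mulr0.
rewrite -{1}[r]add0n big_addn big_mkord.
set M := (N - r).-1; have -> : (N - r = M.+1)%N by rewrite /M; lia.
have eN : N = (M + r).+1 by rewrite /M; lia.
set A := x ^+ 2.
set P := facs q A r.+1 (2 * r).+2.
set b := q ^+ r.+1; set z := A * q ^+ r.+1.
have nzf c d : (0 < c)%N -> (d <= 2 * N)%N -> facs q A c d != 0.
  by move=> hc hd; apply: facs_neq0 => i hi; apply: xsq_neq0; lia.
have nzP : P != 0 by apply: nzf; lia.
have ebz : b * z = A * q ^+ (2 * r).+2.
  by rewrite /b /z mulrCA -exprD; congr (_ * _ ^+ _); lia.
have eqf j : qfac q (b * z) j = facs q A (2 * r).+2 ((2 * r).+2 + j) by rewrite facs_qfac ebz.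
have key (j : 'I_M.+1) : qfac q (x * q) (j + r) * x ^+ (j + r) * bterm' q (A * q) r (j + r) =
   (qfac q (x * q) r * x ^+ r / (P * qfac q (b * z) M)) * (qbin q M j *
     ((-1) ^+ j * q ^+ 'C(j, 2) * z ^+ j * qfac q b j * qfac q (b * z * q ^+ j) (M - j))).
  have jM : (j <= M)%N by rewrite -ltnS.
  have -> : bterm' q (A * q) r (j + r) = qbin q (r + j) r / (P * qfac q (b * z) j).
    rewrite /bterm' /bterm !facs_shift -[LHS]mulrA -invfM addnC; congr (_ / _).
    rewrite eqf /P (facsr q A (_ : r.+1 <= (2 * r).+1)%N); last by lia.
    rewrite -(mulrA A) -exprS.
    have -> : (((2 * r).+2 + j) = (r + j + r).+2)%N by lia.
    by ring.
  have nzb : qfac q (b * z) j != 0 by rewrite eqf; apply: nzf; lia.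
  have nzb2 : qfac q (b * z * q ^+ j) (M - j) != 0.
    by rewrite ebz -mulrA -exprD -facs_qfac; apply: nzf; lia.
  have -> : qfac q (b * z) M = qfac q (b * z) j * qfac q (b * z * q ^+ j) (M - j).
    by rewrite -qfac_cat subnKC.
  rewrite addnC qfac_cat exprD -mulrA -(mulrA x) -exprS.
  have e1 := final_aux eN jM.
  have nq := qpoch_neq0 qN1.
  have e2 : qbin q (r + j) r = qfac q b j / qpoch q j.
    apply: (mulIf (_ : qpoch q r * qpoch q j != 0)); first by rewrite mulf_neq0.
    have := @qbin_qpoch F q (r + j) r (leq_addr _ _); rewrite addKn => ->.
    by rewrite qfac_qpoch; field; rewrite nq.
  have e3 : qbin q M j = qpoch q M / (qpoch q j * qpoch q (M - j)).
    by rewrite -(qbin_qpoch q jM) mulfK // mulf_neq0.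
  have e4 : qfac q (x * q ^+ r.+1) j * x ^+ j = (-1) ^+ j * q ^+ 'C(j, 2) * z ^+ j * qpoch q M / qpoch q (M - j).
    by rewrite -e1 mulfK.
  transitivity (qfac q (x * q) r * x ^+ r * (qfac q (x * q ^+ r.+1) j * x ^+ j) * (qbin q (r + j) r / (P * qfac q (b * z) j))).
    by ring.
  rewrite e2 e3 e4; field; rewrite nzP nzb nzb2 !nq //.
rewrite (eq_bigr _ (fun j _ => key j)) -mulr_sumr qvandermonde.
have eA : A * q ^+ N = x by rewrite /A expr2 -mulrA xqN mulr1.
have e5 : qfac q z M * ((1 - x) * qfac q (x * q) r) = P * qfac q (b * z) M.
  rewrite -qfacSl -{1}eA -facs_qfac /z -facs_qfac eqf /P.
  have -> : (r.+1 + M = N)%N by lia.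
  rewrite -facs_cat; last by lia.
  rewrite -facs_cat; last by lia.
  by congr (facs _ _ _ _); lia.
have nz1 : qfac q (x * q) r != 0.
  have : facs q A N (N + r.+1) != 0 by apply: nzf; lia.
  by rewrite facs_qfac eA qfacSl mulf_eq0 negb_or => /andP[].
have nz2 : qfac q z M != 0.
  by rewrite /z -facs_qfac; apply: nzf; lia.
rewrite -e5; field; rewrite nz1 nz2 x1 //.
Qed.

End FinalSum.

(** The exponent of q in the r-th term of the closed form. Completing the square gives 8Q qexp0 +
    n0^2 = (n0 + 2Qr)^2, as [qexp0_sq] shows. *)
Definition qexp0 (m a r : nat) : nat :=
  ('C(r, 2) + r + r ^ 2 * a.+1 + (r + r ^ 2) * (m - a.+1))%N.

Section HikamiIdentity.
Variables (F : fieldType) (q : F) (N m a : nat).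
Hypothesis qN1 : forall j, (0 < j)%N -> q ^+ j != 1.
Hypotheses (N0 : (0 < N)%N) (am : (a < m)%N).

Lemma hikami_identity x : x * q ^+ N = 1 ->
  (1 - x) * (\sum_(n < N) qfac q (x * q) n * x ^+ n * lev a q (GRing.exp (x ^+ 2)) m n) =
  \sum_(r < N) (-1) ^+ r * x ^+ ((2 * m).+1 * r) * q ^+ (qexp0 m a r) *
     (1 - (x ^+ 2 * q ^+ (2 * r).+1) ^+ a.+1).
Proof.
move=> xqN.
have x1 : 1 - x != 0.
  rewrite subr_eq0; apply/negP => /eqP h; move: xqN; rewrite -h mul1r => /eqP.
  by apply/negP/qN1.
set c := fun r : nat => q ^+ r * ((-1) ^+ r * q ^+ 'C(r, 2)) * ((x ^+ 2) ^+ r * q ^+ (r ^ 2)) ^+ a.+1 *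
  (1 - (x ^+ 2 * q ^+ (2 * r).+1) ^+ a.+1) * ((x ^+ 2 * q) ^+ r * q ^+ (r ^ 2)) ^+ (m - a.+1).
rewrite (eq_bigr (fun n : 'I_N => \sum_(r < N) c r * (qfac q (x * q) n * x ^+ n * bterm' q (x ^+ 2 * q) r n))); last first.
  move=> n _; have nN := ltn_ord n.
  have em : m = (m - a.+1 + a.+1)%N by lia.
  rewrite {1}em (@lev_closed F q qN1 _ N a (xsq_neq0 qN1 xqN)) //.
  rewrite mulr_sumr.
  rewrite (big_ord_widen N (fun r => qfac q (x * q) n * x ^+ n *
   (q ^+ r * ((-1) ^+ r * q ^+ 'C(r, 2)) * ((x ^+ 2) ^+ r * q ^+ (r ^ 2)) ^+ a.+1 *
  (1 - (x ^+ 2 * q ^+ (2 * r).+1) ^+ a.+1) * ((x ^+ 2 * q) ^+ r * q ^+ (r ^ 2)) ^+ (m - a.+1) * bterm' q (x ^+ 2 * q) r n))) //.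
  rewrite big_mkcond; apply: eq_bigr => r _.
  case: ltnP => h; last by rewrite /bterm' (@bterm_small _ q _ r n) ?(mul0r, mulr0) //; lia.
  by rewrite mulrCA.
rewrite exchange_big mulr_sumr; apply: eq_bigr => r _.
rewrite -mulr_sumr (final_sum qN1 xqN) //.
rewrite mulrCA (mulrCA (1 - x)) mulfV // mulr1 /c /qexp0.
(* Each of the m levels contributes x^(2r), and [final_sum] contributes x^r. *)
have -> : x ^+ ((2 * m).+1 * r) = ((x ^+ 2) ^+ r) ^+ a.+1 * ((x ^+ 2) ^+ r) ^+ (m - a.+1) * x ^+ r.
  rewrite -!exprM -!exprD; congr (_ ^+ _).
  have := subnK am; set t := (m - a.+1)%N => <-; nia.
rewrite !exprD !exprMn (exprM q (r ^ 2)) (exprM q (r + r ^ 2)) exprD exprMn.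
by ring.
Qed.

End HikamiIdentity.

(** * The identity between polynomials and its specialisation at a root of unity *)

Lemma poly_nat_eq0 (F : numDomainType) (p : {poly F}) :
  (forall k : nat, p.[k.+2%:R] = 0) -> p = 0.
Proof.
move=> h; apply/eqP; case: eqVneq => // p0.
have := @max_poly_roots F p [seq k.+2%:R | k <- iota 0 (size p)] p0.
rewrite size_map size_iota ltnn => H; exfalso.
suff: false by []; apply: H.
  by apply/allP => _ /mapP[k _ ->]; apply/rootP; exact: h.
by rewrite map_inj_uniq ?iota_uniq // => i j /eqP; rewrite eqr_nat => /eqP[].
Qed.

Lemma natr_exp_neq1 (F : numDomainType) (k j : nat) : (0 < j)%N -> (k.+2%:R : F) ^+ j != 1.
Proof.
move=> j0; rewrite -natrX pnatr_eq1; apply/eqP => h.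
have := @ltn_expl k.+2 j isT; rewrite h; lia.
Qed.

Lemma horner_lev (F : comNzRingType) a (w : F) wt i n :
  (lev a 'X wt i n).[w] = lev a w (fun k => (wt k).[w]) i n.
Proof. by rewrite -[LHS]/(horner_eval w _) rmorph_lev /= [horner_eval w 'X]hornerX. Qed.

Lemma horner_signM (F : comNzRingType) r (p : {poly F}) w :
  ((-1) ^+ r * p).[w] = (-1) ^+ r * p.[w].
Proof. by rewrite hornerM -[((-1) ^+ r).[w]]/(horner_eval w _) rmorphXn rmorphN1. Qed.

Section HikamiPolynomial.
Variables (F : numFieldType) (N m a : nat).
Hypotheses (N0 : (0 < N)%N) (am : (a < m)%N).

(** The power of q that clears denominators: 2 N^2 for the outer sum and for each of the m levels,
    and N for 1 - x = q^(-N) (q^N - 1). It is at least what [n1] and [n2] subtract, so these natural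
    subtractions are exact. *)
Let E0 := (N + 2 * N ^ 2 * m.+1)%N.
Let n1 r := (E0 + qexp0 m a r - N * (2 * m).+1 * r)%N.
Let n2 r := (E0 + qexp0 m a r + a.+1 * (2 * r).+1 - N * (2 * m).+1 * r - 2 * N * a.+1)%N.

(** In the n-th term the share 2 N^2 of the outer sum is spent as N n on (xq)_n, N n on x^n, and the
    visible rest 2N(N - n). *)
Definition hikami_poly : {poly F} :=
  \sum_(n < N) (\prod_(j < n) ('X^N - 'X^(j.+1))) * 'X^(2 * N * (N - n)) *
     lev a 'X (fun k => 'X^(2 * N * (N - k))) m n.

Lemma hikami_poly_eq :
  ('X^N - 1) * hikami_poly = \sum_(r < N) (-1) ^+ r * ('X^(n1 r) - 'X^(n2 r)).
Proof.
(* The integers k + 2 serve as generic q: there are infinitely many, none of them zero or a root of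
   unity. *)
apply/eqP; rewrite -subr_eq0; apply/eqP/poly_nat_eq0 => k.
set q : F := k.+2%:R.
have q0 : q != 0 by rewrite pnatr_eq0.
have qN1 : forall j, (0 < j)%N -> q ^+ j != 1 by move=> j; exact: natr_exp_neq1.
rewrite hornerD hornerN hornerM hornerD hornerN hornerXn hornerC.
set x := (q ^+ N)^-1.
have xqN : x * q ^+ N = 1 by rewrite mulVf // expf_neq0.
have xE n : x ^+ n = (q ^+ (N * n))^-1 by rewrite /x exprVn exprM.
apply/eqP; rewrite subr_eq0; apply/eqP.
have -> : hikami_poly.[q] = q ^+ (2 * N ^ 2 * m.+1) * \sum_(n < N) qfac q (x * q) n * x ^+ n * lev a q (GRing.exp (x ^+ 2)) m n.
  rewrite /hikami_poly horner_sum mulr_sumr; apply: eq_bigr => n _.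
  have nN := ltn_ord n.
  rewrite !hornerM hornerXn horner_lev.
  rewrite (@lev_scale _ a q (q ^+ (2 * N ^ 2)) (GRing.exp (x ^+ 2)) _ N); first last.
  - by lia.
  - move=> i iN /=; rewrite hornerXn -exprM xE.
    apply: (mulIf (expf_neq0 (N * (2 * i)) q0)); rewrite mulfVK ?expf_neq0 // -exprD.
    by congr (_ ^+ _); nia.
  have -> : (\prod_(j < n) ('X^N - 'X^(j.+1))).[q] = q ^+ (N * n) * qfac q (x * q) n.
    rewrite horner_prod; elim: (nat_of_ord n) => [|n' IH].
      by rewrite big_ord0 muln0 qfac0 mulr1.
    rewrite big_ord_recr /= IH qfacSr mulnS exprD hornerD hornerN !hornerXn.
    have -> : q ^+ N - q ^+ n'.+1 = q ^+ N * (1 - x * q * q ^+ n').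
      by rewrite mulrBr mulr1 -(mulrA x) -exprS mulrA (mulrC _ x) xqN mul1r.
    by ring.
  have -> : q ^+ (2 * N ^ 2 * m.+1) = q ^+ (N * n) * q ^+ (N * n) * q ^+ (2 * N * (N - n)) * (q ^+ (2 * N ^ 2)) ^+ m.
    by rewrite -exprM -!exprD; congr (_ ^+ _); nia.
  have e : x ^+ n * q ^+ (N * n) = 1 by rewrite exprM -exprMn xqN expr1n.
  transitivity ((x ^+ n * q ^+ (N * n)) * (q ^+ (N * n) * qfac q (x * q) n * q ^+ (2 * N * (N - n)) *
    ((q ^+ (2 * N ^ 2)) ^+ m * lev a q (GRing.exp (x ^+ 2)) m n))); last by ring.
  by rewrite e mul1r.
have -> : q ^+ N - 1 = q ^+ N * (1 - x) by rewrite mulrBr mulr1 (mulrC _ x) xqN.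
rewrite mulrACA (hikami_identity qN1 N0 am xqN) -exprD mulr_sumr horner_sum; apply: eq_bigr => r _.
have rN := ltn_ord r.
rewrite horner_signM hornerD hornerN !hornerXn.
rewrite -/E0 exprMn -!exprM !xE -!mulrA mulrCA; congr (_ * _).
rewrite !mulrBr !mulr1.
have Q0 : (N * (2 * m).+1 * r + 2 * N * a.+1 <= E0)%N by rewrite /E0; nia.
congr (_ - _).
  apply: (mulIf (expf_neq0 (N * ((2 * m).+1 * r)) q0)).
  rewrite -exprD [X in _ = q ^+ X](_ : _ = E0 + qexp0 m a r)%N; last by rewrite /n1; lia.
  by rewrite exprD; clearbody q; field; rewrite !expf_neq0.
apply: (mulIf (expf_neq0 (N * ((2 * m).+1 * r) + N * (2 * a.+1)) q0)).
rewrite -exprD [X in _ = q ^+ X](_ : _ = E0 + qexp0 m a r + (2 * r).+1 * a.+1)%N; last by rewrite /n2; lia.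
by rewrite !exprD; clearbody q; field; rewrite !expf_neq0.
Qed.

Section AtRoot.
Variable w : F.
Hypothesis wN : w ^+ N = 1.

Lemma horner_hikami_poly :
  hikami_poly.[w] = \sum_(n < N) qpoch w n * lev a w (fun=> 1) m n.
Proof.
rewrite /hikami_poly horner_sum; apply: eq_bigr => n _.
have wk i : w ^+ (2 * N * i) = 1 by rewrite -mulnA mulnCA exprM wN expr1n.
rewrite !hornerM hornerXn wk mulr1 horner_lev.
congr (_ * _).
  rewrite horner_prod /qpoch big_add1 big_mkord; apply: eq_bigr => j _.
  by rewrite hornerD hornerN !hornerXn wN.
rewrite (@lev_scale _ a w 1 (fun=> 1) _ N) ?expr1n ?mul1r //.
  by move=> k _ /=; rewrite hornerXn wk.
by have := ltn_ord n; lia.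
Qed.

(** The value of the identity where X^N - 1 vanishes. It allows a common constant to be dropped from
    all exponents in [hikami_root1]. *)
Lemma hikami_root0 : \sum_(r < N) (-1) ^+ r * (w ^+ n1 r - w ^+ n2 r) = 0.
Proof.
have := congr1 (fun p : {poly F} => p.[w]) hikami_poly_eq.
rewrite /= hornerM hornerD hornerN hornerXn hornerC wN subrr mul0r horner_sum => h; rewrite [RHS]h.
apply: eq_bigr => r _.
by rewrite horner_signM hornerD hornerN !hornerXn.
Qed.

(** Apply w d/dX. On the left only the derivative of X^N - 1 survives at w; on the right every
    monomial is multiplied by its exponent. *)
Lemma hikami_root1 :
  N%:R * \sum_(n < N) qpoch w n * lev a w (fun=> 1) m n =
  \sum_(r < N) (-1) ^+ r * ((n1 r)%:R * w ^+ n1 r - (n2 r)%:R * w ^+ n2 r).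
Proof.
have := congr1 (fun p : {poly F} => w * p^`().[w]) hikami_poly_eq.
have dX k : w * (('X^k)^`()).[w] = k%:R * w ^+ k.
  rewrite derivXn hornerMn hornerXn; case: k => [|k]; first by rewrite mulr0n mulr0 mul0r.
  by rewrite mulrnAr -exprS mulr_natl.
rewrite /= derivM hornerD !hornerM derivB derivC subr0 mulrDr mulrA dX.
rewrite hornerD hornerN hornerXn hornerC wN subrr mul0r mulr0 addr0 mulr1.
rewrite horner_hikami_poly => ->.
rewrite raddf_sum horner_sum mulr_sumr; apply: eq_bigr => r _.
have -> : ((-1) ^+ r : {poly F}) = ((-1) ^+ r)%:P by rewrite rmorphXn rmorphN1.
by rewrite /= mul_polyC derivZ hornerZ derivB hornerD hornerN mulrCA mulrBr !dX.
Qed.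

End AtRoot.
End HikamiPolynomial.

(** * From the sum over tuples to the nested sums *)

Lemma sum_tuple_rcons (V : nmodType) (T : finType) n (f : seq T -> V) :
  \sum_(k : n.+1.-tuple T) f k = \sum_(x : T) \sum_(k : n.-tuple T) f (rcons k x).
Proof.
rewrite pair_big /=.
pose h (p : T * n.-tuple T) : n.+1.-tuple T := [tuple of rcons p.2 p.1].
have hbij : bijective h.
  apply: inj_card_bij.
    move=> [x s] [y t] /(congr1 val) /= /rcons_inj [] /val_inj -> -> //.
  by rewrite card_prod !card_tuple expnS.
by rewrite (reindex h (onW_bij _ hbij)).
Qed.

Section NestedSum.
Variables (F : fieldType) (w : F) (a N : nat).

Let W i k n : F := w ^+ (k ^ 2 + (a < i) * k) * qbin w (n + (i == a)) k.

Let g (k : seq 'I_N.+1) i := nth 0%N [seq val x | x <- k] i.-1.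

Lemma lev1 n : lev a w (fun=> 1) 1 n = 1.
Proof.
rewrite /= big_ord_recl big1 ?addr0; last by move=> i _; rewrite lift0 mulr0.
by rewrite muln0 expr0 qbin0 !mulr1.
Qed.

Lemma levS i n : (n + (a <= i.+1) <= N)%N ->
  lev a w (fun=> 1) i.+2 n = \sum_(k < N.+1) W i.+1 k n * lev a w (fun=> 1) i.+1 k.
Proof.
move=> hn; rewrite [LHS]/=.
set f := fun k : nat => W i.+1 k n * lev a w (fun=> 1) i.+1 k.
have le : ((n + (i.+1 == a)).+1 <= N.+1)%N by move: hn; case: ltngtP => /=; lia.
transitivity (\sum_(k < (n + (i.+1 == a)).+1) f k).
  by apply: eq_bigr => k _; rewrite /f /W mul1r.
rewrite (big_ord_widen _ f le) big_mkcond; apply: eq_bigr => k _.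
by case: ltnP => // h; rewrite /f /W qbin_small ?mulr0 ?mul0r.
Qed.

(** The last entry is split off and its factor becomes the new H. The vanishing of H near the top
    keeps the upper entry n + 1 of the shifted binomial at most N, so that [0, N] contains the
    support of the next sum. *)
Lemma nested_sum_lev i (H : nat -> F) :
  (forall n, (N < n + (a < i.+1))%N -> H n = 0) ->
  \sum_(k : i.+1.-tuple 'I_N.+1)
     (\prod_(1 <= j < i.+1) W j (g k j) (g k j.+1)) * H (g k i.+1) =
  \sum_(n < N.+1) lev a w (fun=> 1) i.+1 n * H n.
Proof.
elim: i H => [|i IH] H hH.
  rewrite (sum_tuple_rcons 0 (fun k => (\prod_(1 <= j < 1) W j (g k j) (g k j.+1)) * H (g k 1%N))).
  apply: eq_bigr => x _; rewrite lev1 mul1r (big_pred1 [tuple]); last first.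
    by move=> t; apply/esym/eqP; exact: tuple0.
  by rewrite big_geq // mul1r.
rewrite (sum_tuple_rcons i.+1 (fun k => (\prod_(1 <= j < i.+2) W j (g k j) (g k j.+1)) * H (g k i.+2))).
apply: eq_bigr => x _.
case: (leqP (x + (a < i.+2)) N) => hx; last first.
  rewrite hH // mulr0 big1 // => k _.
  rewrite {3}/g map_rcons nth_rcons size_map size_tuple /= ltnn eqxx.
  by rewrite hH // mulr0.
rewrite levS; last by move: hx; rewrite ltnS.
transitivity ((\sum_(k : i.+1.-tuple 'I_N.+1)
     (\prod_(1 <= j < i.+1) W j (g k j) (g k j.+1)) * W i.+1 (g k i.+1) x) * H x).
  rewrite mulr_suml; apply: eq_bigr => k _.
  have e j : (j < i.+2)%N -> (0 < j)%N -> g (rcons k x) j = g k j.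
    by move=> h h0; rewrite /g map_rcons nth_rcons size_map size_tuple; case: ifP => //; lia.
  have e2 : g (rcons k x) i.+2 = x.
    by rewrite /g map_rcons nth_rcons size_map size_tuple /= ltnn eqxx.
  rewrite big_nat_recr //= e2 (e i.+1) //; congr (_ * _ * _).
  by apply: eq_big_nat => j hj; rewrite !e //; lia.
congr (_ * _); rewrite (IH (fun k => W i.+1 k x)).
  by apply: eq_bigr => k _; rewrite mulrC.
move=> n hn; rewrite /W qbin_small ?mulr0 //.
by move: hx hn; case: (ltngtP a i.+1) => /=; lia.
Qed.

End NestedSum.

Lemma prod_skip_factor (F : comNzRingType) (m a : nat) (f : nat -> F) c : (a < m)%N ->
  (a != 0%N -> f a = c) ->
  (\prod_(1 <= i < m | i != a) f i) * (if a == 0%N then 1 else c) = \prod_(1 <= i < m) f i.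
Proof.
move=> am; case: eqVneq => [->|a0] fa.
  rewrite mulr1 big_nat_cond [RHS]big_nat_cond; apply: eq_bigl => i.
  by case: eqVneq => [->|]; rewrite ?andbT.
rewrite [RHS](bigD1_seq a) ?iota_uniq //=; last by rewrite mem_index_iota; lia.
by rewrite fa // mulrC.
Qed.

Lemma X_lev (R : realType) m a N : (a < m)%N -> (0 < N)%N -> omega R N ^+ N = 1 ->
  X R m a N = \sum_(n < N) qpoch (omega R N) n * lev a (omega R N) (fun=> 1) m n.
Proof.
move=> am N0 wN; rewrite /X; set w := omega R N in wN *.
case: m am => // m am.
have qN : qpoch w N = 0.
  by case: N N0 @w wN => // N _ w wN; rewrite qpochS wN subrr mulr0.
transitivity (\sum_(n < N.+1) lev a w (fun=> 1) m.+1 n * qpoch w n).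
  rewrite -(@nested_sum_lev _ w a N m (qpoch w)); last first.
    move=> n; have -> : (a < m.+1)%N by []. rewrite addn1 ltnS leq_eqVlt => /orP[/eqP <- //|h].
    have -> : (n = (n - N.+1 + N).+1)%N by lia.
    rewrite -(qbin_qpoch w (_ : N <= (n - N.+1 + N).+1)%N) ?qN ?mul0r ?mulr0 //; lia.
  apply: eq_bigr => k _.
  rewrite -!/(entry k _) [RHS]mulrC -!mulrA; congr (_ * _).
  rewrite [in RHS]big_split /= -expr_sum big_split /=; congr (w ^+ (_ + _) * _).
    rewrite [RHS](@big_cat_nat _ _ _ a.+1) //= [X in _ = (X + _)%N]big_nat_cond [X in _ = (X + _)%N]big1 ?add0n; last first.
      by move=> i; rewrite andbT => hi; have -> : (a < i)%N = false by lia.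
    apply: eq_big_nat => i hi; have -> : (a < i)%N by lia.
    by rewrite mul1n.
  rewrite -(@prod_skip_factor _ m.+1 a _ (gauss_poly R[i] (entry k a.+1).+1 (entry k a)).[w]) //; last first.
    by move=> _; rewrite horner_gauss_poly eqxx addn1.
  congr (_ * _); apply: eq_bigr => i /negbTE ->.
  by rewrite horner_gauss_poly addn0.
rewrite big_ord_recr /= qN mulr0 addr0; apply: eq_bigr => n _; exact: mulrC.
Qed.

(** * Quadratic Gauss sums *)

Section Cis.
Variable R : realType.
Implicit Types s t : R.

Definition cis t : R[i] := cos t +i* sin t.
Arguments cis : simpl never.

Lemma cisD s t : cis (s + t) = cis s * cis t.
Proof. by rewrite /cis cosD sinD; simpc; congr (_ +i* _); ring. Qed.

Lemma cis0 : cis 0 = 1.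
Proof. by rewrite /cis cos0 sin0. Qed.

Lemma cexp_cis t : cexp (t%:C * 'i%C) = cis t.
Proof.
have -> : t%:C * 'i%C = 0 +i* t by simpc.
by rewrite /cexp /= expR0 mul1r.
Qed.

Lemma cisVK t : cis t * cis (- t) = 1.
Proof. by rewrite -cisD subrr cis0. Qed.

Lemma cis_neq0 t : cis t != 0.
Proof. by apply/eqP => h; have := cisVK t; rewrite h mul0r => /esym/eqP; rewrite oner_eq0. Qed.

Lemma cisN t : cis (- t) = (cis t)^-1.
Proof. by apply: (mulfI (cis_neq0 t)); rewrite cisVK mulfV ?cis_neq0. Qed.

Lemma cisX t n : cis t ^+ n = cis (t * n%:R).
Proof.
elim: n => [|n IH]; first by rewrite expr0 mulr0 cis0.
by rewrite exprSr IH -cisD -natr1 mulrDr mulr1.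
Qed.

Lemma conjc_cis t : (cis t)^*%C = (cis t)^-1.
Proof. by rewrite -cisN /cis cosN sinN. Qed.

Lemma normc_cis t : `|cis t| = 1.
Proof. by rewrite normc_def /= cos2Dsin2 sqrtr1. Qed.

Lemma cis_2pi : cis (2 * pi) = 1.
Proof. by rewrite /cis mulr_natl mulr2n cosDpi sinDpi cospi sinpi opprK oppr0. Qed.

Lemma cis_2pi_nat n : cis (2 * pi * n%:R) = 1.
Proof. by rewrite -cisX cis_2pi expr1n. Qed.

Lemma cis_2pi_int (z : int) : cis (2 * pi * z%:~R) = 1.
Proof.
case: z => n; first exact: cis_2pi_nat.
by rewrite NegzE mulrNz mulrN cisN -[X in (X)^-1](_ : 1 = _) ?invr1 // cis_2pi_nat.
Qed.

Lemma cis_eq1 t : 0 <= t < 2 * pi -> cis t = 1 -> t = 0.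
Proof.
move=> /andP[t0 t2] [] h1 h2.
case: (ltP 0 t) => [tp|]; last by move=> h; apply/eqP; rewrite eq_le h t0.
exfalso; case: (ltgtP t pi) => h.
- by have := @sin_gt0_pi _ t; rewrite tp h h2 ltxx => /(_ isT).
- have := @sin_gt0_pi _ (t - pi); rewrite subr_gt0 h ltrBlDr -mulr2n -mulr_natl t2 sinB cospi sinpi h2.
  by rewrite mulr0 mul0r subr0 ltxx => /(_ isT).
- by move: h1; rewrite h cospi => /eqP; rewrite -subr_eq0 -opprD oppr_eq0 -(natrD _ 1 1) pnatr_eq0.
Qed.

Lemma omega_cis N : omega R N = cis (2 * pi / N%:R).
Proof. exact: cexp_cis. Qed.

End Cis.
Arguments cis : simpl never.

Section RogersSzego.
Variable A : comNzRingType.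
Variable q : A.

Definition rszego (t : A) n : A := \sum_(k < n.+1) qbin q n k * t ^+ k.

Lemma rszegoS t n : rszego t n.+1 = rszego t n + t * \sum_(k < n.+1) qbin q n k * (q ^+ (n - k) * t ^+ k).
Proof.
rewrite /rszego (qbin_sum q n (fun k => t ^+ k)); congr (_ + _).
by rewrite mulr_sumr; apply: eq_bigr => k _; rewrite exprS; ring.
Qed.

Lemma rszego_rec t n :
  rszego t n.+2 = (1 + t) * rszego t n.+1 - (1 - q ^+ n.+1) * t * rszego t n.
Proof.
rewrite rszegoS mulrDl mul1r -addrA; congr (_ + _).
rewrite -(mulrA _ t) (mulrCA _ t) -mulrBr; congr (t * _).
rewrite /rszego mulr_sumr.
have -> : \sum_(k < n.+2) qbin q n.+1 k * (q ^+ (n.+1 - k) * t ^+ k) = \sum_(k < n.+1) (q ^+ (n.+1 - k) * qbin q n.+1 k) * t ^+ k + qbin q n.+1 n.+1 * t ^+ n.+1.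
  rewrite big_ord_recr; congr (_ + _); first by apply: eq_bigr => k _; ring.
  by rewrite [nat_of_ord ord_max]/= subnn expr0 mul1r.
have -> : \sum_(k < n.+2) qbin q n.+1 k * t ^+ k = \sum_(k < n.+1) qbin q n.+1 k * t ^+ k + qbin q n.+1 n.+1 * t ^+ n.+1 by rewrite big_ord_recr.
rewrite addrAC; congr (_ + _); rewrite -sumrB; apply: eq_bigr => k _.
have kn : (k <= n)%N by rewrite -ltnS.
rewrite mulrA -mulrBl; congr (_ * _).
have -> : (1 - q ^+ n.+1) * qbin q n k = (1 - q ^+ (n.+1 - k)) * qbin q n.+1 k; last by ring.
have h1 := qbin_absorb q (leqW kn).
rewrite -h1 qbinS mulrDr qbin_absorb //.
have -> : q ^+ n.+1 = q ^+ (n - k) * q ^+ k.+1 by rewrite -exprD; congr (_ ^+ _); lia.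
by ring.
Qed.

End RogersSzego.

(** The product solves the three-term recurrence at q = p^2, t = p. This is Gauss's route to the
    sign of the quadratic sum, which its modulus does not reveal. *)
Lemma rszego_half (A : comNzRingType) (p : A) n :
  rszego (p ^+ 2) p n = \prod_(1 <= i < n.+1) (1 + p ^+ i).
Proof.
suff: rszego (p ^+ 2) p n = \prod_(1 <= i < n.+1) (1 + p ^+ i) /\
  rszego (p ^+ 2) p n.+1 = \prod_(1 <= i < n.+2) (1 + p ^+ i) by case.
elim: n => [|n [IH1 IH2]].
  rewrite big_geq // big_nat1 /rszego big_ord1 big_ord_recl big_ord1 /=.
  by rewrite addn0 subnn !expr0 !mulr1 add0r mul1r.
split=> //; rewrite rszego_rec IH2 big_nat_recr //= [in RHS]big_nat_recr //= [in RHS]big_nat_recr //= IH1.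
rewrite -exprM; have -> : (2 * n.+1 = n.+1 + n.+1)%N by lia.
by rewrite exprD (exprS p n.+1); ring.
Qed.

(** [M, k + 1] vanishes at a primitive M-th root of unity, so Pascal's rule leads from k to k + 1
    with the factor - q^(M-1-k). *)
Lemma qbin_primitive (F : fieldType) (q : F) M k : q ^+ M = 1 ->
  (forall j, (0 < j < M)%N -> q ^+ j != 1) -> (k < M)%N ->
  qbin q M.-1 k * q ^+ 'C(k.+1, 2) = (-1) ^+ k.
Proof.
case: M => // M qM qp; rewrite [M.+1.-1]/=; elim: k => [|k IH] kM.
  by rewrite qbin0 expr0 mul1r.
have z : qbin q M.+1 k.+1 = 0.
  apply/eqP; have := qbin_qpoch q (ltnW kM); rewrite (qpochS q M) qM subrr mulr0 => /eqP.
  rewrite !mulf_eq0 => /orP[//|/orP[]] h; exfalso.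
    have : qpoch q k.+1 != 0.
      by rewrite /qpoch prodf_seq_neq0; apply/allP => j; rewrite mem_index_iota => hj /=; rewrite subr_eq0 eq_sym qp //; lia.
    by rewrite h.
  have : qpoch q (M.+1 - k.+1) != 0.
    by rewrite /qpoch prodf_seq_neq0; apply/allP => j; rewrite mem_index_iota => hj /=; rewrite subr_eq0 eq_sym qp //; lia.
  by rewrite h.
have e : qbin q M k.+1 = - (q ^+ (M - k) * qbin q M k) by apply/eqP; rewrite -addr_eq0 -qbinS z.
rewrite e binS bin1 exprD (exprS (-1)) mulN1r -(IH (ltnW kM)).
have q1 : q ^+ (M - k) * q ^+ k.+1 = 1 by rewrite -exprD; have -> : (M - k + k.+1 = M.+1)%N by lia.
transitivity (- (q ^+ (M - k) * q ^+ k.+1 * (qbin q M k * q ^+ 'C(k.+1, 2)))); first by ring.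
by rewrite q1 mul1r.
Qed.

(** * Real modulus and differentiation of complex-valued functions of a real variable *)

Section ComplexModulus.
Variable R : realType.
Implicit Types z w : R[i].

Lemma ReD z w : complex.Re (z + w) = complex.Re z + complex.Re w.
Proof. by case: z w => a b [c d]. Qed.

Lemma ImD z w : complex.Im (z + w) = complex.Im z + complex.Im w.
Proof. by case: z w => a b [c d]. Qed.

Lemma ReM z w : complex.Re (z * w) = complex.Re z * complex.Re w - complex.Im z * complex.Im w.
Proof. by case: z w => a b [c d]. Qed.

Lemma ImM z w : complex.Im (z * w) = complex.Re z * complex.Im w + complex.Im z * complex.Re w.
Proof. by case: z w => a b [c d]. Qed.

(** The norm on [R[i]] takes its values in [R[i]]; estimates are carried out in R. *)
Definition cabs z : R := complex.Re `|z|.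

Lemma cabsE z : `|z| = (cabs z)%:C.
Proof. by rewrite /cabs normc_def. Qed.

Lemma cabs_def z : cabs z = Num.sqrt (complex.Re z ^+ 2 + complex.Im z ^+ 2).
Proof. by rewrite /cabs normc_def. Qed.

Lemma cabs_ge0 z : 0 <= cabs z.
Proof. by rewrite cabs_def sqrtr_ge0. Qed.

Lemma cabs0 : cabs 0 = 0.
Proof. by rewrite /cabs normr0. Qed.

Lemma cabs1 : cabs 1 = 1.
Proof. by rewrite /cabs normr1. Qed.

Lemma cabsN z : cabs (- z) = cabs z.
Proof. by rewrite /cabs normrN. Qed.

Lemma cabsM z w : cabs (z * w) = cabs z * cabs w.
Proof. by apply: complexI; rewrite rmorphM /= -!cabsE normrM. Qed.

Lemma cabsD z w : cabs (z + w) <= cabs z + cabs w.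
Proof. by rewrite -lecR rmorphD /= -!cabsE ler_normD. Qed.

Lemma cabsB z w : cabs (z - w) <= cabs z + cabs w.
Proof. by rewrite -(cabsN w) cabsD. Qed.

Lemma cabs_distC z w : cabs (z - w) = cabs (w - z).
Proof. by rewrite -cabsN opprB. Qed.

Lemma cabsX z n : cabs (z ^+ n) = cabs z ^+ n.
Proof. by elim: n => [|n IH]; rewrite ?cabs1 // !exprS cabsM IH. Qed.

Lemma cabsV z : cabs z^-1 = (cabs z)^-1.
Proof. by apply: complexI; rewrite fmorphV /= -!cabsE normfV. Qed.

Lemma cabs_eq0 z : cabs z = 0 -> z = 0.
Proof. by move=> h; apply/eqP; rewrite -normr_eq0 cabsE h. Qed.

Lemma cabs_gt0 z : z != 0 -> 0 < cabs z.
Proof. by move=> z0; rewrite lt_neqAle cabs_ge0 andbT eq_sym; apply: contra_neq z0 => /cabs_eq0. Qed.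

Lemma cabs_real (x : R) : cabs x%:C = `|x|.
Proof. by rewrite cabs_def /= expr0n addr0 sqrtr_sqr. Qed.

Lemma cabs_nat n : cabs n%:R = n%:R.
Proof. by rewrite -(rmorph_nat (real_complex R)) cabs_real normr_nat. Qed.

Lemma cabs_i : cabs 'i%C = 1.
Proof. by rewrite cabs_def /= expr0n add0r expr1n sqrtr1. Qed.

Lemma cabs_cis t : cabs (cis t) = 1.
Proof. by rewrite /cabs normc_cis. Qed.

Lemma cabs_sum I (r : seq I) (P : pred I) (F : I -> R[i]) :
  cabs (\sum_(i <- r | P i) F i) <= \sum_(i <- r | P i) cabs (F i).
Proof.
elim/big_ind2: _ => [|x x' y y' h1 h2|//]; first by rewrite cabs0.
by apply: le_trans (cabsD _ _) _; apply: lerD.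
Qed.

Lemma Re_le_cabs z : `|complex.Re z| <= cabs z.
Proof. by rewrite cabs_def -sqrtr_sqr ler_wsqrtr // lerDl sqr_ge0. Qed.

Lemma Im_le_cabs z : `|complex.Im z| <= cabs z.
Proof. by rewrite cabs_def -sqrtr_sqr ler_wsqrtr // lerDr sqr_ge0. Qed.

Lemma cabs_le_ReIm z : cabs z <= `|complex.Re z| + `|complex.Im z|.
Proof.
have {1}-> : z = (complex.Re z)%:C + (complex.Im z)%:C * 'i%C by case: z => a b; simpc.
by apply: le_trans (cabsD _ _) _; rewrite cabsM cabs_i mulr1 !cabs_real.
Qed.

End ComplexModulus.

Section ComplexDerivative.
Variable R : realType.
Implicit Types (f g : R -> R[i]) (x t : R).

Definition cderiv f x (l : R[i]) : Prop :=
  is_derive x (1 : R) (fun t => complex.Re (f t)) (complex.Re l) /\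
  is_derive x (1 : R) (fun t => complex.Im (f t)) (complex.Im l).

Lemma cderiv_eq f x l l' : cderiv f x l -> l = l' -> cderiv f x l'.
Proof. by move=> h <-. Qed.

Lemma cderiv_ext f g x l : (forall t, f t = g t) -> cderiv f x l -> cderiv g x l.
Proof. by move=> /funext ->. Qed.

Lemma cderiv_cst (c : R[i]) x : cderiv (fun=> c) x 0.
Proof. by split; exact: is_derive_cst. Qed.

Lemma cderivD f g x l l' : cderiv f x l -> cderiv g x l' ->
  cderiv (fun t => f t + g t) x (l + l').
Proof.
move=> [h1 h2] [h3 h4]; split.
  have := is_deriveD h1 h3; congr (is_derive _ _ _ _); last by rewrite ReD.
  by apply/funext => t; rewrite ReD.
have := is_deriveD h2 h4; congr (is_derive _ _ _ _); last by rewrite ImD.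
by apply/funext => t; rewrite ImD.
Qed.

Lemma cderivM f g x l l' : cderiv f x l -> cderiv g x l' ->
  cderiv (fun t => f t * g t) x (l * g x + f x * l').
Proof.
move=> [h1 h2] [h3 h4]; split.
  have := is_deriveB (is_deriveM h1 h3) (is_deriveM h2 h4); congr (is_derive _ _ _ _).
    by apply/funext => t; rewrite ReM.
  by rewrite /GRing.scale /= ReD !ReM; ring.
have := is_deriveD (is_deriveM h1 h4) (is_deriveM h2 h3); congr (is_derive _ _ _ _).
  by apply/funext => t; rewrite ImM.
by rewrite /GRing.scale /= ImD !ImM; ring.
Qed.

Lemma cderivZ c f x l : cderiv f x l -> cderiv (fun t => c * f t) x (c * l).
Proof. by move=> h; have := cderivM (cderiv_cst c x) h; rewrite mul0r add0r. Qed.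

Lemma cderivN f x l : cderiv f x l -> cderiv (fun t => - f t) x (- l).
Proof.
move=> /(cderivZ (-1)); rewrite mulN1r; apply: cderiv_ext => t.
by rewrite mulN1r.
Qed.

Lemma cderivB f g x l l' : cderiv f x l -> cderiv g x l' ->
  cderiv (fun t => f t - g t) x (l - l').
Proof. by move=> h /cderivN; exact: cderivD. Qed.

Lemma cderiv_sum n (f : 'I_n -> R -> R[i]) x (l : 'I_n -> R[i]) :
  (forall i, cderiv (f i) x (l i)) ->
  cderiv (fun t => \sum_(i < n) f i t) x (\sum_(i < n) l i).
Proof.
elim: n f l => [|n IH] f l h.
  rewrite big_ord0; apply: cderiv_ext (cderiv_cst 0 x) => t.
  by rewrite big_ord0.
rewrite big_ord_recr; apply: cderiv_ext (cderivD (IH _ _ (fun i => h (widen_ord (leqnSn n) i))) (h ord_max)) => t.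
by rewrite big_ord_recr.
Qed.

Lemma cderiv_real (f : R -> R) x l : is_derive x 1 f l -> cderiv (fun t => (f t)%:C) x l%:C.
Proof. by move=> h; split => //=; exact: is_derive_cst. Qed.

Lemma cderiv_comp f (g : R -> R) x l d : cderiv f (g x) l -> is_derive x 1 g d ->
  cderiv (fun t => f (g t)) x (l * d%:C).
Proof.
move=> [h1 h2] h; split.
  have := is_derive1_comp h1 h; congr (is_derive _ _ _ _).
  by case: l {h1 h2} => a b; simpc.
have := is_derive1_comp h2 h; congr (is_derive _ _ _ _).
by case: l {h1 h2} => a b; simpc.
Qed.

Lemma cderivX f x l n : cderiv f x l ->
  cderiv (fun t => f t ^+ n.+1) x (n.+1%:R * f x ^+ n * l).
Proof.
move=> h; elim: n => [|n IH].
  by rewrite expr0 !mul1r; apply: cderiv_ext h => t; rewrite expr1.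
apply: cderiv_eq (cderiv_ext _ (cderivM h IH)) _ => [t|]; first by rewrite -exprS.
by rewrite -[n.+2%:R]natr1 exprS; ring.
Qed.

Lemma cderiv_horner (p : {poly R[i]}) f x l : cderiv f x l ->
  cderiv (fun t => p.[f t]) x (p^`().[f x] * l).
Proof.
move=> h; elim/poly_ind: p => [|p c IH].
  by rewrite deriv0 horner0 mul0r; apply: cderiv_ext (cderiv_cst 0 x) => t; rewrite horner0.
apply: cderiv_eq (cderiv_ext _ (cderivD (cderivM IH h) (cderiv_cst c x))) _ => [t|].
  by rewrite hornerMXaddC.
by rewrite derivD derivM derivX derivC !hornerE; ring.
Qed.

Lemma cderiv_cis x : cderiv (@cis R) x ('i%C * cis x).
Proof.
split; rewrite /cis /=; simpc => /=.
  exact: is_derive_cos.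
exact: is_derive_sin.
Qed.

(** The mean value theorem is applied to real and imaginary parts separately, whence the factor
    2. *)
Lemma cderiv_bound f (df : R -> R[i]) (a b B : R) : a <= b ->
  (forall t, a <= t <= b -> cderiv f t (df t)) ->
  (forall t, a <= t <= b -> cabs (df t) <= B) ->
  cabs (f b - f a) <= 2 * B * (b - a).
Proof.
move=> ab hd hB.
have key (p : R[i] -> R) (hp : forall z w, p (z - w) = p z - p w)
   (hpb : forall z, `|p z| <= cabs z)
   (hpd : forall t, a <= t <= b -> is_derive t (1 : R) (fun s => p (f s)) (p (df t))) :
   `|p (f b - f a)| <= B * (b - a).
  have [c] := @MVT_segment R (fun s => p (f s)) (fun t => p (df t)) a b ab
    (fun t ht => hpd t ltac:(by move: ht; rewrite in_itv /= => /andP[/ltW -> /ltW ->]))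
    ltac:(apply: derivable_within_continuous => t; rewrite in_itv /= => ht; exact: (@ex_derive _ _ _ _ _ _ _ (hpd t ht))).
  rewrite in_itv /= => hc e; rewrite hp e normrM (ger0_norm (_ : 0 <= b - a)) ?subr_ge0 //.
  by apply: ler_wpM2r; rewrite ?subr_ge0 //; apply: le_trans (hpb _) (hB _ hc).
apply: le_trans (cabs_le_ReIm _) _.
have -> : 2 * B * (b - a) = B * (b - a) + B * (b - a) by ring.
apply: lerD; apply: key.
- by move=> [? ?] [? ?].
- exact: Re_le_cabs.
- by move=> t /hd [].
- by move=> [? ?] [? ?].
- exact: Im_le_cabs.
- by move=> t /hd [].
Qed.

End ComplexDerivative.

(** * Periodic sums and the value of the Gauss sum *)

Lemma sum_shift1 (V : zmodType) (f : int -> V) M :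
  \sum_(n < M) f (n%:Z + 1) = \sum_(n < M) f n%:Z + f M%:Z - f 0.
Proof.
elim: M => [|M IH]; first by rewrite !big_ord0 add0r subrr.
rewrite !big_ord_recr /= IH.
have -> : M%:Z + 1 = M.+1 by rewrite -PoszD addn1.
by rewrite addrAC.
Qed.

Lemma sum_shift (V : zmodType) (f : int -> V) M (z : int) :
  (forall k, f (k + M%:Z) = f k) -> \sum_(n < M) f (n%:Z + z) = \sum_(n < M) f n%:Z.
Proof.
move=> fp.
have h1 (g : int -> V) : (forall k, g (k + M%:Z) = g k) -> \sum_(n < M) g (n%:Z + 1) = \sum_(n < M) g n%:Z.
  by move=> gp; rewrite sum_shift1 -[M%:Z]add0r gp addrK.
have hn (n : nat) : forall g : int -> V, (forall k, g (k + M%:Z) = g k) ->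
    \sum_(i < M) g (i%:Z + n%:Z) = \sum_(i < M) g i%:Z.
  elim: n => [|n IH] g gp; first by apply: eq_bigr => i _; rewrite addr0.
  rewrite -(h1 g gp) -(IH (fun k => g (k + 1))); last by move=> k; rewrite addrAC gp.
  by apply: eq_bigr => i _; congr (g _); lia.
case: z => n; first exact: hn.
rewrite -(hn n.+1 (fun k => f (k + Negz n))); last by move=> k; rewrite addrAC fp.
by apply: eq_bigr => i _; congr (f _); lia.
Qed.

Lemma sum_rev0 (V : zmodType) (f : nat -> V) M : f 0%N = f M ->
  \sum_(n < M) f (M - n)%N = \sum_(n < M) f n.
Proof.
move=> f0; transitivity (\sum_(n < M) f n.+1).
  by rewrite [RHS](reindex_inj rev_ord_inj); apply: eq_bigr => i _ /=; congr f; have := ltn_ord i; lia.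
have : \sum_(n < M.+1) f n = f 0%N + \sum_(n < M) f n.+1 by rewrite big_ord_recl.
by rewrite big_ord_recr /= f0 addrC => /addrI ->.
Qed.

Section GaussSum.
Variables (R : realType) (M : nat).
Hypotheses (M0 : (0 < M)%N) (Meven : ~~ odd M).

Definition gterm (z : int) : R[i] := cis (pi * z%:~R ^+ 2 / M%:R).

Let MR0 : (M%:R : R) != 0. Proof. by rewrite pnatr_eq0 -lt0n. Qed.

Lemma gtermN z : gterm (- z) = gterm z.
Proof. by rewrite /gterm mulrNz sqrrN. Qed.

Lemma gterm0 : gterm 0 = 1.
Proof. by rewrite /gterm expr0n mulr0 mul0r cis0. Qed.

Lemma gtermD y z : gterm (y + z) = gterm y * gterm z * cis (2 * pi * (y * z)%:~R / M%:R).
Proof. by rewrite /gterm -!cisD; congr cis; rewrite rmorphD rmorphM /=; field. Qed.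

(** Evenness of M enters here: (z + M)^2 / M and z^2 / M differ by the even integer 2z + M. *)
Lemma gterm_period z : gterm (z + M%:Z) = gterm z.
Proof.
rewrite gtermD /gterm -mulrA -cisD -[RHS]mulr1; congr (_ * _).
have -> : pi * (M%:Z)%:~R ^+ 2 / M%:R + 2 * pi * (z * M)%:~R / M%:R = 2 * pi * (M./2%:Z + z)%:~R :> R.
  have e : (M%:R : R) = 2 * (M./2)%:R by rewrite -natrM mul2n even_halfK.
  rewrite rmorphD rmorphM /= -!pmulrn.
  have e2 : (M%:R : R) ^+ 2 / M%:R = 2 * (M./2)%:R by rewrite -e expr2 mulfK.
  by rewrite -(mulrA pi) e2; field.
exact: cis_2pi_int.
Qed.

Lemma gterm_neq0 z : gterm z != 0. Proof. exact: cis_neq0. Qed.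

Lemma cabs_gterm z : cabs (gterm z) = 1. Proof. exact: cabs_cis. Qed.

Definition gsum : R[i] := \sum_(n < M) gterm n%:Z.

Lemma gsum_shift z : \sum_(n < M) gterm (n%:Z + z) = gsum.
Proof. exact: (sum_shift _ gterm_period). Qed.

Lemma cis_root_neq1 j : (0 < j < M)%N -> cis (2 * pi / M%:R * j%:R : R) != 1.
Proof.
move=> hj; apply/eqP => /cis_eq1 h.
have Mp : 0 < M%:R :> R by rewrite ltr0n.
have p0 := pi_gt0 R.
have : 2 * pi / M%:R * j%:R = 0 :> R.
  apply: h; apply/andP; split; first by rewrite !mulr_ge0 ?invr_ge0 ?ler0n ?ltW.
  rewrite mulrAC ltr_pdivrMr // ltr_pM2l ?mulr_gt0 ?ltr_nat //; lia.
move/eqP; rewrite !mulf_eq0 invr_eq0 !pnatr_eq0 (gt_eqF p0).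
by apply/negP; rewrite !negb_or /=; lia.
Qed.

Lemma cis_geom_sum j : (j < M)%N -> \sum_(k < M) cis (2 * pi / M%:R * j%:R * k%:R : R) = (M * (j == 0))%N%:R.
Proof.
move=> jM; under eq_bigr do rewrite -cisX.
case: j jM => [|j] jM.
  by rewrite mulr0 cis0; under eq_bigr do rewrite expr1n; rewrite sumr_const card_ord muln1.
rewrite muln0.
have := subrX1 (cis (2 * pi / M%:R * j.+1%:R : R)) M.
rewrite cisX mulrAC divfK // cis_2pi_nat subrr => /esym/eqP.
rewrite mulf_eq0 subr_eq0 (negbTE (cis_root_neq1 _)) //= => /eqP -> //.
Qed.

(** Shifting one index by the other turns the double sum into geometric sums, of which a single one
    is nonzero. *)
Lemma gsum_norm : gsum * gsum^*%C = M%:R.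
Proof.
have cj z : (gterm z)^*%C = (gterm z)^-1 by exact: conjc_cis.
rewrite {2}/gsum rmorph_sum mulr_sumr.
transitivity (\sum_(k < M) \sum_(n < M) gterm n%:Z * cis (2 * pi / M%:R * n%:R * k%:R)).
  apply: eq_bigr => k _; rewrite [X in gsum * X](cj k) -(gsum_shift k%:Z) mulr_suml; apply: eq_bigr => n _.
  have -> : 2 * pi / M%:R * n%:R * k%:R = 2 * pi * (n%:Z * k%:Z)%:~R / M%:R :> R.
    by rewrite rmorphM /= -!pmulrn; field.
  by rewrite gtermD; field; exact: gterm_neq0.
rewrite exchange_big /=.
under eq_bigr do rewrite -mulr_sumr cis_geom_sum //.
rewrite (bigD1 (Ordinal M0)) //= muln1 gterm0 mul1r big1 ?addr0 // => i hi.
have -> : (nat_of_ord i == 0%N) = false by apply/negbTE; apply: contra hi => /eqP h; apply/eqP/val_inj.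
by rewrite muln0 mulr0.
Qed.

Lemma gsum_prod : gsum = \prod_(1 <= i < M) (1 + (-1) ^+ i * cis (- (pi * i%:R / M%:R))).
Proof.
(* p^2 = e^(-2 pi i/M) is a primitive M-th root of unity, and the minus sign of p cancels the sign
   (-1)^k of [qbin_primitive], so that [M - 1, k] p^k = e^(pi i k^2/M). *)
set p : R[i] := - cis (- (pi / M%:R)).
have pE i : p ^+ i = (-1) ^+ i * cis (- (pi * i%:R / M%:R)).
  have -> : p = -1 * cis (- (pi / M%:R)) by rewrite mulN1r.
  by rewrite exprMn cisX; congr (_ * cis _); field.
have := rszego_half p M.-1; rewrite prednK //.
under eq_bigr do rewrite pE; move=> <-.
rewrite /rszego prednK // /gsum; apply: eq_bigr => k _.
have kM := ltn_ord k.
have p2 : p ^+ 2 = cis (- (2 * pi / M%:R)) by rewrite pE expr2 mulrNN !mul1r; congr cis; field.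
have qM : (p ^+ 2) ^+ M = 1.
  by rewrite p2 cisX mulNr cisN divfK // cis_2pi invr1.
have qp j : (0 < j < M)%N -> (p ^+ 2) ^+ j != 1.
  move=> hj; rewrite p2 cisX mulNr cisN invr_eq1; exact: cis_root_neq1.
have p0 : p != 0 by rewrite oppr_eq0 cis_neq0.
apply: (mulIf (expf_neq0 'C(k.+1, 2) (expf_neq0 2 p0))).
rewrite mulrAC (qbin_primitive qM qp) // -exprM.
have -> : (2 * 'C(k.+1, 2) = k * k + k)%N.
  by elim: (nat_of_ord k) => // n IH; rewrite binS bin1 mulnDr IH; lia.
rewrite exprD mulrA; congr (_ * _); rewrite pE /gterm mulrCA -cisD.
rewrite -signr_odd oddM andbb signr_odd -[RHS]mulr1; congr (_ * _).
rewrite -[RHS]cis0; congr cis; rewrite -pmulrn natrM; field; exact: MR0.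
Qed.

(** Half-angle formulas give every factor an explicit phase and a nonnegative modulus, so the
    argument of the product is the sum of the phases. *)
Lemma gfactor (b : bool) (t : R) : 0 <= t <= pi ->
  exists2 c : R, 0 <= c & 1 + (-1) ^+ b * cis (- t) = c%:C * cis (pi / 2 * b%:R - t / 2).
Proof.
move=> /andP[t0 tp].
have e1 : 1 = cis (- (t / 2)) * cis (t / 2) by rewrite -cisD addNr cis0.
have e2 : cis (- t) = cis (- (t / 2)) * cis (- (t / 2)) by rewrite -cisD; congr cis; field.
have ht : 0 <= t / 2 by rewrite divr_ge0.
case: b; last first.
  exists (2 * cos (t / 2)).
    rewrite mulr_ge0 //; apply: cos_ge0_pihalf; apply/andP; split; last by rewrite ler_pM2r.
    by apply: le_trans ht; rewrite oppr_le0 divr_ge0 ?pi_ge0.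
  rewrite expr0 mul1r mulr0 sub0r e1 e2 -mulrDr mulrC; congr (_ * _).
  by rewrite /cis cosN sinN; simpc; congr (_ +i* _); ring.
exists (2 * sin (t / 2)).
  rewrite mulr_ge0 // sin_ge0_pi // ht /=; apply: le_trans tp.
  by rewrite ler_pdivrMr // ler_peMr // ler1n.
rewrite expr1 mulN1r mulr1 cisD [X in X + _]e1 e2 -mulrBr mulrC mulrA; congr (_ * _).
by rewrite /cis cosN sinN sin_pihalf cos_pihalf; simpc; congr (_ +i* _); ring.
Qed.

(** [uphalf n] counts the odd i <= n, each of which contributes pi/2. For n = M - 1 the phase is pi
    M/4 - pi (M - 1)/4 = pi/4. *)
Lemma gsum_partial n : (n < M)%N ->
  exists2 c : R, 0 <= c & \prod_(1 <= i < n.+1) (1 + (-1) ^+ i * cis (- (pi * i%:R / M%:R))) =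
    c%:C * cis (pi / 2 * (uphalf n)%:R - pi * (n * n.+1)%:R / (4 * M%:R)).
Proof.
elim: n => [|n IH] nM.
  exists 1 => //; rewrite big_geq // mulr0 mul0n mulr0 mul0r subrr cis0 mulr1 //.
have [c c0 IHe] := IH (ltnW nM).
have Mp : 0 < M%:R :> R by rewrite ltr0n.
have [d d0 he] := @gfactor (odd n.+1) (pi * n.+1%:R / M%:R) ltac:(
  apply/andP; split; [by rewrite !mulr_ge0 ?invr_ge0 ?pi_ge0 ?ler0n |
  by rewrite -mulrA ler_piMr ?pi_ge0 // ler_pdivrMr // mul1r ler_nat ltnW]).
exists (c * d); first exact: mulr_ge0.
rewrite big_nat_recr //= IHe -signr_odd he mulrACA -cisD; congr (_ * cis _); first by rewrite rmorphM.
have -> : (n./2.+1%:R : R) = (uphalf n)%:R + (~~ odd n)%:R.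
  by rewrite -natrD; congr (_%:R); rewrite uphalf_half; case: (odd n) => /=; lia.
rewrite [odd n.+1]/=.
rewrite !natrM -[n.+2%:R]natr1 -[n.+1%:R]natr1; field.
exact: MR0.
Qed.

Lemma gsumE : gsum = (Num.sqrt M%:R)%:C * cis (pi / 4).
Proof.
have [c c0 he] := @gsum_partial M.-1 ltac:(lia).
have e : gsum = c%:C * cis (pi / 4).
  rewrite gsum_prod -[X in \prod_(1 <= i < X) _](prednK M0) he; congr (_ * cis _).
  have eh : ((uphalf M.-1)%:R : R) = M%:R / 2.
    apply: (mulIf (_ : 2 != 0 :> R)) => //; rewrite divfK // -natrM; congr (_%:R).
    by have := even_halfK Meven; lia.
  rewrite eh prednK // natrM -subn1 natrB //; field; exact: MR0.
rewrite e; congr (_%:C * _).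
have cj : (c%:C * cis (pi / 4 : R))^*%C = c%:C * (cis (pi / 4))^-1.
  by rewrite -cisN /cis cosN sinN; simpc.
have := gsum_norm; rewrite e cj mulrACA mulfV ?cis_neq0 // mulr1.
rewrite -rmorphM -(rmorph_nat (real_complex R)) => /complexI <-.
by rewrite -expr2 sqrtr_sqr ger0_norm.
Qed.

End GaussSum.

(** * The weighted Gauss sum and the Fourier expansion of chi *)

Section WeightedSum.
Variables (R : realType) (M : nat).
Hypotheses (M0 : (0 < M)%N) (Meven : ~~ odd M).

Local Notation g := (@gterm R M).

Definition quadw (z : int) : R[i] := (z ^+ 2 - M%:Z * z)%:~R.

Lemma quadwE z : quadw z = z%:~R ^+ 2 - M%:R * z%:~R.
Proof. by rewrite /quadw rmorphB rmorphXn rmorphM. Qed.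

Lemma quadw0 : quadw 0 = 0. Proof. by rewrite /quadw expr0n mulr0 subrr. Qed.

Lemma quadwM : quadw M%:Z = 0. Proof. by rewrite /quadw expr2 subrr. Qed.

Lemma quadw_sym z : quadw (M%:Z - z) = quadw z.
Proof. by rewrite /quadw; congr (_%:~R); ring. Qed.

Definition wsum (K : int) : R[i] := \sum_(n < M) g (n%:Z - K) * quadw n%:Z.

(** Moving the shift from K to n produces the second difference 2 of the weight, hence 2 G. The
    weight is not M-periodic: its change by -2M from -1 to M - 1 is the term with [g K]. *)
Lemma wsum_diff2 K :
  wsum (K + 1) + wsum (K - 1) - 2 * wsum K = 2 * gsum R M - 2 * M%:R * g K.
Proof.
have e1 : wsum (K + 1) = \sum_(n < M) g (n%:Z - K) * quadw (n%:Z + 1).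
  have := sum_shift1 (fun z => g (z - (K + 1)) * quadw z) M.
  rewrite quadw0 quadwM !mulr0 addr0 subr0 -/(wsum (K + 1)) => <-.
  by apply: eq_bigr => n _; congr (g _ * _); ring.
have e2 : wsum (K - 1) = \sum_(n < M) g (n%:Z - K) * quadw (n%:Z - 1) - 2 * M%:R * g K.
  have := sum_shift1 (fun z => g (z - K) * quadw (z - 1)) M.
  have -> : \sum_(n < M) g (n%:Z + 1 - K) * quadw (n%:Z + 1 - 1) = wsum (K - 1).
    by apply: eq_bigr => n _; congr (g _ * quadw _); ring.
  move=> ->; rewrite -addrA; congr (_ + _).
  have -> : g (M%:Z - K) = g K by rewrite -gtermN opprB -(gterm_period R M0 Meven (K - M%:Z)) subrK.
  rewrite sub0r gtermN -mulrBr [RHS](_ : _ = g K * (- (2 * M%:R))); last by ring.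
  congr (_ * _); rewrite /quadw -rmorphB /=.
  have -> : (M%:Z - 1) ^+ 2 - M%:Z * (M%:Z - 1) - ((0 - 1) ^+ 2 - M%:Z * (0 - 1)) = - (2 * M%:Z) by ring.
  by rewrite rmorphN rmorphM.
rewrite e1 e2 -[gsum R M](gsum_shift R M0 Meven (- K)) {1}/wsum !mulr_sumr.
transitivity (\sum_(n < M) (g (n%:Z - K) * quadw (n%:Z + 1) + g (n%:Z - K) * quadw (n%:Z - 1) -
   2 * (g (n%:Z - K) * quadw n%:Z)) - 2 * M%:R * g K).
  by rewrite !big_split /= sumrN; ring.
congr (_ - _); apply: eq_bigr => n _ /=.
rewrite -mulrDr (mulrCA 2) -mulrBr mulrC; congr (_ * _).
by rewrite !quadwE rmorphD rmorphB /=; ring.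
Qed.

Lemma wsum_sym K : wsum (M%:Z - K) = wsum K.
Proof.
rewrite /wsum -(sum_rev0 (f := fun n : nat => g (n%:Z - K) * quadw n%:Z)); last by rewrite quadw0 quadwM !mulr0.
apply: eq_bigr => n _; rewrite -subzn 1?ltnW // quadw_sym; congr (_ * _).
by rewrite -gtermN; congr g; ring.
Qed.

(** Completing the square: multiplying the Gaussian kernel by a Fourier mode of frequency K
    translates it by K. *)
Lemma wsum_twist K :
  \sum_(n < M) quadw n%:Z * g n%:Z * cis (- (2 * pi * (n%:Z * K)%:~R / M%:R)) = (g K)^-1 * wsum K.
Proof.
rewrite mulr_sumr; apply: eq_bigr => n _.
rewrite [g (n%:Z - K)]gtermD // gtermN mulrN rmorphN /= mulrN mulNr.
by field; exact: gterm_neq0.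
Qed.

Lemma wsum_twistN K :
  \sum_(n < M) quadw n%:Z * g n%:Z * cis (2 * pi * (n%:Z * K)%:~R / M%:R) = (g K)^-1 * wsum K.
Proof.
rewrite -wsum_twist.
rewrite -(sum_rev0 (f := fun n : nat => quadw n%:Z * g n%:Z * cis (- (2 * pi * (n%:Z * K)%:~R / M%:R)))).
  apply: eq_bigr => n _; rewrite -subzn 1?ltnW // quadw_sym; congr (_ * _ * _).
    by rewrite -[RHS]gtermN opprB -[RHS](gterm_period R M0 Meven (n%:Z - M%:Z)) subrK.
  have M1 : (M%:R : R) != 0 by rewrite pnatr_eq0 -lt0n.
  rewrite -[RHS]mul1r -(cis_2pi_int _ K) -[cis (2 * pi * _)]invrK -!cisN -cisD.
  rewrite -[LHS]invrK -!cisN; congr cis; rewrite !rmorphM rmorphB /= -!pmulrn; by field.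
by rewrite quadw0 quadwM !mul0r.
Qed.

End WeightedSum.

Lemma sum_half_sym (V : zmodType) (f : nat -> V) P :
  f 0%N = 0 -> f P = 0 -> (forall n, (n <= P)%N -> f (P + n)%N = f (P - n)%N) ->
  \sum_(n < 2 * P) f n = (\sum_(n < P) f n) *+ 2.
Proof.
move=> f0 fP fs; rewrite mul2n -addnn big_split_ord /=.
rewrite mulr2n; congr (_ + _).
rewrite -(sum_rev0 (f := f)) ?f0 ?fP //.
by apply: eq_bigr => n _; rewrite fs // ltnW.
Qed.

Section ChiFourier.
Variables (R : realType) (m a : nat).
Hypotheses (am : (a < m)%N).

Local Notation Q := ((2 * m).+1).
Let s := (2 * a.+1)%N.

Lemma chi_block r t : (t < 2 * Q)%N ->
  chi m a (2 * Q * r + t) = (-1) ^+ r * ((t == Q - s)%N%:Z - (t == Q + s)%N%:Z).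
Proof.
move=> tQ; rewrite /chi /s -signr_odd.
have -> : ((2 * Q * r + t) %% (8 * m + 4) = odd r * (2 * Q) + t)%N.
  have -> : (2 * Q * r + t = r./2 * (8 * m + 4) + (odd r * (2 * Q) + t))%N.
    rewrite -{1}(odd_double_half r); lia.
  by rewrite modnMDl modn_small //; case: (odd r); lia.
rewrite !modn_small; try lia.
case: (odd r); rewrite ?expr1 ?expr0 /=; do 6? case: eqP => ?; lia.
Qed.

(** A Dirichlet kernel at odd frequencies: on the integers it is (-1)^r Q at 2Qr and 0 elsewhere. *)
Definition psi (x : R) : R := \sum_(k < Q) cos (pi * (2 * k + 1)%:R * x / (2 * Q)%:R).


Lemma psiN x : psi (- x) = psi x.
Proof. by apply: eq_bigr => k _; rewrite -cosN; congr cos; field. Qed.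

Lemma psi_shift1 x : psi (x + (2 * Q)%:R) = - psi x.
Proof.
rewrite /psi -sumrN; apply: eq_bigr => k _.
rewrite [X in cos X](_ : _ = pi * (2 * k + 1)%:R * x / (2 * Q)%:R + pi + 2 * pi * k%:R); last first.
  by rewrite natrD natrM; field.
have [h1 h2] : cos (2 * pi * k%:R : R) = 1 /\ sin (2 * pi * k%:R : R) = 0 by have [] := cis_2pi_nat R k.
by rewrite cosD h1 h2 mulr1 mulr0 subr0 cosDpi.
Qed.

Lemma psi_shift x r : psi (x + (2 * Q * r)%:R) = (-1) ^+ r * psi x.
Proof.
elim: r => [|r IH]; first by rewrite muln0 addr0 mul1r.
by rewrite mulnS natrD addrCA addrC psi_shift1 IH exprS mulN1r mulNr.
Qed.

Lemma psi0 : psi 0 = Q%:R.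
Proof.
rewrite /psi; under eq_bigr do rewrite mulr0 mul0r cos0.
by rewrite sumr_const card_ord.
Qed.

Lemma psi_small e : (0 < e < 2 * Q)%N -> psi e%:R = 0.
Proof.
move=> /andP[e0 eQ].
set th : R := pi * e%:R / (2 * Q)%:R.
have p0 := pi_gt0 R.
have s0 : 0 < sin th.
  apply: sin_gt0_pi; rewrite /th; apply/andP; split.
    by rewrite divr_gt0 ?mulr_gt0 ?ltr0n.
  by rewrite -mulrA gtr_pMr // ltr_pdivrMr ?ltr0n // mul1r ltr_nat.
have tel n : 2 * sin th * \sum_(k < n) cos (pi * (2 * k + 1)%:R * e%:R / (2 * Q)%:R) = sin (2 * n%:R * th).
  elim: n => [|n IH]; first by rewrite big_ord0 !mulr0 mul0r sin0.
  rewrite big_ord_recr mulrDr IH /=.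
  have -> : pi * (2 * n + 1)%:R * e%:R / (2 * Q)%:R = 2 * n%:R * th + th.
    by rewrite /th natrD natrM; field.
  have -> : 2 * n.+1%:R * th = 2 * n%:R * th + th + th by rewrite -natr1; ring.
  set x := 2 * n%:R * th.
  have -> : sin (x + th + th) = sin (x + th) * cos th + cos (x + th) * sin th by rewrite sinD.
  have -> : sin x = sin (x + th) * cos th - cos (x + th) * sin th by rewrite -sinB addrK.
  by ring.
have := tel Q; rewrite -/(psi e%:R).
have -> : 2 * Q%:R * th = pi * e%:R.
  by rewrite /th natrM; field.
have -> : sin (pi * e%:R) = 0 :> R.
  elim: e {e0 eQ th s0 tel} => [|e IH]; first by rewrite mulr0 sin0.
  by rewrite -natr1 mulrDr mulr1 sinDpi IH oppr0.
move=> /eqP; rewrite !mulf_eq0 pnatr_eq0 /= (gt_eqF s0) /= => /eqP //.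
Qed.

(** Fourier coefficient of chi at frequency (2k + 1)/(4Q). Two opposite spikes at distance s on
    either side of Q give the sine; the offset Q is a phase of pi (2k + 1)/2 and gives (-1)^k. *)
Definition fcoef (k : nat) : R := (-1) ^+ k * sin (pi * (2 * k + 1)%:R * a.+1%:R / Q%:R) / Q%:R.

Lemma cos_shift_sign x k : cos (x - pi * (2 * k + 1)%:R / 2) = (-1) ^+ k * sin x :> R.
Proof.
have -> : pi * (2 * k + 1)%:R / 2 = pi / 2 + pi * k%:R :> R by rewrite natrD natrM; field.
elim: k => [|k IH].
  by rewrite mulr0 addr0 cosB cos_pihalf sin_pihalf mulr0 add0r mulr1 mul1r.
have -> : x - (pi / 2 + pi * k.+1%:R) = (x - (pi / 2 + pi * k%:R)) - pi by rewrite -[k.+1%:R]natr1; ring.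
by rewrite cosB cospi sinpi mulr0 addr0 mulrN1 IH exprS mulN1r mulNr.
Qed.

Lemma chi_fourier n : (chi m a n)%:~R =
  \sum_(k < Q) fcoef k * (2 * cos (pi * (2 * k + 1)%:R * n%:R / (2 * Q)%:R)).
Proof.
(* The first translate of [psi] has its spike at Q - s, the second at Q + s with the sign that
   antiperiodicity brings. *)
have -> : \sum_(k < Q) fcoef k * (2 * cos (pi * (2 * k + 1)%:R * n%:R / (2 * Q)%:R)) =
   (psi (n%:R + s%:R - Q%:R) + psi (n%:R + Q%:R - s%:R)) / Q%:R.
  rewrite /psi -big_split mulr_suml; apply: eq_bigr => k _; rewrite /fcoef /=.
  set A := pi * (2 * k + 1)%:R * a.+1%:R / Q%:R; set B := pi * _ * n%:R / _.
  have -> : pi * (2 * k + 1)%:R * (n%:R + s%:R - Q%:R) / (2 * Q)%:R = (B + A) - pi * (2 * k + 1)%:R / 2.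
    by rewrite /A /B /s !natrM; field.
  rewrite [X in _ + cos X](_ : _ = - ((A - B) - pi * (2 * k + 1)%:R / 2)); last first.
    by rewrite /A /B /s !natrM; field.
  by rewrite cosN !cos_shift_sign sinD sinB; field.
have e : n = (2 * Q * (n %/ (2 * Q)) + n %% (2 * Q))%N by rewrite mulnC -divn_eq.
move: (n %/ (2 * Q))%N (n %% (2 * Q))%N e (ltn_pmod n (isT : (0 < 2 * Q)%N)) => r t -> tQ.
rewrite chi_block //.
have -> : (2 * Q * r + t)%:R + s%:R - Q%:R = (t%:R + s%:R - Q%:R) + (2 * Q * r)%:R :> R by rewrite natrD; ring.
have -> : (2 * Q * r + t)%:R + Q%:R - s%:R = (t%:R + Q%:R - s%:R) + (2 * Q * r)%:R :> R by rewrite natrD; ring.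
rewrite !psi_shift -mulrDr -mulrA rmorphM rmorphXn rmorphN1 /=; congr (_ * _).
have sQ : (s < Q)%N by rewrite /s; lia.
have e1 : psi (t%:R + s%:R - Q%:R) = Q%:R * (t == Q - s)%N%:R.
  case: (ltngtP (t + s)%N Q) => h.
  - have -> : (t == Q - s)%N = false by lia.
    rewrite mulr0 -psiN opprB -natrD -natrB; last by lia.
    by apply: psi_small; lia.
  - have -> : (t == Q - s)%N = false by lia.
    rewrite mulr0 -natrD -natrB; last by lia.
    by apply: psi_small; lia.
  - have -> : (t == Q - s)%N by lia.
    by rewrite -natrD h subrr psi0 mulr1.
have e2 : psi (t%:R + Q%:R - s%:R) = - (Q%:R * (t == Q + s)%N%:R).
  rewrite -natrD -natrB; last by lia.
  case: (ltngtP (t + Q - s)%N (2 * Q)) => h.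
  - have -> : (t == Q + s)%N = false by lia.
    by rewrite mulr0 oppr0; apply: psi_small; lia.
  - have -> : (t == Q + s)%N = false by lia.
    have -> : (t + Q - s = (t + Q - s - 2 * Q) + 2 * Q)%N by lia.
    rewrite natrD psi_shift1 mulr0; congr (- _); apply: psi_small; lia.
  - have -> : (t == Q + s)%N by lia.
    by rewrite h -[(2 * Q)%:R]add0r psi_shift1 psi0 mulr1.
by rewrite e1 e2 rmorphB /= -!pmulrn; field.
Qed.

End ChiFourier.

(** * Solving the difference equation *)

Section NegativePolylog.
Variable R : realType.
Implicit Types p f : {poly R[i]}.

(** The operator u d/du in the coordinate y = u/(1 - u), for which u dy/du = y (1 + y). *)
Definition theta p : {poly R[i]} := 'X * (1 + 'X) * p^`().

(* [Lam k] evaluated at u / (1 - u) is the polylogarithm Li_(-k)(u). *)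
Fixpoint Lam (k : nat) : {poly R[i]} := if k is k'.+1 then theta (Lam k') else 'X.

(* The linear map sending X^k to [Lam k], that is, p to sum_n p(n) u^n. *)
Definition LamF p : {poly R[i]} := \sum_(i < size p) p`_i *: Lam i.

Lemma LamF_widen p n : (size p <= n)%N -> LamF p = \sum_(i < n) p`_i *: Lam i.
Proof.
move=> h; rewrite /LamF (big_ord_widen n (fun i => p`_i *: Lam i) h) big_mkcond.
by apply: eq_bigr => i _; case: ltnP => // hi; rewrite nth_default // scale0r.
Qed.

Lemma LamF_lin c p f : LamF (c *: p + f) = c *: LamF p + LamF f.
Proof.
set n := maxn (size p) (size f).
have hp : (size p <= n)%N by exact: leq_maxl.
have hf : (size f <= n)%N by exact: leq_maxr.
rewrite (LamF_widen hp) (LamF_widen hf) (@LamF_widen _ n); last first.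
  apply: leq_trans (size_polyD _ _) _; rewrite geq_max hf andbT.
  exact: leq_trans (size_scale_leq _ _) hp.
rewrite scaler_sumr -big_split; apply: eq_bigr => i _ /=.
by rewrite coefD coefZ scalerDl scalerA.
Qed.

Lemma LamF0 : LamF 0 = 0.
Proof. by rewrite /LamF size_poly0 big_ord0. Qed.

Lemma LamFD p f : LamF (p + f) = LamF p + LamF f.
Proof. by have := LamF_lin 1 p f; rewrite !scale1r. Qed.

Lemma LamFZ c p : LamF (c *: p) = c *: LamF p.
Proof. by rewrite -[c *: p]addr0 LamF_lin LamF0 addr0. Qed.

Lemma LamFB p f : LamF (p - f) = LamF p - LamF f.
Proof. by rewrite LamFD -scaleN1r LamFZ scaleN1r. Qed.

Lemma LamFXn k : LamF 'X^k = Lam k.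
Proof.
rewrite (@LamF_widen _ k.+1) ?size_polyXn // big_ord_recr /= coefXn eqxx scale1r.
by rewrite big1 ?add0r // => i _; rewrite coefXn; have -> : (nat_of_ord i == k) = false; [have := ltn_ord i; lia|rewrite scale0r].
Qed.

Lemma LamFC c : LamF c%:P = c *: 'X.
Proof.
have -> : c%:P = c *: 'X^0 by rewrite expr0 alg_polyC.
by rewrite LamFZ LamFXn.
Qed.

Lemma LamFMX p : LamF (p * 'X) = theta (LamF p).
Proof.
rewrite (@LamF_widen _ (size p).+1); last by rewrite (leq_trans (size_polyMleq _ _)) // size_polyX addn2.
rewrite big_ord_recl coefMX eqxx scale0r add0r /LamF /theta raddf_sum mulr_sumr.
apply: eq_bigr => i _; rewrite lift0 coefMX /=.
by rewrite derivZ -scalerAr.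
Qed.

(** Reindexing sum_(n >= 1) p(n + 1) u^n divides by u and drops the term p(1) u; here u = y/(1 + y).
    The formal proof is an induction on p that applies [theta] to the relation. *)
Lemma LamF_shift p :
  'X * LamF (p \Po ('X + 1)) = (1 + 'X) * LamF p - p.[1] *: 'X.
Proof.
elim/poly_ind: p => [|p c IH].
  by rewrite comp_poly0 LamF0 horner0 scale0r !mulr0 subr0.
have IH' := congr1 theta IH.
rewrite comp_polyD comp_polyM comp_polyX comp_polyC mulrDr mulr1 !LamFD !LamFMX !LamFC.
rewrite hornerMXaddC mulr1.
move: IH'; rewrite /theta !(derivB, derivD, derivM, derivZ, derivX) derivC.
set A := LamF (p \Po ('X + 1)) in IH *; set B := LamF p in IH *.
move=> IH'.
rewrite -!mul_polyC in IH IH' *; rewrite polyCD.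
transitivity ('X * (1 + 'X) * (1 * A + 'X * A^`()) - (1 + 'X) * ('X * A) + 'X * A + 'X * (c%:P * 'X)).
  by ring.
by rewrite IH' IH; ring.
Qed.

Lemma LamF_shiftN p :
  (1 + 'X) * LamF (p \Po ('X - 1)) = 'X * (LamF p + p.[0]%:P).
Proof.
have := LamF_shift (p \Po ('X - 1)).
rewrite -comp_polyA comp_polyB comp_polyX rmorph1 addrK comp_polyXr.
rewrite horner_comp hornerD hornerN hornerX hornerC subrr -mul_polyC => h.
by rewrite mulrDr h; ring.
Qed.

Lemma horner_LamF_shift p y :
  y * (LamF (p \Po ('X + 1))).[y] = (1 + y) * (LamF p).[y] - p.[1] * y.
Proof. by have := congr1 (horner^~ y) (LamF_shift p); rewrite /= !hornerE. Qed.

Lemma horner_LamF_shiftN p y :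
  (1 + y) * (LamF (p \Po ('X - 1))).[y] = y * ((LamF p).[y] + p.[0]).
Proof. by have := congr1 (horner^~ y) (LamF_shiftN p); rewrite /= !hornerE. Qed.

End NegativePolylog.

Section CotangentVariable.
Variable R : realType.

(* The value of u / (1 - u) at u = e^(ib). *)
Definition ycot (b : R) : R[i] := (- 2^-1) +i* (cos (b / 2) / (2 * sin (b / 2))).

Lemma ycotE b : sin (b / 2) != 0 -> ycot b = cis b * (1 + ycot b).
Proof.
move=> s0; have e : b = b / 2 + b / 2 by field.
have c2 := cos2Dsin2 (b / 2).
rewrite /ycot [in cis b]e cisD /cis; simpc; congr (_ +i* _).
  apply/eqP; rewrite -subr_eq0; apply/eqP.
  transitivity ((cos (b / 2) ^+ 2 + sin (b / 2) ^+ 2 - 1) / 2); last by rewrite c2 subrr mul0r.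
  by field.
apply/eqP; rewrite -subr_eq0; apply/eqP.
transitivity ((cos (b / 2) / (2 * sin (b / 2))) * (1 - (cos (b / 2) ^+ 2 + sin (b / 2) ^+ 2))); last by rewrite c2 subrr mulr0.
by field.
Qed.

Lemma cderiv_ycot b : sin (b / 2) != 0 -> cderiv ycot b ('i%C * (ycot b * (1 + ycot b))).
Proof.
move=> s0; split; rewrite /ycot; simpc => /=.
  apply: is_derive_eq (is_derive_cst _ _ _) _.
  by set x := cos _ / _; field.
have hh : is_derive b (1 : R) (fun t : R => t / 2) (2^-1).
  have := is_deriveM (is_derive_id b (1 : R)) (is_derive_cst (2^-1 : R) b (1 : R)).
  by move/is_derive_eq; apply; rewrite /GRing.scale /= mulr0 add0r mulr1.
have hs := @is_derive1_comp R (@sin R) (fun t : R => t / 2) b _ _ (is_derive_sin (b / 2)) hh.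
have hc := @is_derive1_comp R (@cos R) (fun t : R => t / 2) b _ _ (is_derive_cos (b / 2)) hh.
have s2 : 2 * sin (b / 2) != 0 by rewrite mulf_neq0.
have hs2 : is_derive b (1 : R) (fun t : R => 2 * sin (t / 2)) (cos (b / 2)).
  have := is_deriveZ 2 hs; move/is_derive_eq; apply.
  by rewrite /GRing.scale /=; field.
have hi := @is_deriveV R (fun t : R => 2 * sin (t / 2)) b _ _ s2 hs2.
have := is_deriveM hc hi; move/is_derive_eq; apply.
rewrite /GRing.scale /=.
apply/eqP; rewrite -subr_eq0; apply/eqP.
have c2 := cos2Dsin2 (b / 2).
by field.
Qed.

Lemma cabs_ycot s0 b : 0 < s0 -> s0 <= sin (b / 2) -> cabs (ycot b) <= 2^-1 + (2 * s0)^-1.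
Proof.
move=> s0p hs; apply: le_trans (cabs_le_ReIm _) _ => /=.
have sp : 0 < sin (b / 2) by apply: lt_le_trans hs.
rewrite normrN ger0_norm ?invr_ge0 // lerD2l normrM normfV (ger0_norm (_ : 0 <= 2 * sin (b / 2))); last by rewrite mulr_ge0 // ltW.
rewrite -[X in _ <= X]mul1r; apply: ler_pM; rewrite ?invr_ge0 ?mulr_ge0 ?(ltW sp) //.
  by rewrite ler_norml cos_geN1 cos_le1.
by rewrite lef_pV2 ?posrE ?mulr_gt0 // ler_pM2l.
Qed.

End CotangentVariable.

(** * Truncated partial theta series *)

Section TruncatedTheta.
Variable R : realType.
Implicit Types (p f : {poly R[i]}) (b t : R).

Definition ecoef r t : R[i] := ('i%C / 2 * t%:C) ^+ r / (r`!)%:R.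

Lemma cderiv_ecoefS r t : cderiv (ecoef r.+1) t ('i%C / 2 * ecoef r t).
Proof.
have h : cderiv (fun s : R => 'i%C / 2 * s%:C) t ('i%C / 2).
  have := cderivZ ('i%C / 2) (cderiv_real (is_derive_id t (1 : R))).
  by rewrite mulr1.
have := cderivM (cderivX r h) (cderiv_cst (((r.+1)`!)%:R^-1) t).
move/cderiv_eq; apply; rewrite mulr0 addr0 /ecoef factS natrM.
have r0 : ((r`!)%:R : R[i]) != 0 by rewrite pnatr_eq0 -lt0n fact_gt0.
have r1 : (r.+1%:R : R[i]) != 0 by rewrite pnatr_eq0.
have gen (n1 f1 z i2 : R[i]) : n1 != 0 -> f1 != 0 -> n1 * z * i2 / (n1 * f1) = i2 * (z / f1).
  by move=> h1 h2; field; rewrite h1 h2.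
exact: gen.
Qed.

Lemma ecoef00 t : ecoef 0 t = 1.
Proof. by rewrite /ecoef expr0 fact0 divr1. Qed.

Lemma ecoefS0 r : ecoef r.+1 0 = 0.
Proof. by rewrite /ecoef mulr0 expr0n mul0r. Qed.

Lemma cabs_ecoef r t : 0 <= t -> cabs (ecoef r t) <= t ^+ r.
Proof.
move=> t0; rewrite /ecoef cabsM cabsX !cabsM !cabsV cabs_i cabs_real !cabs_nat (ger0_norm t0) mul1r.
rewrite exprMn mulrAC -[X in _ <= X]mul1r; apply: ler_wpM2r; first exact: exprn_ge0.
rewrite mulr_ile1 ?exprn_ge0 ?invr_ge0 ?ler0n //.
  by rewrite exprn_ile1 ?invr_ge0 // invf_le1 // ler1n.
by rewrite invf_le1 ?ltr0n ?fact_gt0 // ler1n fact_gt0.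
Qed.

(** Truncation of sum_(n >= 1) p(n) e^(i (b n + t n^2/2)): the factor e^(i t n^2/2) is expanded in
    t, and each power of n^2 is summed to a rational function by [LamF]. *)
Definition Aser T p b t : R[i] := \sum_(r < T) ecoef r t * (LamF (p * 'X^(2 * r))).[ycot b].

Lemma Aser_lin T c p f b t : Aser T (c *: p + f) b t = c * Aser T p b t + Aser T f b t.
Proof.
rewrite /Aser mulr_sumr -big_split; apply: eq_bigr => r _ /=.
have -> : (c *: p + f) * 'X^(2 * r) = c *: (p * 'X^(2 * r)) + f * 'X^(2 * r).
  by rewrite mulrDl scalerAl.
by rewrite LamF_lin hornerD hornerZ; ring.
Qed.

Lemma AserD T p f b t : Aser T (p + f) b t = Aser T p b t + Aser T f b t.
Proof. by have := Aser_lin T 1 p f b t; rewrite scale1r mul1r. Qed.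

Lemma AserZ T c p b t : Aser T (c *: p) b t = c * Aser T p b t.
Proof.
have := Aser_lin T c p 0 b t; rewrite addr0 => ->.
rewrite [X in _ + X]big1 ?addr0 // => r _.
by rewrite mul0r LamF0 horner0 mulr0.
Qed.

(** The top term of [Aser T.+1 ('X^2 * p)], which the derivative of the truncated series in t does
    not contain. *)
Definition rlast T p b t : R[i] := 'i%C / 2 * ecoef T t * (LamF (p * 'X^(2 * T.+1))).[ycot b].

Lemma cderiv_Aser T p b (s t : R) : sin ((b + s * t) / 2) != 0 ->
  cderiv (fun t => Aser T.+1 p (b + s * t) t) t
    ('i%C * s%:C * Aser T.+1 ('X * p) (b + s * t) t + 'i%C / 2 * Aser T.+1 ('X^2 * p) (b + s * t) t
     - rlast T p (b + s * t) t).
Proof.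
move=> s0.
have hb : is_derive t (1 : R) (fun t : R => b + s * t) s.
  have := is_deriveD (is_derive_cst b t (1 : R)) (is_deriveZ s (is_derive_id t (1 : R))).
  by move/is_derive_eq; apply; rewrite /GRing.scale /= mulr1 add0r.
have hy := @cderiv_comp R (@ycot R) (fun t : R => b + s * t) t _ _ (cderiv_ycot s0) hb.
set y := ycot (b + s * t) in hy *.
pose L r := LamF (p * 'X^(2 * r)).
have hL r : cderiv (fun t => (L r).[ycot (b + s * t)]) t ('i%C * s%:C * (LamF ('X * p * 'X^(2 * r))).[y]).
  apply: cderiv_eq (cderiv_horner (L r) hy) _.
  have -> : 'X * p * 'X^(2 * r) = p * 'X^(2 * r) * 'X by ring.
  rewrite LamFMX /theta !hornerM hornerD hornerX hornerC -/y -/(L r); ring.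
have h : cderiv (fun t => Aser T.+1 p (b + s * t) t) t
   ((0 * (L 0%N).[y] + ecoef 0 t * ('i%C * s%:C * (LamF ('X * p * 'X^(2 * 0))).[y])) +
    \sum_(r < T) ('i%C / 2 * ecoef r t * (L r.+1).[y] + ecoef r.+1 t * ('i%C * s%:C * (LamF ('X * p * 'X^(2 * r.+1))).[y]))).
  apply: cderiv_ext (cderivD (cderivM _ (hL 0%N)) (cderiv_sum (fun r : 'I_T => cderivM (cderiv_ecoefS r t) (hL r.+1)))).
    by move=> t'; rewrite /Aser big_ord_recl; congr (_ + _).
  by apply: cderiv_ext (cderiv_cst 1 t) => t'; rewrite ecoef00.
apply: cderiv_eq h _.
rewrite mul0r add0r big_split /=.
have e1 : \sum_(i < T) 'i%C / 2 * ecoef i t * (L i.+1).[y] =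
    'i%C / 2 * \sum_(r < T) ecoef r t * (LamF ('X^2 * p * 'X^(2 * r))).[y].
  rewrite mulr_sumr; apply: eq_bigr => r _; rewrite -mulrA; congr (_ * (_ * (LamF _).[y])).
  by rewrite mulnS exprD; ring.
have e2 : 'i%C * s%:C * Aser T.+1 ('X * p) (b + s * t) t = ecoef 0 t * ('i%C * s%:C * (LamF ('X * p * 'X^(2 * 0))).[y]) +
  \sum_(i < T) ecoef i.+1 t * ('i%C * s%:C * (LamF ('X * p * 'X^(2 * i.+1))).[y]).
  rewrite /Aser big_ord_recl mulrDr mulr_sumr; congr (_ + _); first by rewrite mulrCA.
  by apply: eq_bigr => r _; rewrite lift0 mulrCA.
rewrite e1 e2 /Aser big_ord_recr /= /rlast.
have -> : 'X^2 * p * 'X^(2 * T) = p * 'X^(2 * T.+1) by rewrite mulnS exprD; ring.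
rewrite -/y; set S1 := \sum_(i < T) _; set S2 := \sum_(i < T) _.
by ring.
Qed.

(** Formally sum_(n >= 1) p(n + s) e^(i (b (n + s) + t (n + s)^2/2)). Attaching the shift to n in
    this way makes d/dt act, up to [Rem], as multiplication of p by i X^2/2, for every s alike. *)
Definition Phi T (s : R) p b t : R[i] :=
  cis (s * b + s ^+ 2 * t / 2) * Aser T (p \Po ('X + (s%:C)%:P)) (b + s * t) t.

Definition Rem T (s : R) p b t : R[i] :=
  cis (s * b + s ^+ 2 * t / 2) * rlast T (p \Po ('X + (s%:C)%:P)) (b + s * t) t.

Lemma cderiv_Phi T s p b t : sin ((b + s * t) / 2) != 0 ->
  cderiv (Phi T.+1 s p b) t ('i%C / 2 * Phi T.+1 s ('X^2 * p) b t - Rem T s p b t).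
Proof.
move=> s0.
have hb : is_derive t (1 : R) (fun t : R => s * b + s ^+ 2 * t / 2) (s ^+ 2 / 2).
  have := is_deriveD (is_derive_cst (s * b) t (1 : R)) (is_deriveZ (s ^+ 2 / 2) (is_derive_id t (1 : R))).
  rewrite (_ : (cst (s * b) + _) = (fun t : R => s * b + s ^+ 2 * t / 2)); last first.
    apply/funext => x; transitivity (s * b + s ^+ 2 / 2 * x); first by [].
    by field.
  by move/is_derive_eq; apply; rewrite /GRing.scale /= mulr1 add0r.
have := cderivM (@cderiv_comp R (@cis R) (fun t : R => s * b + s ^+ 2 * t / 2) t _ _ (cderiv_cis _) hb) (cderiv_Aser T (p \Po ('X + (s%:C)%:P)) s0).
move/cderiv_eq; apply; rewrite /Phi /Rem.
set c := cis _; set f := p \Po _.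
have -> : ('X^2 * p) \Po ('X + (s%:C)%:P) = 'X^2 * f + (s%:C *: ('X * f) + (s%:C *: ('X * f) + (s%:C ^+ 2) *: f)).
  by rewrite comp_polyM comp_Xn_poly -/f -!mul_polyC polyC_exp; ring.
rewrite !AserD !AserZ.
have -> : (s ^+ 2 / 2)%:C = s%:C ^+ 2 / 2 by rewrite rmorphM fmorphV rmorphXn rmorph_nat.
by field.
Qed.

(* The defect of the truncated series in the difference equation at angle b and
   step t; it is estimated through its derivatives in t. *)
Definition Err T p b t : R[i] :=
  Phi T 1 (p * ('X - 1)) b t + Phi T (-1) (p * ('X + 1)) b t - 2 * Phi T 0 (p * 'X) b t - p.[0].

Lemma cderiv_Err T p b t :
  sin (b / 2) != 0 -> sin ((b + t) / 2) != 0 -> sin ((b - t) / 2) != 0 ->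
  cderiv (Err T.+1 p b) t ('i%C / 2 * Err T.+1 ('X^2 * p) b t -
     (Rem T 1 (p * ('X - 1)) b t + Rem T (-1) (p * ('X + 1)) b t - 2 * Rem T 0 (p * 'X) b t)).
Proof.
move=> h0 h1 h2.
have d1 := @cderiv_Phi T 1 (p * ('X - 1)) b t; rewrite mul1r in d1.
have d2 := @cderiv_Phi T (-1) (p * ('X + 1)) b t; rewrite mulN1r in d2.
have d3 := @cderiv_Phi T 0 (p * 'X) b t; rewrite mul0r addr0 in d3.
have H := cderivB (cderivB (cderivD (d1 h1) (d2 h2)) (cderivZ 2 (d3 h0))) (cderiv_cst p.[0] t).
apply: cderiv_eq (@cderiv_ext R _ (Err T.+1 p b) t _ (fun=> erefl) H) _.
have z : ('X^2 * p).[0] = 0 by rewrite hornerM hornerXn expr0n mul0r.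
have e1 : 'X^2 * p * ('X - 1) = 'X^2 * (p * ('X - 1)) by rewrite mulrA.
have e2 : 'X^2 * p * ('X + 1) = 'X^2 * (p * ('X + 1)) by rewrite mulrA.
have e3 : 'X^2 * p * 'X = 'X^2 * (p * 'X) by rewrite mulrA.
rewrite /Err z e1 e2 e3.
have gen (i2 x1 x2 x3 r1 r2 r3 : R[i]) : i2 * x1 - r1 + (i2 * x2 - r2) - 2 * (i2 * x3 - r3) - 0 =
   i2 * (x1 + x2 - 2 * x3 - 0) - (r1 + r2 - 2 * r3) by ring.
exact: gen.
Qed.

Lemma Phi0 T s p b : Phi T.+1 s p b 0 = cis (s * b) * (LamF (p \Po ('X + (s%:C)%:P))).[ycot b].
Proof.
rewrite /Phi !mulr0 !mul0r !addr0 /Aser big_ord_recl big1 => [|i _]; last by rewrite lift0 ecoefS0 mul0r.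
by rewrite addr0 ecoef00 mul1r muln0 expr0 mulr1.
Qed.

(** The weights (n - 1) + (n + 1) - 2n cancel term by term, and the shifts leave only the boundary
    term p(0). At t = 0 the truncation keeps one rational function per series, so the shift
    relations of [LamF] make this argument exact. *)
Lemma Err0 T p b : sin (b / 2) != 0 -> Err T.+1 p b 0 = 0.
Proof.
move=> s0; rewrite /Err !Phi0 mul1r mulN1r mul0r cis0 mul1r.
set y := ycot b; have hy : y = cis b * (1 + y) := ycotE s0; clearbody y.
have y1 : 1 + y != 0.
  apply/eqP => h; have := hy; rewrite h mulr0 => y0.
  by move: h; rewrite y0 addr0 => /eqP; rewrite oner_eq0.
have y0 : y != 0 by rewrite hy mulf_neq0 // cis_neq0.
have ec : cis b = y / (1 + y) by rewrite {1}hy mulfK.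
have c1 : ((1 : R)%:C)%:P = 1 :> {poly R[i]} by rewrite rmorph1.
have cN1 : ((-1 : R)%:C)%:P = -1 :> {poly R[i]} by rewrite rmorphN1 polyCN.
have c0 : 'X + ((0 : R)%:C)%:P = 'X :> {poly R[i]} by rewrite polyC0 addr0.
rewrite c1 cN1 c0 comp_polyXr cisN ec.
have z1 : (p * ('X - 1)).[1] = 0 by rewrite hornerM hornerD hornerN hornerX hornerC subrr mulr0.
have z2 : (p * ('X + 1)).[0] = p.[0] by rewrite hornerM hornerD hornerX hornerC add0r mulr1.
have e1 := horner_LamF_shift (p * ('X - 1)) y.
have e2 := horner_LamF_shiftN (p * ('X + 1)) y.
have e3 : (LamF (p * ('X - 1))).[y] + (LamF (p * ('X + 1))).[y] = 2 * (LamF (p * 'X)).[y].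
  rewrite -hornerD -LamFD.
  have -> : p * ('X - 1) + p * ('X + 1) = p * 'X + p * 'X by ring.
  by rewrite LamFD hornerD; ring.
rewrite z1 in e1; rewrite z2 in e2.
have gen (L1 L2 B1 B2 B3 p0 : R[i]) : y * L1 = (1 + y) * B1 - 0 * y -> (1 + y) * L2 = y * (B2 + p0) ->
    B1 + B2 = 2 * B3 -> y / (1 + y) * L1 + (y / (1 + y))^-1 * L2 - 2 * B3 - p0 = 0.
  move=> h1 h2 <-.
  have -> : L1 = (1 + y) * B1 / y by apply: (mulfI y0); rewrite h1; field.
  have -> : L2 = y * (B2 + p0) / (1 + y) by apply: (mulfI y1); rewrite h2; field.
  by field; rewrite y0 y1.
exact: gen e1 e2 e3.
Qed.

End TruncatedTheta.

Section ErrorBound.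
Variable R : realType.
Implicit Types (p f : {poly R[i]}) (b t : R).

Definition pbnd p (Y : R) : R := \sum_(i < size p) cabs p`_i * Y ^+ i.

Lemma pbnd_ge0 p Y : 0 <= Y -> 0 <= pbnd p Y.
Proof. by move=> Y0; apply: sumr_ge0 => i _; rewrite mulr_ge0 ?cabs_ge0 ?exprn_ge0. Qed.

Lemma cabs_horner p y Y : cabs y <= Y -> cabs p.[y] <= pbnd p Y.
Proof.
move=> hy; rewrite horner_coef; apply: le_trans (cabs_sum _ _ _) _.
apply: ler_sum => i _; rewrite cabsM cabsX; apply: ler_wpM2l; first exact: cabs_ge0.
by rewrite lerXn2r ?nnegrE ?cabs_ge0 // (le_trans _ hy) // cabs_ge0.
Qed.

Variable s0 : R.
Hypothesis s0p : 0 < s0.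

Let Y : R := 2^-1 + (2 * s0)^-1.
Let Y0 : 0 <= Y. Proof. by rewrite addr_ge0 ?invr_ge0 ?mulr_ge0 // ltW. Qed.

Let hyY b : s0 <= sin (b / 2) -> cabs (ycot b) <= Y.
Proof. exact: cabs_ycot. Qed.

Lemma Aser_bound T p : exists2 C, 0 <= C &
  forall b t, 0 <= t <= 1 -> s0 <= sin (b / 2) -> cabs (Aser T p b t) <= C.
Proof.
exists (\sum_(r < T) pbnd (LamF (p * 'X^(2 * r))) Y).
  by apply: sumr_ge0 => r _; exact: pbnd_ge0.
move=> b t /andP[t0 t1] hs; apply: le_trans (cabs_sum _ _ _) _; apply: ler_sum => r _.
rewrite cabsM -[X in _ <= X]mul1r; apply: ler_pM; rewrite ?cabs_ge0 //.
  by apply: le_trans (cabs_ecoef _ t0) _; rewrite exprn_ile1.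
exact/cabs_horner/hyY.
Qed.

Lemma Phi_bound T s p : exists2 C, 0 <= C &
  forall b t, 0 <= t <= 1 -> s0 <= sin ((b + s * t) / 2) -> cabs (Phi T s p b t) <= C.
Proof.
have [C C0 h] := Aser_bound T (p \Po ('X + (s%:C)%:P)); exists C => // b t ht hs.
by rewrite /Phi cabsM cabs_cis mul1r h.
Qed.

Lemma Rem_bound T s p : exists2 C, 0 <= C &
  forall b t, 0 <= t <= 1 -> s0 <= sin ((b + s * t) / 2) -> cabs (Rem T s p b t) <= C * t ^+ T.
Proof.
set f := p \Po ('X + (s%:C)%:P).
exists (pbnd (LamF (f * 'X^(2 * T.+1))) Y); first exact: pbnd_ge0.
move=> b t /andP[t0 t1] hs; rewrite /Rem /rlast.
have := cabs_ecoef T t0; move: (ecoef T t) => e he; rewrite !cabsM cabs_cis mul1r cabsV cabs_i cabs_nat mul1r.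
rewrite [X in _ <= X]mulrC; apply: ler_pM; rewrite ?mulr_ge0 ?cabs_ge0 ?invr_ge0 //.
  rewrite -[X in _ <= X]mul1r; apply: ler_pM; rewrite ?cabs_ge0 ?invr_ge0 //.
  by rewrite invf_le1 // ler1n.
exact/cabs_horner/hyY.
Qed.

(** Induction on d: the error vanishes at t = 0, and its derivative combines the error for X^2 p, of
    order t^d by induction, with remainders of order t^T. The polynomial p is general because
    differentiation changes it. The lower bound on the sine keeps [ycot] bounded. *)
Lemma Err_bound T d p : (d <= T.+1)%N -> exists2 C, 0 <= C &
  forall b t, 0 <= t <= 1 -> (forall x, - t <= x <= t -> s0 <= sin ((b + x) / 2)) ->
    cabs (Err T.+1 p b t) <= C * t ^+ d.
Proof.
have reg b t : 0 <= t -> (forall x, - t <= x <= t -> s0 <= sin ((b + x) / 2)) ->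
   [/\ s0 <= sin ((b + 1 * t) / 2), s0 <= sin ((b + -1 * t) / 2) & s0 <= sin ((b + 0 * t) / 2)].
  by move=> t0 h; split; apply: h; apply/andP; split; lra.
elim: d p => [|d IH] p dT.
  have [C1 C10 h1] := Phi_bound T.+1 1 (p * ('X - 1)).
  have [C2 C20 h2] := Phi_bound T.+1 (-1) (p * ('X + 1)).
  have [C3 C30 h3] := Phi_bound T.+1 0 (p * 'X).
  exists (C1 + C2 + 2 * C3 + cabs p.[0]).
    by rewrite !addr_ge0 ?mulr_ge0 ?cabs_ge0.
  move=> b t ht hreg; rewrite expr0 mulr1 /Err.
  have [r1 r2 r3] := reg b t (proj1 (andP ht)) hreg.
  apply: le_trans (cabsB _ _) _; apply: lerD => //.
  apply: le_trans (cabsB _ _) _; apply: lerD; last by rewrite cabsM cabs_nat ler_pM2l // h3.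
  by apply: le_trans (cabsD _ _) _; apply: lerD; [apply: h1|apply: h2].
have [C C0 hC] := IH ('X^2 * p) (ltnW dT).
have [C1 C10 h1] := Rem_bound T 1 (p * ('X - 1)).
have [C2 C20 h2] := Rem_bound T (-1) (p * ('X + 1)).
have [C3 C30 h3] := Rem_bound T 0 (p * 'X).
exists (2 * (C + (C1 + C2 + 2 * C3))); first by rewrite !(mulr_ge0, addr_ge0).
move=> b t /andP[t0 t1] hreg.
have sub x : 0 <= x <= t -> forall z, - x <= z <= x -> s0 <= sin ((b + z) / 2).
  move=> /andP[x0 xt] z /andP[z1 z2]; apply: hreg.
  by rewrite (le_trans z2 xt) andbT; apply: le_trans z1; rewrite lerN2.
have nz x : s0 <= sin x -> sin x != 0 by move=> h; rewrite gt_eqF // (lt_le_trans s0p h).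
have E0 : Err T.+1 p b 0 = 0.
  apply: Err0; apply: nz; rewrite -[b in X in _ <= X]addr0; apply: (sub 0); rewrite ?lexx ?t0 //.
  by rewrite oppr0 lexx.
rewrite -[Err T.+1 p b t]subr0 -E0.
have -> : 2 * (C + (C1 + C2 + 2 * C3)) * t ^+ d.+1 = 2 * ((C + (C1 + C2 + 2 * C3)) * t ^+ d) * (t - 0).
  by rewrite exprSr subr0; ring.
apply: (cderiv_bound (df := fun x => 'i%C / 2 * Err T.+1 ('X^2 * p) b x -
     (Rem T 1 (p * ('X - 1)) b x + Rem T (-1) (p * ('X + 1)) b x - 2 * Rem T 0 (p * 'X) b x))) => //.
  move=> x hx; have [r1 r2 r3] := reg b x (proj1 (andP hx)) (sub x hx).
  by move: r1 r2 r3; rewrite mul1r mulN1r mul0r addr0 => r1 r2 r3; apply: cderiv_Err; apply: nz.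
move=> x hx; have [r1 r2 r3] := reg b x (proj1 (andP hx)) (sub x hx).
have /andP[x0 xt] := hx.
have x1 : x <= 1 by exact: le_trans xt t1.
have hx1 : 0 <= x <= 1 by rewrite x0.
have xd : x ^+ d <= t ^+ d by rewrite lerXn2r ?nnegrE.
have xT : x ^+ T <= t ^+ d.
  apply: le_trans xd; rewrite -(subnK (_ : d <= T)%N) // exprD ler_piMl ?exprn_ge0 //.
  by rewrite exprn_ile1.
apply: le_trans (cabsB _ _) _; rewrite [X in _ <= X]mulrDl; apply: lerD.
  rewrite !cabsM cabs_i cabsV cabs_nat mul1r; apply: (@le_trans _ _ (1 * (C * x ^+ d))).
    apply: ler_pM; rewrite ?invr_ge0 ?cabs_ge0 //; first by rewrite invf_le1 // ler1n.
    by apply: hC => //; exact: sub.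
  by rewrite mul1r ler_wpM2l.
apply: (@le_trans _ _ ((C1 + C2 + 2 * C3) * x ^+ T)); last by rewrite ler_wpM2l // !(addr_ge0, mulr_ge0).
apply: le_trans (cabsB _ _) _; rewrite [X in _ <= X]mulrDl; apply: lerD; last first.
  by rewrite cabsM cabs_nat -mulrA ler_pM2l // h3.
by apply: le_trans (cabsD _ _) _; rewrite [X in _ <= X]mulrDl; apply: lerD; [apply: h1|apply: h2].
Qed.

End ErrorBound.

Lemma discrete_taylor (R : realType) (f : nat -> R[i]) (e : R) n : 0 <= e ->
  cabs (f 1%N - f 0%N) <= e ->
  (forall k, (k.+1 < n)%N -> cabs (f k.+2 - f k.+1 - (f k.+1 - f k)) <= e) ->
  forall k, (k <= n)%N -> cabs (f k - f 0%N) <= k%:R * k%:R * e.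
Proof.
move=> e0 h0 hd.
have d1 k : (k < n)%N -> cabs (f k.+1 - f k) <= k.+1%:R * e.
  elim: k => [|k IH] kn; first by rewrite mul1r.
  rewrite -(subrK (f k.+1 - f k) (f k.+2 - f k.+1)).
  apply: le_trans (cabsD _ _) _; rewrite -[k.+2%:R]natr1 mulrDl mul1r [X in _ <= X]addrC.
  by apply: lerD; [apply: hd|apply: IH; exact: ltnW].
elim=> [|k IH] kn; first by rewrite subrr cabs0 !mul0r.
rewrite -(subrK (f k) (f k.+1)) -addrA; apply: le_trans (cabsD _ _) _.
apply: le_trans (lerD (d1 k kn) (IH (ltnW kn))) _.
rewrite -mulrDl; apply: ler_wpM2r => //.
by rewrite -natrM -natrD -natrM ler_nat; nia.
Qed.

Section LamReflection.
Variable R : realType.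

(** The map y -> -1 - y is u -> 1/u, under which u d/du changes sign. *)
Lemma Lam_reflect k : Lam R k.+1 \Po (-1 - 'X) = (-1) ^+ k *: Lam R k.+1.
Proof.
elim: k => [|k IH].
  rewrite expr0 scale1r [Lam R 1]/= /theta derivX mulr1 comp_polyM comp_polyD comp_polyX rmorph1.
  by ring.
have dr : (-1 - 'X : {poly R[i]})^`() = -1 by rewrite derivB derivN derivC derivX oppr0 sub0r.
have h := congr1 (@deriv _) IH; rewrite deriv_comp dr derivZ mulrN1 in h.
rewrite -[Lam R k.+2]/(theta (Lam R k.+1)); move: (Lam R k.+1) h => L h.
have {}h : L^`() \Po (-1 - 'X) = - ((-1) ^+ k *: L^`()) by rewrite -h opprK.
rewrite /theta !comp_polyM comp_polyD comp_polyX rmorph1 h exprS mulN1r -!mul_polyC polyCN.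
by ring.
Qed.

Lemma horner_Lam_odd r y : (Lam R (2 * r).+1).[-1 - y] = (Lam R (2 * r).+1).[y].
Proof.
have := congr1 (horner^~ y) (Lam_reflect (2 * r)).
by rewrite /= horner_comp -signr_odd oddM /= expr0 scale1r !hornerE.
Qed.

Lemma ycot_reflect (b : R) : ycot (2 * pi - b) = -1 - ycot b.
Proof.
rewrite /ycot; have -> : (2 * pi - b) / 2 = pi - b / 2 by field.
by rewrite cosB sinB cospi sinpi !mul0r addr0 sub0r mulN1r mulN1r opprK; simpc; congr (_ +i* _); field.
Qed.

End LamReflection.

(** * Approximate solution of the difference equation for the weighted Gauss sum *)

Section WsumAsymptotics.
Variable R : realType.

(** Formally sum_(n >= 1) n e^(pi i (n + K)^2/M), whose second difference in K is e^(pi i K^2/M). *)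
Definition vser M T (K : int) : R[i] :=
  gterm R M K * Aser T.+1 'X (2 * pi / M%:R * K%:~R) (2 * pi / M%:R).

(** The two subtracted parts account for the two terms of [wsum_diff2]; what is left has a second
    difference of the size of M times [Err]. *)
Definition wdefect M T (K : int) : R[i] :=
  wsum R M K - quadw R M K * gsum R M + 2 * M%:R * vser M T K.

Section FixedM.
Variables (M T : nat).
Hypotheses (M0 : (0 < M)%N) (Meven : ~~ odd M).

Let e : R := 2 * pi / M%:R.
Let MR0 : (M%:R : R) != 0. Proof. by rewrite pnatr_eq0 -lt0n. Qed.

Lemma vser_diff2 K : vser M T (K + 1) + vser M T (K - 1) - 2 * vser M T K =
  gterm R M K * (1 + Err T.+1 1 (e * K%:~R) e).
Proof.
have g1 : gterm R M (K + 1) = gterm R M K * cis (e * K%:~R + e / 2).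
  rewrite gtermD // -mulrA /gterm -cisD; congr (_ * cis _); rewrite mulr1 rmorph1 /e; by field.
have g2 : gterm R M (K - 1) = gterm R M K * cis (- (e * K%:~R) + e / 2).
  rewrite gtermD // gtermN -mulrA /gterm -cisD; congr (_ * cis _); rewrite mulrN1 rmorphN rmorph1 /e; by field.
have p1 : Phi T.+1 1 (1 * ('X - 1)) (e * K%:~R) e = cis (e * K%:~R + e / 2) * Aser T.+1 'X (e * (K + 1)%:~R) e.
  rewrite /Phi !mul1r expr1n mul1r; congr (_ * Aser _ _ _ _).
    have -> : ((1 : R)%:C)%:P = 1 :> {poly R[i]} by rewrite rmorph1.
    by rewrite comp_polyB comp_polyX rmorph1 addrK.
  by rewrite rmorphD rmorph1 mulrDr mulr1.
have p2 : Phi T.+1 (-1) (1 * ('X + 1)) (e * K%:~R) e = cis (- (e * K%:~R) + e / 2) * Aser T.+1 'X (e * (K - 1)%:~R) e.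
  rewrite /Phi !mul1r !mulN1r sqrrN expr1n mul1r; congr (_ * Aser _ _ _ _).
    have -> : ((-1 : R)%:C)%:P = -1 :> {poly R[i]} by rewrite rmorphN1 polyCN.
    by rewrite comp_polyD comp_polyX rmorph1 subrK.
  by rewrite rmorphB rmorph1 mulrBr mulr1.
have p3 : Phi T.+1 0 (1 * 'X) (e * K%:~R) e = Aser T.+1 'X (e * K%:~R) e.
  have c0 : 'X + ((0 : R)%:C)%:P = 'X :> {poly R[i]} by rewrite polyC0 addr0.
  by rewrite /Phi c0 !mul1r expr0n !mul0r !addr0 cis0 mul1r comp_polyX.
rewrite /Err p1 p2 p3 hornerC /vser -/e g1 g2; ring.
Qed.

Lemma wdefect_diff2 K :
  wdefect M T (K + 1) + wdefect M T (K - 1) - 2 * wdefect M T K =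
  2 * M%:R * gterm R M K * Err T.+1 1 (e * K%:~R) e.
Proof.
have h1 := wsum_diff2 R M0 Meven K.
have h2 := vser_diff2 K.
rewrite /wdefect.
have h3 : quadw R M (K + 1) + quadw R M (K - 1) - 2 * quadw R M K = 2.
  by rewrite !quadwE rmorphD rmorphB rmorph1; ring.
transitivity ((wsum R M (K + 1) + wsum R M (K - 1) - 2 * wsum R M K)
  - (quadw R M (K + 1) + quadw R M (K - 1) - 2 * quadw R M K) * gsum R M
  + 2 * M%:R * (vser M T (K + 1) + vser M T (K - 1) - 2 * vser M T K)); first by ring.
rewrite h1 h2 h3; ring.
Qed.

Lemma wdefect_sym K : wdefect M T (M%:Z - K) = wdefect M T K.
Proof.
rewrite /wdefect wsum_sym // quadw_sym; congr (_ + _ * _); rewrite /vser.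
have -> : gterm R M (M%:Z - K) = gterm R M K.
  by rewrite -[LHS]gtermN opprB -[LHS](gterm_period R M0 Meven) subrK.
congr (_ * _); rewrite /Aser; apply: eq_bigr => r _; congr (_ * _).
have -> : ('X * 'X^(2 * r) : {poly R[i]}) = 'X^((2 * r).+1) by rewrite exprS.
rewrite LamFXn -[RHS]horner_Lam_odd -ycot_reflect; congr (_.[ycot _]).
have -> : (M%:Z - K)%:~R = M%:R - K%:~R :> R by rewrite rmorphB.
by field.
Qed.

End FixedM.

(** Second differences are summed twice from P = M/2 down to K, which costs the factor P^2. *)
Lemma wdefect_bound s0 T : 0 < s0 -> exists2 C, 0 <= C & forall P K : nat,
  (0 < P)%N -> (K <= P)%N -> let e := 2 * pi / (2 * P)%:R in e <= 1 ->
  (forall x : R, e * K%:R - e <= x <= pi + e -> s0 <= sin (x / 2)) ->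
  cabs (wdefect (2 * P) T K%:Z - wdefect (2 * P) T P%:Z) <= P%:R ^+ 2 * (2 * (2 * P)%:R * C * e ^+ T.+1).
Proof.
move=> s0p; have [C C0 hC] := Err_bound s0p 1 (leqnn T.+1).
exists C => // P K P0 KP e e1 hreg; set M := (2 * P)%N.
have M0 : (0 < M)%N by rewrite muln_gt0.
have Me : ~~ odd M by rewrite oddM.
have e0 : 0 <= e by rewrite divr_ge0 ?mulr_ge0 ?pi_ge0.
have PR : (P%:R : R) != 0 by rewrite pnatr_eq0 -lt0n.
have eP : e * P%:R = pi by rewrite /e natrM; field.
set eps := 2 * M%:R * C * e ^+ T.+1.
have eps0 : 0 <= eps by rewrite /eps !mulr_ge0 ?exprn_ge0 // ler0n.
have hd (k : nat) : (K <= k <= P)%N ->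
   cabs (wdefect M T (k%:Z + 1) + wdefect M T (k%:Z - 1) - 2 * wdefect M T k%:Z) <= eps.
  move=> /andP[Kk kP]; rewrite wdefect_diff2 // -/e cabsM cabsM cabs_gterm mulr1 cabsM !cabs_nat /eps -[X in _ <= X]mulrA.
  apply: ler_wpM2l; first by rewrite mulr_ge0 // ler0n.
  apply: hC; first by rewrite e0.
  move=> x /andP[x1 x2]; apply: hreg.
  have k1 : e * K%:R <= e * k%:R by rewrite ler_wpM2l // ler_nat.
  have k2 : e * k%:R <= pi by rewrite -eP ler_wpM2l // ler_nat.
  by rewrite -[k%:~R]pmulrn; apply/andP; split; lra.
pose f k := wdefect M T (P - k)%N%:Z.
have [->|KP1] := eqVneq K P; first by rewrite subrr cabs0 mulr_ge0 // exprn_ge0.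
have fS k : (k.+1 <= P)%N -> (P - k)%N%:Z = (P - k.+1)%N%:Z + 1 by lia.
have h := @discrete_taylor R f eps (P - K) eps0 _ _ (P - K) (leqnn _).
have -> : wdefect M T K%:Z = f (P - K)%N by rewrite /f subKn.
have -> : wdefect M T P%:Z = f 0%N by rewrite /f subn0.
apply: le_trans (h _ _) _.
- have := hd P; rewrite KP leqnn => /(_ isT).
  (* Symmetry about P makes the first difference at P half a second difference. This excludes a
     linear drift, and only the constant [wdefect] at P stays unknown. *)
  have -> : wdefect M T (P%:Z + 1) = wdefect M T (P%:Z - 1).
    rewrite -(wdefect_sym T M0 Me (P%:Z - 1)); congr (wdefect _ _ _); rewrite /M; lia.
  rewrite /f subn0; have -> : (P - 1)%N%:Z = P%:Z - 1 by lia.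
  set x := wdefect _ _ _; set y := wdefect _ _ _.
  have -> : x + x - 2 * y = 2 * (x - y) by ring.
  rewrite cabsM cabs_nat => h1; have := cabs_ge0 (x - y); lra.
- move=> k hk; have := hd (P - k.+1)%N; rewrite /f.
  have -> : (P - k.+1)%N%:Z + 1 = (P - k)%N%:Z by lia.
  have -> : (P - k.+1)%N%:Z - 1 = (P - k.+2)%N%:Z by lia.
  move=> /(_ ltac:(lia)); congr (cabs _ <= _); ring.
rewrite -/eps expr2; apply: ler_wpM2r => //.
by apply: ler_pM; rewrite ?ler0n // ler_nat leq_subr.
Qed.

End WsumAsymptotics.

(** * Continuation of polylogarithms and the L-function *)

Section ComplexLimits.
Variable R : realType.
Implicit Types (u v : nat -> R[i]) (l : R[i]).

Definition ccvg u l : Prop :=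
  forall e : R, 0 < e -> exists n0, forall n, (n0 <= n)%N -> cabs (u n - l) < e.

Lemma ccvg_ext u v l : (forall n, u n = v n) -> ccvg u l -> ccvg v l.
Proof. by move=> /funext ->. Qed.

Lemma ccvg_cst l : ccvg (fun=> l) l.
Proof. by move=> e e0; exists 0%N => n _; rewrite subrr cabs0. Qed.

Lemma ccvgD u v l l' : ccvg u l -> ccvg v l' -> ccvg (fun n => u n + v n) (l + l').
Proof.
move=> hu hv e e0; have e2 : 0 < e / 2 by rewrite divr_gt0.
have [n1 h1] := hu _ e2; have [n2 h2] := hv _ e2.
exists (maxn n1 n2) => n; rewrite geq_max => /andP[/h1 a1 /h2 a2].
rewrite opprD addrACA; apply: le_lt_trans (cabsD _ _) _; lra.
Qed.

Lemma ccvgZ (c : R[i]) u l : ccvg u l -> ccvg (fun n => c * u n) (c * l).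
Proof.
move=> hu e e0; have c1 : 0 < cabs c + 1 by rewrite ltr_wpDl ?cabs_ge0.
have [n0 h] := hu (e / (cabs c + 1)) ltac:(exact: divr_gt0).
exists n0 => n /h; rewrite ltr_pdivlMr // => h1.
rewrite -mulrBr cabsM; apply: le_lt_trans h1; rewrite mulrC.
by apply: ler_wpM2l; [exact: cabs_ge0|rewrite lerDl].
Qed.

Lemma ccvgB u v l l' : ccvg u l -> ccvg v l' -> ccvg (fun n => u n - v n) (l - l').
Proof.
move=> hu /(ccvgZ (-1)) hv; have := ccvgD hu hv; rewrite mulN1r.
by apply: ccvg_ext => n; rewrite mulN1r.
Qed.

Lemma ccvg_sum n (u : 'I_n -> nat -> R[i]) (l : 'I_n -> R[i]) :
  (forall i, ccvg (u i) (l i)) -> ccvg (fun k => \sum_(i < n) u i k) (\sum_(i < n) l i).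
Proof.
elim: n u l => [|n IH] u l h.
  by rewrite big_ord0; apply: ccvg_ext (ccvg_cst 0) => k; rewrite big_ord0.
rewrite big_ord_recr; apply: ccvg_ext (ccvgD (IH _ _ (fun i => h (widen_ord (leqnSn n) i))) (h ord_max)) => k.
by rewrite big_ord_recr.
Qed.

Lemma ccvg_bound u l B : ccvg u l -> (forall n, cabs (u n) <= B) -> cabs l <= B.
Proof.
move=> hu hB; rewrite leNgt; apply/negP => h.
have [n0 hn] := hu (cabs l - B) ltac:(by rewrite subr_gt0).
have := hn n0 (leqnn _); have := hB n0; rewrite cabs_distC => h1 h2.
have : cabs l <= cabs (l - u n0) + cabs (u n0) by rewrite -{1}(subrK (u n0) l) cabsD.
lra.
Qed.

Lemma ccvg_unique u l l' : ccvg u l -> ccvg u l' -> l = l'.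
Proof.
move=> h h'; have := ccvgB h h'; rewrite (_ : (fun n => _) = fun=> 0); last by apply/funext => n; rewrite subrr.
move=> h0; apply/eqP; rewrite -subr_eq0; apply/eqP/cabs_eq0/eqP.
rewrite eq_le cabs_ge0 andbT; apply: ccvg_bound h0 _ => n.
by rewrite cabs0.
Qed.

Lemma ccvg_shift u l : ccvg u l -> ccvg (fun n => u n.+1) l.
Proof. by move=> h e /h [n0 hn]; exists n0 => n hnn; apply: hn; exact: leqW. Qed.

Lemma ccvg_le u l (e : nat -> R) : (forall n, cabs (u n - l) <= e n) ->
  (e @ \oo --> (0 : R)) -> ccvg u l.
Proof.
move=> hu /cvgrPdist_lt he d d0; have [n0 _ hn] := he d d0.
exists n0 => n hnn; apply: le_lt_trans (hu n) _.
by have := hn n hnn; rewrite /= sub0r normrN; apply: le_lt_trans; exact: ler_norm.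
Qed.

Lemma ccvg_geom (C x : R) u l : 0 <= x < 1 ->
  (forall n, cabs (u n - l) <= C * x ^+ n) -> ccvg u l.
Proof.
move=> /andP[x0 x1] h; apply: ccvg_le h _.
rewrite -[X in _ --> X](mulr0 C); apply: cvgM; first exact: cvg_cst.
by apply: cvg_expr; rewrite ger0_norm.
Qed.

Lemma mono_limit (u : nat -> R) B : (forall n, u n <= u n.+1) -> (forall n, u n <= B) ->
  exists l : R, forall e : R, 0 < e -> exists n0, forall n, (n0 <= n)%N -> `|u n - l| < e.
Proof.
move=> um uB.
have nd : nondecreasing_seq u by apply/nondecreasing_seqP.
have hub : has_ubound (range u) by exists B => _ [n _ <-].
exists (sup (range u)) => e e0.
have /cvgrPdist_lt /(_ e e0) [n0 _ h] := nondecreasing_cvgn nd hub.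
by exists n0 => n hn; rewrite distrC; exact: h.
Qed.

Lemma abs_series_limit (x w : nat -> R) B : (forall n, `|x n| <= w n) ->
  (forall N, \sum_(n < N) w n <= B) ->
  exists l : R, forall e : R, 0 < e -> exists n0, forall n, (n0 <= n)%N -> `|\sum_(i < n) x i - l| < e.
Proof.
move=> hx hB.
have w0 n : 0 <= w n by exact: le_trans (hx n).
have [l1 h1] := @mono_limit (fun N => \sum_(n < N) w n) B
  ltac:(by move=> n /=; rewrite big_ord_recr lerDl) hB.
(* x = (x + w) - w, where both series have nonnegative terms. *)
have [l2 h2] := @mono_limit (fun N => \sum_(n < N) (x n + w n)) (B + B)
  ltac:(by move=> n /=; rewrite big_ord_recr lerDl /= -lerBlDr sub0r; have := hx n; rewrite ler_norml => /andP[])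
  ltac:(by move=> n /=; rewrite big_split; apply: lerD; [apply: le_trans (hB n); apply: ler_sum => i _; apply: le_trans (hx i); exact: ler_norm|exact: hB]).
exists (l2 - l1) => e e0; have e2 : 0 < e / 2 by rewrite divr_gt0.
have [n1 a1] := h1 _ e2; have [n2 a2] := h2 _ e2.
exists (maxn n1 n2) => n; rewrite geq_max => /andP[/a1 b1 /a2 b2].
move: b2; rewrite big_split /=; move: b1; rewrite !ltr_norml => /andP[? ?] /andP[? ?].
by apply/andP; split; lra.
Qed.

Lemma cseries_limit (a : nat -> R[i]) (w : nat -> R) B : (forall n, cabs (a n) <= w n) ->
  (forall N, \sum_(n < N) w n <= B) -> exists l, ccvg (fun N => \sum_(n < N) a n) l.
Proof.
move=> ha hB.
have [p hp] := @abs_series_limit (fun n => complex.Re (a n)) w B (fun n => le_trans (Re_le_cabs _) (ha n)) hB.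
have [q hq] := @abs_series_limit (fun n => complex.Im (a n)) w B (fun n => le_trans (Im_le_cabs _) (ha n)) hB.
exists (p +i* q) => e e0; have e2 : 0 < e / 2 by rewrite divr_gt0.
have [n1 a1] := hp _ e2; have [n2 a2] := hq _ e2.
exists (maxn n1 n2) => n; rewrite geq_max => /andP[/a1 b1 /a2 b2].
have eR : complex.Re (\sum_(i < n) a i) = \sum_(i < n) complex.Re (a i).
  by elim/big_ind2: _ => // *; rewrite ReD; congr (_ + _).
have eI : complex.Im (\sum_(i < n) a i) = \sum_(i < n) complex.Im (a i).
  by elim/big_ind2: _ => // *; rewrite ImD; congr (_ + _).
apply: le_lt_trans (cabs_le_ReIm _) _.
rewrite ReD ImD eR eI /= ; lra.
Qed.

(** A telescoping substitute for 1/n^2, with partial sums visibly at most 1. *)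
Definition tw (n : nat) : R := (n.+1%:R * n.+2%:R)^-1.

Lemma tw_ge0 n : 0 <= tw n.
Proof. by rewrite invr_ge0 mulr_ge0. Qed.

Lemma tw_sum N : \sum_(n < N) tw n <= 1.
Proof.
suff -> : \sum_(n < N) tw n = 1 - N.+1%:R^-1 by rewrite gerBl invr_ge0.
elim: N => [|N IH]; first by rewrite big_ord0 invr1 subrr.
rewrite big_ord_recr /= IH /tw -[N.+2%:R]natr1.
have h : (N.+1%:R : R) != 0 by rewrite pnatr_eq0.
have h2 : (N.+1%:R + 1 : R) != 0 by rewrite natr1 pnatr_eq0.
by move: (N.+1%:R : R) h h2 => x h h2; field; rewrite h h2.
Qed.

Lemma inv_sq_tw n : n.+1%:R ^- 2 <= 2 * tw n.
Proof.
have x0 : (0 : R) < n.+1%:R by rewrite ltr0n.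
have x1 : (1 : R) <= n.+1%:R by rewrite ler1n.
rewrite /tw -[n.+2%:R]natr1; move: (n.+1%:R : R) x0 x1 => x x0 x1.
have y0 : 0 < x + 1 by lra.
rewrite -[X in X <= _]mul1r ler_pdivrMr ?exprn_gt0 //.
rewrite [X in _ <= X](_ : _ = 2 * x / (x + 1)); last by field; rewrite !gt_eqF.
by rewrite ler_pdivlMr //; lra.
Qed.

End ComplexLimits.

(** * The exponential series with remainder *)

Section ComplexExponential.
Variable R : realType.
Implicit Types z w : R[i].

Lemma cexpE z : cexp z = (expR (complex.Re z))%:C * cis (complex.Im z).
Proof. by []. Qed.

Lemma cexpD z w : cexp (z + w) = cexp z * cexp w.
Proof. by rewrite !cexpE ReD ImD expRD cisD rmorphM /=; ring. Qed.

Lemma cexp0 : cexp 0 = 1 :> R[i].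
Proof. by rewrite cexpE expR0 cis0 mulr1. Qed.

Lemma cabs_cexp z : cabs (cexp z) = expR (complex.Re z).
Proof. by rewrite cexpE cabsM cabs_cis mulr1 cabs_real ger0_norm // expR_ge0. Qed.

Lemma cderiv_cexpM z (t : R) : cderiv (fun t => cexp (z * t%:C)) t (z * cexp (z * t%:C)).
Proof.
case: z => p q.
have h (c : R) : is_derive t (1 : R) (fun t : R => c * t) c.
  have := is_deriveZ c (is_derive_id t (1 : R)); move/is_derive_eq; apply.
  by rewrite /GRing.scale /= mulr1.
have h1 := cderiv_real (@is_derive1_comp R (@expR R) (fun t : R => p * t) t _ _ (is_derive_expR _) (h p)).
have h2 := @cderiv_comp R (@cis R) (fun t : R => q * t) t _ _ (cderiv_cis _) (h q).
have E s : (p +i* q) * s%:C = (p * s) +i* (q * s) by simpc.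
apply: cderiv_eq (cderiv_ext _ (cderivM h1 h2)) _ => [s|].
  by rewrite cexpE E.
rewrite cexpE E /= rmorphM /= (_ : p +i* q = p%:C + 'i%C * q%:C); last by simpc.
ring.
Qed.

Lemma cderiv_pow_bound (f df : R -> R[i]) (C b : R) k : f 0 = 0 ->
  (forall t, 0 <= t <= b -> cderiv f t (df t)) ->
  (forall t, 0 <= t <= b -> cabs (df t) <= C * t ^+ k / (k`!)%:R) ->
  forall t, 0 <= t <= b -> cabs (f t) <= 2 * C * t ^+ k.+1 / (k.+1`!)%:R.
Proof.
move=> f0 hd hB t /andP[t0 tb].
have kf : (k.+1`!%:R : R) != 0 by rewrite pnatr_eq0 -lt0n fact_gt0.
have hpow (x : R) : is_derive x (1 : R) (fun t : R => C * t ^+ k.+1 / (k.+1`!)%:R) (C * x ^+ k / (k`!)%:R).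
  have := is_deriveZ (C / (k.+1`!)%:R) (is_deriveX k.+1 (is_derive_id x (1 : R))).
  rewrite (_ : (_ \*: _) = fun t : R => C * t ^+ k.+1 / (k.+1`!)%:R); last first.
    apply/funext => y; transitivity (C / (k.+1`!)%:R * y ^+ k.+1); last by ring.
    by congr (_ * _); rewrite exprfctE.
  move/is_derive_eq; apply; rewrite /GRing.scale /= mulr1 factS natrM.
  have a1 : (k.+1%:R : R) != 0 by rewrite pnatr_eq0.
  have a2 : ((k`!)%:R : R) != 0 by rewrite pnatr_eq0 -lt0n fact_gt0.
  by move: (k.+1%:R : R) a1 => y a1; field; rewrite a1 a2.
have key (g dg : R -> R) : g 0 = 0 -> (forall t, 0 <= t <= b -> is_derive t (1 : R) g (dg t)) ->
  (forall t, 0 <= t <= b -> dg t <= C * t ^+ k / (k`!)%:R) ->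
  g t <= C * t ^+ k.+1 / (k.+1`!)%:R.
  move=> g0 hg hdg.
  have hG x : 0 <= x <= t -> is_derive x (1 : R) (g - (fun t : R => C * t ^+ k.+1 / (k.+1`!)%:R)) (dg x - C * x ^+ k / (k`!)%:R).
    move=> /andP[x0 xt]; have hx : 0 <= x <= b by rewrite x0 (le_trans xt tb).
    exact: (is_deriveB (hg x hx) (hpow x)).
  have [c] := @MVT_segment R _ (fun x => dg x - C * x ^+ k / (k`!)%:R) 0 t t0
    (fun x hx => hG x ltac:(by move: hx; rewrite in_itv /= => /andP[/ltW -> /ltW ->]))
    ltac:(apply: derivable_within_continuous => x; rewrite in_itv /= => hx; exact: (@ex_derive _ _ _ _ _ _ _ (hG x hx))).
  rewrite in_itv /= => /andP[c0 ct].
  rewrite [X in X - _ = _](_ : _ = g t - C * t ^+ k.+1 / (k.+1`!)%:R) //.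
  rewrite [X in _ - X = _](_ : _ = 0); last first.
    by rewrite [LHS](_ : _ = g 0 - C * 0 ^+ k.+1 / (k.+1`!)%:R) // g0 expr0n mulr0 mul0r subrr.
  rewrite !subr0 => e; rewrite -subr_le0 e; apply: mulr_le0_ge0 => //.
  by rewrite subr_le0 hdg // c0 (le_trans ct tb).
have e2 : 2 * C * t ^+ k.+1 / (k.+1`!)%:R = C * t ^+ k.+1 / (k.+1`!)%:R + C * t ^+ k.+1 / (k.+1`!)%:R by ring.
rewrite e2; apply: le_trans (cabs_le_ReIm _) _; apply: lerD; rewrite ler_norml lerNl.
  apply/andP; split.
    apply: (key (fun x => - complex.Re (f x)) (fun x => - complex.Re (df x))); first by rewrite f0 oppr0.
      by move=> x /hd [h _]; exact: is_deriveN.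
    by move=> x /hB; apply: le_trans; apply: le_trans (Re_le_cabs _); rewrite -normrN; exact: ler_norm.
  apply: (key (fun x => complex.Re (f x)) (fun x => complex.Re (df x))); first by rewrite f0.
    by move=> x /hd [].
  by move=> x /hB; apply: le_trans; apply: le_trans (Re_le_cabs _); exact: ler_norm.
apply/andP; split.
  apply: (key (fun x => - complex.Im (f x)) (fun x => - complex.Im (df x))); first by rewrite f0 oppr0.
    by move=> x /hd [_ h]; exact: is_deriveN.
  by move=> x /hB; apply: le_trans; apply: le_trans (Im_le_cabs _); rewrite -normrN; exact: ler_norm.
apply: (key (fun x => complex.Im (f x)) (fun x => complex.Im (df x))); first by rewrite f0.
  by move=> x /hd [].
by move=> x /hB; apply: le_trans; apply: le_trans (Im_le_cabs _); exact: ler_norm.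
Qed.

Definition cexp_rest z J (t : R) : R[i] :=
  cexp (z * t%:C) - \sum_(j < J) (z * t%:C) ^+ j / (j`!)%:R.

Lemma cderiv_cexp_rest z J t : cderiv (cexp_rest z J.+1) t (z * cexp_rest z J t).
Proof.
have h : cderiv (fun s : R => z * s%:C) t z.
  by have := cderivZ z (cderiv_real (is_derive_id t (1 : R))); rewrite mulr1.
have hj (j : nat) : cderiv (fun s : R => (z * s%:C) ^+ j.+1 / (j.+1`!)%:R) t (z * ((z * t%:C) ^+ j / (j`!)%:R)).
  have := cderivM (cderivX j h) (cderiv_cst (((j.+1)`!)%:R^-1) t).
  move/cderiv_eq; apply; rewrite mulr0 addr0 factS natrM.
  have gen (n1 f1 y i2 : R[i]) : n1 != 0 -> f1 != 0 -> n1 * y * i2 / (n1 * f1) = i2 * (y / f1).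
    by move=> h1 h2; field; rewrite h1 h2.
  by apply: gen; rewrite pnatr_eq0 // -lt0n fact_gt0.
have hs := cderiv_sum (fun j : 'I_J => hj j).
have := cderivB (cderiv_cexpM z t) (cderivD (cderiv_cst 1 t) hs).
rewrite add0r -mulr_sumr -mulrBr; apply: cderiv_ext => s.
by rewrite /cexp_rest big_ord_recl expr0 fact0 divr1; congr (_ - (_ + _)).
Qed.

(** Differentiation lowers J by one, and integrating the bound back costs a factor 2 each time; the
    resulting 2^J is harmless against J!. *)
Lemma cexp_rest_bound z J : forall t, 0 <= t <= 1 ->
  cabs (cexp_rest z J t) <= expR (cabs z) * (2 * cabs z) ^+ J * t ^+ J / (J`!)%:R.
Proof.
elim: J => [|J IH] t ht.
  rewrite /cexp_rest big_ord0 subr0 !expr0 fact0 divr1 !mulr1 cabs_cexp ler_expR.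
  have /andP[t0 t1] := ht.
  rewrite ReM /= mulr0 subr0; apply: le_trans (ler_norm _) _; rewrite normrM.
  by rewrite -[X in _ <= X]mulr1; apply: ler_pM; rewrite ?normr_ge0 ?Re_le_cabs // ger0_norm.
have -> : expR (cabs z) * (2 * cabs z) ^+ J.+1 = 2 * (cabs z * (expR (cabs z) * (2 * cabs z) ^+ J)).
  by rewrite exprS; ring.
apply: (@cderiv_pow_bound (cexp_rest z J.+1) (fun t => z * cexp_rest z J t) _ 1) => //.
- rewrite /cexp_rest mulr0 cexp0 big_ord_recl expr0 fact0 divr1 big1 ?addr0 ?subrr // => i _.
  by rewrite lift0 expr0n mul0r.
- by move=> x _; exact: cderiv_cexp_rest.
move=> x hx; rewrite cabsM; apply: le_trans (ler_wpM2l (cabs_ge0 z) (IH x hx)) _.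
by rewrite !mulrA.
Qed.

Lemma cexp_series z : ccvg (fun J => \sum_(j < J) z ^+ j / (j`!)%:R) (cexp z).
Proof.
apply: (@ccvg_le _ _ _ (fun J => expR (cabs z) * ((2 * cabs z) ^+ J / (J`!)%:R))).
  move=> J; have := @cexp_rest_bound z J 1; rewrite ler01 lexx expr1n mulr1 /cexp_rest mulr1 cabs_distC -mulrA.
  exact.
rewrite -[X in _ --> X](mulr0 (expR (cabs z))); apply: cvgM; first exact: cvg_cst.
exact: (cvg_series_cvg_0 (is_cvg_series_exp_coeff (2 * cabs z))).
Qed.

End ComplexExponential.

(** * Finite differences of powers *)

Section ForwardDifference.
Variable R : realType.

Fixpoint fdiff T (g : R -> R[i]) : R -> R[i] :=
  if T is T'.+1 then fdiff T' (fun x => g (x + 1) - g x) else g.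

Lemma fdiffS T g x : fdiff T.+1 g x = fdiff T g (x + 1) - fdiff T g x.
Proof. by elim: T g => [|T IH] g //; rewrite -IH. Qed.

Lemma fdiff_sum T n (c : 'I_n -> R[i]) (g : 'I_n -> R -> R[i]) x :
  fdiff T (fun x => \sum_(i < n) c i * g i x) x = \sum_(i < n) c i * fdiff T (g i) x.
Proof.
elim: T x => [|T IH] x //.
rewrite fdiffS !IH -sumrB; apply: eq_bigr => i _.
by rewrite fdiffS mulrBr.
Qed.

Lemma fdiff_ccvg T (g : nat -> R -> R[i]) (h : R -> R[i]) x :
  (forall k, ccvg (fun n => g n (x + k%:R)) (h (x + k%:R))) ->
  ccvg (fun n => fdiff T (g n) x) (fdiff T h x).
Proof.
elim: T x => [|T IH] x hc; first by have := hc 0%N; rewrite addr0.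
rewrite fdiffS; apply: ccvg_ext (ccvgB (IH (x + 1) _) (IH x hc)) => [n|k]; first by rewrite fdiffS.
by have := hc k.+1; rewrite -[k.+1%:R]natr1 [_ + 1]addrC addrA.
Qed.

(** [G i] plays the i-th derivative of [G 0]. Each difference is traded for a derivative at the cost
    of the factor 2 of [cderiv_bound]. *)
Lemma fdiff_bound T (G : nat -> R -> R[i]) x0 B : 0 < x0 ->
  (forall i x, 0 < x -> cderiv (G i) x (G i.+1 x)) ->
  (forall x, x0 <= x -> cabs (G T x) <= B) ->
  cabs (fdiff T (G 0%N) x0) <= 2 ^+ T * B.
Proof.
elim: T G B => [|T IH] G B x0p hG hB; first by rewrite mul1r hB.
rewrite exprSr -mulrA; apply: (IH (fun i x => G i (x + 1) - G i x)) => //.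
  move=> i x xp; apply: cderivB (hG i x xp).
  have hs : is_derive x (1 : R) (fun y : R => y + 1) 1.
    have := is_deriveD (is_derive_id x (1 : R)) (is_derive_cst (1 : R) x (1 : R)).
    by move/is_derive_eq; apply; rewrite addr0.
  have := @cderiv_comp R (G i) (fun y : R => y + 1) x _ _ (hG i (x + 1) ltac:(lra)) hs.
  by rewrite mulr1.
move=> x hx; have := @cderiv_bound R (G T) (G T.+1) x (x + 1) B.
rewrite [x + 1 - x]addrAC subrr add0r mulr1; apply; first by rewrite lerDl.
  by move=> t /andP[h _]; apply: hG; lra.
by move=> t /andP[h _]; apply: hB; lra.
Qed.

End ForwardDifference.

Section PowerFamily.
Variable R : realType.
Implicit Types z s : R[i].

(** The coefficient of w^j in the expansion of x^(-(z + w)). *)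
Definition lpow z j (x : R) : R[i] := cexp (- z * (ln x)%:C) * ((- ln x) ^+ j / (j`!)%:R)%:C.

(** The T-th derivative in x: each differentiation raises z by one and either keeps j or lowers it
    by one. *)
Fixpoint lpowD T z j : R -> R[i] :=
  if T is T'.+1 then
    fun x => - z * lpowD T' (z + 1) j x - (if j is j'.+1 then lpowD T' (z + 1) j' x else 0)
  else lpow z j.

Lemma cderiv_lpow z j x : 0 < x -> cderiv (lpow z j) x (lpowD 1 z j x).
Proof.
move=> x0; have hl := is_derive1_ln x0.
have h1 := @cderiv_comp R (fun t => cexp (- z * t%:C)) (@ln R) x _ _ (cderiv_cexpM (- z) (ln x)) hl.
have xl : (x^-1)%:C = cexp (- 1 * (ln x)%:C).
  have -> : - 1 * (ln x)%:C = (- ln x)%:C by rewrite mulN1r rmorphN.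
  by rewrite cexpE /= cis0 mulr1 expRN lnK.
have ez : cexp (- (z + 1) * (ln x)%:C) = cexp (- z * (ln x)%:C) * (x^-1)%:C.
  by rewrite xl -cexpD; congr cexp; ring.
case: j => [|j].
  apply: cderiv_eq (cderiv_ext _ (cderivM h1 (cderiv_cst 1 x))) _ => [t|].
    by rewrite /lpow expr0 fact0 divr1 rmorph1.
  by rewrite /= /lpow expr0 fact0 divr1 rmorph1 ez; ring.
have hp : is_derive x (1 : R) (fun t : R => (- ln t) ^+ j.+1 / (j.+1`!)%:R) (- ((- ln x) ^+ j / (j`!)%:R) / x).
  have := is_deriveZ ((j.+1`!)%:R^-1) (is_deriveX j.+1 (is_deriveN hl)).
  rewrite (_ : (_ \*: _) = fun t : R => (- ln t) ^+ j.+1 / (j.+1`!)%:R); last first.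
    apply/funext => y; transitivity ((j.+1`!)%:R^-1 * (- ln y) ^+ j.+1); last by rewrite mulrC.
    by congr (_ * _); rewrite exprfctE.
  move/is_derive_eq; apply; rewrite /GRing.scale /= factS natrM.
  have a1 : (j.+1%:R : R) != 0 by rewrite pnatr_eq0.
  have a2 : ((j`!)%:R : R) != 0 by rewrite pnatr_eq0 -lt0n fact_gt0.
  rewrite [X in X ^+ j](_ : _ = - ln x) //.
  by move: (j.+1%:R : R) a1 => y a1; field; rewrite a1 a2 gt_eqF.
apply: cderiv_eq (cderivM h1 (cderiv_real hp)) _.
by rewrite /= /lpow ez !rmorphM rmorphN /= !rmorphM /=; ring.
Qed.

Lemma cderiv_lpowD T z j x : 0 < x -> cderiv (lpowD T z j) x (lpowD T.+1 z j x).
Proof.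
move=> x0; elim: T z j => [|T IH] z j; first exact: cderiv_lpow.
case: j => [|j]; first exact: cderivB (cderivZ _ (IH _ _)) (cderiv_cst 0 x).
exact: cderivB (cderivZ _ (IH _ _)) (IH _ _).
Qed.

Lemma pow_fact_le_expR (L : R) j : 0 <= L -> L ^+ j / (j`!)%:R <= expR L.
Proof.
move=> L0; have := @cexp_series R (L%:C).
set u := fun J => _; move=> hc.
have ru J : u J = (\sum_(k < J) L ^+ k / (k`!)%:R)%:C.
  by rewrite /u rmorph_sum; apply: eq_bigr => k _; rewrite rmorphM rmorphXn fmorphV rmorph_nat.
rewrite leNgt; apply/negP => h.
have [n0 hn] := hc (L ^+ j / (j`!)%:R - expR L) ltac:(by rewrite subr_gt0).
have := hn (maxn n0 j.+1) (leq_maxl _ _).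
rewrite ru cexpE /= cis0 mulr1 -rmorphB /= cabs_real => h1.
have : L ^+ j / (j`!)%:R <= \sum_(k < maxn n0 j.+1) L ^+ k / (k`!)%:R.
  rewrite (bigD1 (Ordinal (leq_maxr n0 j.+1))) //= lerDl; apply: sumr_ge0 => k _.
  by rewrite divr_ge0 ?exprn_ge0.
by have := ler_norm (\sum_(k < maxn n0 j.+1) L ^+ k / (k`!)%:R - expR L); lra.
Qed.

(** The bound is uniform in j because (ln x)^j / j! <= e^(ln x) = x; this costs one power of x, the
    1 in the exponent. *)
Lemma lpowD_bound T z : exists2 C : R, 0 <= C & forall j x, 1 <= x ->
  cabs (lpowD T z j x) <= C * expR ((1 - complex.Re z - T%:R) * ln x).
Proof.
elim: T z => [|T IH] z.
  exists 1 => // j x x1; have L0 : 0 <= ln x by rewrite ln_ge0.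
  rewrite /= /lpow cabsM cabs_cexp cabs_real mul1r subr0 mulrDl expRD mul1r mulrC.
  have -> : complex.Re (- z * (ln x)%:C) = - complex.Re z * ln x by case: z => a b; simpc.
  apply: ler_pM; rewrite ?normr_ge0 ?expR_ge0 //.
  rewrite normrM normrX normrN (ger0_norm L0) ger0_norm ?invr_ge0 //.
  exact: pow_fact_le_expR.
have [C C0 h] := IH (z + 1).
exists (cabs z * C + C); first by rewrite addr_ge0 ?mulr_ge0 ?cabs_ge0.
move=> j x x1.
have e : 1 - complex.Re (z + 1) - T%:R = 1 - complex.Re z - T.+1%:R by rewrite ReD -[T.+1%:R]natr1 /=; ring.
rewrite [lpowD _ _ _ _]/= mulrDl; apply: le_trans (cabsB _ _) _; apply: lerD.
  rewrite cabsM cabsN -mulrA; apply: ler_wpM2l; first exact: cabs_ge0.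
  by rewrite -e; exact: h.
case: j => [|j]; first by rewrite cabs0 mulr_ge0 ?expR_ge0.
by rewrite -e; exact: h.
Qed.

(** The condition on Re z + T brings the exponent 1 - Re z - T down to -2 or below, where [tw]
    dominates. *)
Lemma fdiff_lpow_bound T z : 3 <= complex.Re z + T%:R -> exists2 C : R, 0 <= C &
  forall j n, cabs (fdiff T (lpow z j) n.+1%:R) <= C * tw R n.
Proof.
move=> hz; have [C C0 h] := lpowD_bound T z.
exists (2 ^+ T * (C * 2)); first by rewrite !mulr_ge0 ?exprn_ge0.
move=> j n; have n0 : (0 : R) < n.+1%:R by rewrite ltr0n.
have n1 : (1 : R) <= n.+1%:R by rewrite ler1n.
rewrite -mulrA; apply: le_trans (@fdiff_bound R T (fun i => lpowD i z j) n.+1%:R (C * n.+1%:R ^- 2) n0 _ _) _.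
- by move=> i x x0; exact: cderiv_lpowD.
- move=> x hx; have x1 : 1 <= x by exact: le_trans hx.
  have x0 : 0 < x by exact: lt_le_trans x1.
  apply: le_trans (h j x x1) _; apply: ler_wpM2l => //.
  apply: (@le_trans _ _ (expR (- (2 * ln n.+1%:R)))).
    rewrite ler_expR; have L0 : 0 <= ln x by rewrite ln_ge0.
    have Ln : ln n.+1%:R <= ln x by rewrite ler_ln ?posrE.
    apply: (@le_trans _ _ (- 2 * ln x)); first by apply: ler_wpM2r => //; lra.
    by lra.
  rewrite expRN mulrDl !mul1r expRD lnK ?posrE // expr2 //.
rewrite -mulrA ler_wpM2l ?exprn_ge0 // ler_wpM2l //; exact: inv_sq_tw.
Qed.

Lemma lpow_series z w x : ccvg (fun J => \sum_(j < J) w ^+ j * lpow z j x) (lpow (z + w) 0 x).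
Proof.
have := ccvgZ (cexp (- z * (ln x)%:C)) (cexp_series (- w * (ln x)%:C)).
rewrite -cexpD.
have -> : cexp (- z * (ln x)%:C + - w * (ln x)%:C) = lpow (z + w) 0 x.
  by rewrite /lpow expr0 fact0 divr1 rmorph1 mulr1; congr cexp; ring.
apply: ccvg_ext => J; rewrite mulr_sumr; apply: eq_bigr => j _.
have -> : - w * (ln x)%:C = w * (- ln x)%:C by rewrite rmorphN mulrN mulNr.
by rewrite exprMn /lpow rmorphM rmorphXn fmorphV rmorph_nat /=; ring.
Qed.

Lemma fdiff_lpow_series T z w x :
  ccvg (fun J => \sum_(j < J) w ^+ j * fdiff T (lpow z j) x) (fdiff T (lpow (z + w) 0) x).
Proof.
have := @fdiff_ccvg R T (fun J y => \sum_(j < J) w ^+ j * lpow z j y) (lpow (z + w) 0) x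
  (fun k => lpow_series z w (x + k%:R)).
by apply: ccvg_ext => J; exact: fdiff_sum.
Qed.

End PowerFamily.

Section PolyDifference.
Variable R : realType.
Implicit Types p : {poly R[i]}.

Definition pdelta p := p \Po ('X + 1) - p.

Fixpoint pdiff T p := if T is T'.+1 then pdiff T' (pdelta p) else p.

Lemma fdiff_poly T (g : R -> R[i]) p x : 0 < x -> (forall y, 0 < y -> g y = p.[y%:C]) ->
  fdiff T g x = (pdiff T p).[x%:C].
Proof.
move=> x0; elim: T g p => [|T IH] g p h; first exact: h.
apply: IH => y y0; rewrite !h //; last by rewrite addr_gt0.
by rewrite /pdelta hornerD hornerN horner_comp hornerD hornerX hornerC rmorphD.
Qed.

Lemma size_pdelta p : (size (pdelta p) <= (size p).-1)%N.
Proof.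
have hX i : (size (('X + 1) ^+ i - 'X^i : {poly R[i]})%R <= i)%N.
  elim: i => [|i IH]; first by rewrite !expr0 subrr size_poly0.
  have -> : ('X + 1) ^+ i.+1 - 'X^(i.+1) = ('X + 1) * (('X + 1) ^+ i - 'X^i) + 'X^i :> {poly R[i]}.
    by rewrite !exprS; ring.
  apply: leq_trans (size_polyD _ _) _; rewrite geq_max size_polyXn leqnn andbT.
  apply: leq_trans (size_polyMleq _ _) _.
  by rewrite (_ : size ('X + 1 : {poly R[i]}) = 2) ?size_XaddC //=.
have -> : pdelta p = \sum_(i < size p) p`_i *: (('X + 1) ^+ i - 'X^i).
  rewrite /pdelta {1}/comp_poly horner_coef size_map_polyC.
  rewrite -[X in _ - X](coefK p) poly_def -sumrB; apply: eq_bigr => i _.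
  by rewrite coef_map /= mul_polyC scalerBr.
apply: leq_trans (size_sum _ _ _) _; apply/bigmax_leqP => i _.
apply: leq_trans (size_scale_leq _ _) _; apply: leq_trans (hX i) _.
by have := ltn_ord i; lia.
Qed.

Lemma pdiff_eq0 T p : (size p <= T)%N -> pdiff T p = 0.
Proof.
elim: T p => [|T IH] p h /=; first by apply/eqP; rewrite -size_poly_leq0.
by apply: IH; apply: leq_trans (size_pdelta p) _; lia.
Qed.

(** [LamF_shift] iterated T times. This is the algebraic counterpart of Abel summation, and it
    becomes a finite sum once the differences of p vanish. *)
Lemma LamF_newton T p y :
  (LamF p).[y] = \sum_(t < T) y ^+ t.+1 * (pdiff t p).[1] + y ^+ T * (LamF (pdiff T p)).[y].
Proof.
elim: T p => [|T IH] p; first by rewrite big_ord0 add0r mul1r.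
have h := horner_LamF_shift p y.
have e : (LamF p).[y] = y * (p.[1] + (LamF (pdelta p)).[y]).
  rewrite /pdelta LamFB hornerD hornerN mulrDr mulrBr h; ring.
rewrite e (IH (pdelta p)) big_ord_recl /= expr1 !mulrDr mulr_sumr addrA; congr (_ + _ + _).
  by apply: eq_bigr => t _; rewrite mulrA -exprS.
by rewrite mulrA -exprS.
Qed.

End PolyDifference.

(** * Polylogarithms on the unit circle *)

Section Polylogarithm.
Variable R : realType.
Variables u Y : R[i].
Implicit Types s z : R[i].

Definition plsum T s N := \sum_(n < N) u ^+ n.+1 * fdiff T (lpow s 0) n.+1%:R.
Definition plhead T s := \sum_(t < T) Y ^+ t.+1 * fdiff t (lpow s 0) 1.

(* Abel summation applied T times to the series sum u^n n^(-s). *)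
Definition is_polylog T s (l : R[i]) : Prop :=
  3 <= complex.Re s + T%:R /\
  exists2 S, ccvg (plsum T s) S & l = plhead T s + Y ^+ T * S.

(** The order T must grow as Re s decreases, so no fixed T serves every s; by [is_polylog_unique]
    the admissible orders agree. *)
Definition polylog s : R[i] := xget 0 [set l : R[i] | exists T, is_polylog T s l].

Hypotheses (u1 : cabs u = 1) (uY : Y = u * (1 + Y)).

(** After multiplication by 1 - u, with Y (1 - u) = u, the sums telescope up to the boundary term
    u^N b_N, which tends to 0. *)
Lemma abel_step (b : nat -> R[i]) l : ccvg b 0 ->
  ccvg (fun N => \sum_(n < N) u ^+ n.+1 * (b n.+1 - b n)) l ->
  ccvg (fun N => \sum_(n < N) u ^+ n.+1 * b n) (Y * (b 0%N + l)).
Proof.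
move=> b0 hl.
have u11 : 1 - u != 0.
  rewrite subr_eq0; apply/eqP => e; move: uY; rewrite -e mul1r -[X in X = _]add0r => /addIr/eqP.
  by rewrite eq_sym oner_eq0.
have eY : Y * (1 - u) = u by rewrite mulrBr mulr1 [X in X - _]uY; ring.
have h0 : ccvg (fun N => u ^+ N * b N) 0.
  move=> e /b0 [n0 hn]; exists n0 => n /hn; rewrite !subr0 cabsM cabsX u1 expr1n mul1r //.
have := ccvgZ Y (ccvgD (ccvgB (ccvg_cst (b 0%N)) h0) hl); rewrite subr0.
apply: ccvg_ext => N; apply: (mulIf u11); rewrite mulrAC eY.
elim: N => [|N IH]; first by rewrite !big_ord0 expr0 mul1r subrr addr0 mulr0 mul0r.
rewrite !big_ord_recr /= mulrDl -IH exprS; ring.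
Qed.

Lemma tw_cvg0 (C : R) (b : nat -> R[i]) : (forall n, cabs (b n) <= C * tw R n) -> 0 <= C -> ccvg b 0.
Proof.
move=> hb C0; apply: (@ccvg_le _ _ _ (fun n => C * n.+1%:R^-1)).
  move=> n; rewrite subr0; apply: le_trans (hb n) _; apply: ler_wpM2l => //.
  rewrite /tw invfM -[X in _ <= X]mulr1; apply: ler_wpM2l; first by rewrite invr_ge0.
  by rewrite invf_le1 ?ltr0n // ler1n.
rewrite -[X in _ --> X](mulr0 C); apply: cvgM; first exact: cvg_cst.
exact: cvg_harmonic.
Qed.

Lemma is_polylog_ex T s : 3 <= complex.Re s + T%:R -> exists l, is_polylog T s l.
Proof.
move=> hs; have [C C0 h] := fdiff_lpow_bound hs.
have [S hS] := @cseries_limit R (fun n => u ^+ n.+1 * fdiff T (lpow s 0) n.+1%:R) (fun n => C * tw R n) C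
  ltac:(by move=> n; rewrite cabsM cabsX u1 expr1n mul1r)
  ltac:(by move=> N; rewrite -mulr_sumr -[X in _ <= X]mulr1; apply: ler_wpM2l => //; exact: tw_sum).
by exists (plhead T s + Y ^+ T * S); split=> //; exists S.
Qed.

Lemma plsumS T s N : plsum T.+1 s N =
  \sum_(n < N) u ^+ n.+1 * (fdiff T (lpow s 0) n.+2%:R - fdiff T (lpow s 0) n.+1%:R).
Proof. by apply: eq_bigr => n _; rewrite fdiffS natr1. Qed.

Lemma is_polylogS T s l l' : is_polylog T s l -> is_polylog T.+1 s l' -> l = l'.
Proof.
move=> [hs [S hS ->]] [_ [S' hS' ->]].
have [C C0 hb] := fdiff_lpow_bound hs.
have b0 : ccvg (fun n => fdiff T (lpow s 0) n.+1%:R) 0 by exact: tw_cvg0 (hb 0%N) C0.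
have h := abel_step b0 (ccvg_ext (plsumS T s) hS').
have -> := ccvg_unique hS h.
by rewrite /plhead big_ord_recr /= exprSr; ring.
Qed.

Lemma is_polylog_unique T T' s l l' : is_polylog T s l -> is_polylog T' s l' -> l = l'.
Proof.
have key k : forall T l l', is_polylog T s l -> is_polylog (k + T) s l' -> l = l'.
  elim: k => [|k IH] T1 l1 l2 h1 h2.
    by move: h1 h2 => [_ [S hS ->]] [_ [S' hS' ->]]; rewrite (ccvg_unique hS hS').
  have hs : 3 <= complex.Re s + (k + T1)%:R.
    by have := proj1 h1; rewrite natrD; have := ler0n R k; lra.
  have [l3 h3] := is_polylog_ex hs.
  by rewrite (IH _ _ _ h1 h3); exact: is_polylogS h3 h2.
move=> h h'; case: (leqP T T') => hT.
  by apply: (key (T' - T)%N T) => //; rewrite subnK.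
by apply/esym; apply: (key (T - T')%N T') => //; rewrite subnK // ltnW.
Qed.

Lemma polylogP T s l : is_polylog T s l -> polylog s = l.
Proof.
move=> h; rewrite /polylog; case: xgetP => [l' _ [T' h']|/(_ l)].
  exact: is_polylog_unique h' h.
by case; exists T.
Qed.

Lemma ex_order (x : R) : exists T : nat, x <= T%:R.
Proof.
exists (Num.bound `|x|); apply: le_trans (ler_norm x) _.
by apply: ltW; apply: archi_boundP.
Qed.

Lemma geom_le (x : R) n : 0 <= x < 1 -> \sum_(i < n) x ^+ i <= (1 - x)^-1.
Proof.
move=> /andP[x0 x1]; have h : 0 < 1 - x by rewrite subr_gt0.
rewrite -[X in _ <= X]mul1r ler_pdivlMr //.
have := subrX1 x n; move=> e.
have -> : (\sum_(i < n) x ^+ i) * (1 - x) = 1 - x ^+ n.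
  by rewrite -opprB -[RHS]opprB e; ring.
by rewrite gerBl exprn_ge0.
Qed.

Lemma polylog_analytic z : exists c : nat -> R[i], forall s, cabs (s - z) < 1 ->
  ccvg (fun J => \sum_(j < J) c j * (s - z) ^+ j) (polylog s).
Proof.
(* With Re z + T >= 4 the same order T is admissible on the whole disc |s - z| < 1. *)
have [T hT] := ex_order (4 - complex.Re z).
have hz : 3 <= complex.Re z + T%:R by lra.
have [C C0 hC] := fdiff_lpow_bound hz.
have /choice [S hS] : forall j, exists S, ccvg (fun N => \sum_(n < N) u ^+ n.+1 * fdiff T (lpow z j) n.+1%:R) S.
  move=> j; apply: (@cseries_limit R (fun n => u ^+ n.+1 * fdiff T (lpow z j) n.+1%:R) (fun n => C * tw R n) C).
    by move=> n; rewrite cabsM cabsX u1 expr1n mul1r.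
  by move=> N; rewrite -mulr_sumr -[X in _ <= X]mulr1; apply: ler_wpM2l => //; exact: tw_sum.
exists (fun j => \sum_(t < T) Y ^+ t.+1 * fdiff t (lpow z j) 1 + Y ^+ T * S j) => s hs.
set w := s - z in hs *; have es : s = z + w by rewrite /w addrCA subrr addr0.
clearbody w.
have hs3 : 3 <= complex.Re s + T%:R.
  by have := Re_le_cabs w; rewrite es ReD ler_norml => /andP[h _]; lra.
have [l hl] := is_polylog_ex hs3.
rewrite (polylogP hl); have [_ [S' hS' ->]] := hl.
have w01 : 0 <= cabs w < 1 by rewrite cabs_ge0.
(* The tail of the expansion in w is geometric in J, uniformly in n up to the summable weight
   [tw R n]; this justifies exchanging the limits in J and N. *)
have tail J n : cabs (\sum_(j < J) w ^+ j * fdiff T (lpow z j) n.+1%:R - fdiff T (lpow s 0) n.+1%:R)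
    <= C * tw R n * (cabs w ^+ J / (1 - cabs w)).
  pose v J := \sum_(j < J) w ^+ j * fdiff T (lpow z j) n.+1%:R.
  have hv : ccvg v (fdiff T (lpow s 0) n.+1%:R) by rewrite es; exact: fdiff_lpow_series.
  have hv2 : ccvg (fun k => v J - v (J + k)%N) (v J - fdiff T (lpow s 0) n.+1%:R).
    apply: ccvgB (ccvg_cst _) _ => e /hv [n0 hn]; exists n0 => k hk; apply: hn.
    exact: leq_trans hk (leq_addl _ _).
  apply: ccvg_bound hv2 _ => k; rewrite cabs_distC.
  rewrite [X in cabs X](_ : _ = \sum_(i < k) w ^+ (J + i) * fdiff T (lpow z (J + i)) n.+1%:R); last first.
    by rewrite /v big_split_ord /= addrAC subrr add0r.
  apply: le_trans (cabs_sum _ _ _) _.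
  apply: (@le_trans _ _ (\sum_(i < k) C * tw R n * (cabs w ^+ J * cabs w ^+ i))).
    apply: ler_sum => i _; rewrite cabsM cabsX exprD mulrC.
    by apply: ler_wpM2r; rewrite ?mulr_ge0 ?exprn_ge0 ?cabs_ge0.
  rewrite -mulr_sumr -mulr_sumr; apply: ler_wpM2l; first by rewrite mulr_ge0 ?tw_ge0.
  by apply: ler_wpM2l; [rewrite exprn_ge0 ?cabs_ge0|exact: geom_le].
have h2 : ccvg (fun J => \sum_(j < J) w ^+ j * S j) S'.
  apply: (@ccvg_geom _ (C / (1 - cabs w)) _ _ _ w01) => J.
  pose d N := \sum_(j < J) w ^+ j * (\sum_(n < N) u ^+ n.+1 * fdiff T (lpow z j) n.+1%:R) - plsum T s N.
  have hd : ccvg d (\sum_(j < J) w ^+ j * S j - S').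
    by apply: ccvgB hS'; apply: ccvg_sum => j; apply: ccvgZ; exact: hS.
  apply: ccvg_bound hd _ => N.
  have -> : d N = \sum_(n < N) u ^+ n.+1 * (\sum_(j < J) w ^+ j * fdiff T (lpow z j) n.+1%:R - fdiff T (lpow s 0) n.+1%:R).
    rewrite /d /plsum; under eq_bigr do rewrite mulr_sumr.
    rewrite exchange_big -sumrB; apply: eq_bigr => n _ /=.
    by rewrite mulrBr mulr_sumr; congr (_ - _); apply: eq_bigr => j _; rewrite mulrCA.
  apply: le_trans (cabs_sum _ _ _) _.
  apply: (@le_trans _ _ (\sum_(n < N) tw R n * (C * (cabs w ^+ J / (1 - cabs w))))).
    apply: ler_sum => n _; rewrite cabsM cabsX u1 expr1n mul1r; apply: le_trans (tail J n) _.
    by rewrite [X in _ <= X]mulrA [tw R n * C]mulrC.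
  rewrite -mulr_suml -[X in _ <= X]mul1r.
  have -> : C / (1 - cabs w) * cabs w ^+ J = C * (cabs w ^+ J / (1 - cabs w)) by ring.
  apply: ler_wpM2r; last exact: tw_sum.
  have /andP[_ w1] := w01.
  by rewrite mulr_ge0 // divr_ge0 ?exprn_ge0 ?cabs_ge0 // subr_ge0 ltW.
have h1 : ccvg (fun J => \sum_(t < T) Y ^+ t.+1 * \sum_(j < J) w ^+ j * fdiff t (lpow z j) 1) (plhead T s).
  by rewrite es; apply: ccvg_sum => t; apply: ccvgZ; exact: fdiff_lpow_series.
apply: ccvg_ext (ccvgD h1 (ccvgZ (Y ^+ T) h2)) => J.
under eq_bigr do rewrite mulr_sumr.
rewrite exchange_big mulr_sumr -big_split; apply: eq_bigr => j _ /=.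
rewrite mulrDl mulr_suml; congr (_ + _); last by rewrite [in RHS]mulrAC mulrA.
by apply: eq_bigr => t _; ring.
Qed.

Lemma polylog_series s : 1 < complex.Re s ->
  ccvg (fun N => \sum_(n < N) u ^+ n.+1 * lpow s 0 n.+1%:R) (polylog s).
Proof.
(* Order 2 is admissible for Re s > 1, and two Abel steps lead back to the series itself. *)
move=> hs; have hs3 : 3 <= complex.Re s + 2%:R by lra.
have [l hl] := is_polylog_ex hs3.
rewrite (polylogP hl); have [_ [S hS ->]] := hl.
have b0 : ccvg (fun n => fdiff 0 (lpow s 0) n.+1%:R) 0.
  apply: (@ccvg_le _ _ _ (fun n => n.+1%:R^-1)); last exact: cvg_harmonic.
  move=> n; have n0 : (0 : R) < n.+1%:R by rewrite ltr0n.
  rewrite subr0 /= /lpow expr0 fact0 divr1 rmorph1 mulr1 cabs_cexp.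
  have -> : n.+1%:R^-1 = expR (- ln n.+1%:R) :> R by rewrite expRN lnK.
  rewrite ler_expR; have L0 : 0 <= ln (n.+1%:R : R) by rewrite ln_ge0 // ler1n.
  have -> : complex.Re (- s * (ln n.+1%:R)%:C) = - (complex.Re s * ln n.+1%:R) by rewrite ReM /= mulr0 subr0 -mulNr; congr (_ * _); case: (s).
  by rewrite lerN2 ler_peMl // ltW.
have b1 : ccvg (fun n => fdiff 1 (lpow s 0) n.+1%:R) 0.
  have := ccvgB (ccvg_shift b0) b0; rewrite subrr; apply: ccvg_ext => n.
  by rewrite fdiffS natr1.
have h1 := abel_step b1 (ccvg_ext (plsumS 1 s) hS).
have h0 := abel_step b0 (ccvg_ext (plsumS 0 s) h1).
have -> : plhead 2 s + Y ^+ 2 * S = Y * (fdiff 0 (lpow s 0) 1 + Y * (fdiff 1 (lpow s 0) 1 + S)).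
  by rewrite /plhead !big_ord_recr big_ord0 /= add0r; ring.
exact: h0.
Qed.

Lemma polylog_neg k : polylog (- k%:R) = (Lam R k).[Y].
Proof.
have hp y : 0 < y -> lpow (- k%:R : R[i]) 0 y = ('X^k : {poly R[i]}).[y%:C].
  move=> y0; rewrite /lpow expr0 fact0 divr1 rmorph1 mulr1 opprK hornerXn.
  elim: k => [|k IH]; first by rewrite mul0r cexp0.
  rewrite -natr1 mulrDl mul1r cexpD IH exprSr; congr (_ * _).
  by rewrite cexpE /= cis0 mulr1 lnK.
(* Order k + 3 meets the condition on Re s with equality and annihilates n^k, so the infinite series
   is 0. *)
apply: (@polylogP (k + 3)); split.
  have -> : complex.Re (- k%:R : R[i]) = - k%:R.
    by rewrite -(rmorph_nat (real_complex R)) -rmorphN.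
  by rewrite natrD; lra.
exists 0.
  apply: ccvg_ext (ccvg_cst 0) => N; rewrite /plsum big1 // => n _.
  by rewrite (fdiff_poly _ _ hp) ?ltr0n // pdiff_eq0 ?horner0 ?mulr0 // size_polyXn; lia.
rewrite mulr0 addr0 -LamFXn (LamF_newton (k + 3)) pdiff_eq0 ?LamF0 ?horner0 ?mulr0 ?addr0; last first.
  by rewrite size_polyXn; lia.
by apply: eq_bigr => t _; rewrite (fdiff_poly _ _ hp).
Qed.

End Polylogarithm.

Section CvgBridge.
Variable R : realType.
Implicit Types (v : nat -> R[i]) (l : R[i]).

Lemma ccvg_cvg v l : ccvg v l -> (fun n => v n : R[i]^o) @ \oo --> (l : R[i]^o).
Proof.
move=> h; apply/cvgrPdist_lt => e e0.
have er : e = (complex.Re e)%:C.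
  by move: e0; case: e => p q; rewrite ltcE /= => /andP[/eqP -> _].
have p0 : 0 < complex.Re e by move: e0; rewrite ltcE /= => /andP[_].
have [n0 hn] := h _ p0.
exists n0 => // n /= hnn; rewrite er cabsE ltcR cabs_distC; exact: hn.
Qed.

Lemma cvg_ccvg v l : (fun n => v n : R[i]^o) @ \oo --> (l : R[i]^o) -> ccvg v l.
Proof.
move=> /cvgrPdist_lt h e e0; have [n0 _ hn] := h e%:C ltac:(by rewrite ltcR).
by exists n0 => n hnn; have := hn n hnn; rewrite /= cabsE ltcR cabs_distC.
Qed.

Lemma ccvg_bounded v l : ccvg v l -> exists2 B : R, 0 <= B & forall n, cabs (v n) <= B.
Proof.
move=> /(_ 1 ltr01) [n0 hn].
exists (\sum_(i < n0) cabs (v i) + (cabs l + 1)).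
  by rewrite !addr_ge0 ?cabs_ge0 ?sumr_ge0 // => i _; exact: cabs_ge0.
move=> n; case: (leqP n0 n) => h.
  apply: ler_wpDl; first by apply: sumr_ge0 => i _; exact: cabs_ge0.
  have := ltW (hn n h); have : cabs (v n) <= cabs (v n - l) + cabs l by rewrite -{1}(subrK l (v n)) cabsD.
  by lra.
apply: ler_wpDr; first by rewrite addr_ge0 ?cabs_ge0.
rewrite (bigD1 (Ordinal h)) //= lerDl; apply: sumr_ge0 => i _; exact: cabs_ge0.
Qed.

End CvgBridge.

(** * The identity theorem along the real axis *)

Section IdentityTheorem.
Variable R : realType.

Lemma power_series_eq0 (c : nat -> R[i]) (r : R) : 0 < r ->
  (forall t : R, 0 < t < r -> ccvg (fun N => \sum_(n < N) c n * t%:C ^+ n) 0) ->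
  forall n, c n = 0.
Proof.
move=> r0 hc.
set t0 := r / 2; have t0p : 0 < t0 by rewrite divr_gt0.
have t0r : 0 < t0 < r by rewrite t0p /t0; lra.
have [B B0 hB] := ccvg_bounded (hc t0 t0r).
have hcn n : cabs (c n) * t0 ^+ n <= 2 * B.
  have -> : cabs (c n) * t0 ^+ n = cabs (c n * t0%:C ^+ n).
    by rewrite cabsM cabsX cabs_real ger0_norm // ltW.
  have -> : c n * t0%:C ^+ n = \sum_(i < n.+1) c i * t0%:C ^+ i - \sum_(i < n) c i * t0%:C ^+ i.
    by rewrite big_ord_recr /= addrAC subrr add0r.
  by apply: le_trans (cabsB _ _) _; have := hB n; have := hB n.+1; lra.
move=> n; elim/ltn_ind: n => n IH.
apply/eqP; case: eqVneq => // cn0; exfalso.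
have d0 := cabs_gt0 cn0; set d := cabs (c n) in d0.
pose B' := 2 * B / t0 ^+ n.
have B'0 : 0 <= B' by rewrite divr_ge0 ?mulr_ge0 ?exprn_ge0 // ltW.
(* After division by t^n at t = q t0 the terms beyond c n add up to at most 2 B' q; this q keeps the
   bound below d. *)
pose q := Num.min 2^-1 (d / (4 * B' + 1)).
have q1 : q <= 2^-1 by rewrite ge_min lexx.
have den : 0 < 4 * B' + 1 by rewrite ltr_wpDl // mulr_ge0.
have q2 : q <= d / (4 * B' + 1) by rewrite ge_min lexx orbT.
have q0 : 0 < q by rewrite lt_min invr_gt0 ltr0n divr_gt0.
set t := q * t0.
have tp : 0 < t by rewrite mulr_gt0.
have tr : 0 < t < r.
  by rewrite tp; apply: le_lt_trans (proj2 (andP t0r)); rewrite ler_piMl ?(ltW t0p) //; lra.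
have hs := hc t tr.
pose S K := \sum_(k < K) c (n + k.+1)%N * t%:C ^+ k.+1.
have hS : ccvg (fun K => c n + S K) 0.
  have := ccvgZ (t%:C ^- n) hs; rewrite mulr0 => h e /h [n0 hn].
  exists n0 => K hK; have := hn (n + K.+1)%N (leq_trans hK (leq_trans (leqnSn K) (leq_addl n K.+1))).
  congr (cabs (_ - _) < _).
  rewrite big_split_ord /= big1 ?add0r; last by move=> i _; rewrite IH ?mul0r.
  have tn : t%:C != 0 :> R[i] by rewrite (inj_eq (@complexI R) t 0) gt_eqF.
  rewrite mulr_sumr big_ord_recl /= addn0; congr (_ + _).
    by rewrite mulrCA mulVf ?mulr1 // expf_neq0.
  apply: eq_bigr => k _; rewrite /bump /= add1n exprD mulrCA; congr (_ * _).
  by rewrite mulrA mulVf ?mul1r // expf_neq0.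
have hb K : cabs (c n - (c n + S K)) <= 2 * B' * q.
  rewrite opprD addrA subrr sub0r cabsN; apply: le_trans (cabs_sum _ _ _) _.
  apply: (@le_trans _ _ (\sum_(k < K) B' * q * q ^+ k)).
    apply: ler_sum => k _; rewrite cabsM cabsX cabs_real (ger0_norm (ltW tp)) /t exprMn.
    have := hcn (n + k.+1)%N; rewrite exprD => h.
    rewrite mulrCA (mulrC (cabs _)) mulrC -mulrA -exprS mulrC.
    rewrite [X in _ <= X]mulrC; apply: ler_wpM2l; first by rewrite exprn_ge0 // ltW.
    rewrite /B' ler_pdivlMr ?exprn_gt0 //; apply: le_trans h; rewrite le_eqVlt.
    by apply/orP; left; apply/eqP; ring.
  rewrite -mulr_sumr [2 * B' * q](_ : _ = B' * q * 2); last by ring.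
  apply: ler_wpM2l; first by rewrite mulr_ge0 // ltW.
  have qq : 0 <= q < 1 by rewrite ltW //; lra.
  apply: le_trans (geom_le K qq) _; rewrite -[X in _ <= X]invrK lef_pV2 ?posrE ?invr_gt0 //; lra.
have := ccvg_bound (ccvgB (ccvg_cst (c n)) hS) hb; rewrite subr0 -/d.
move: q2; rewrite ler_pdivlMr // => q2 q3.
have : 0 < d - 2 * B' * q by nra.
by rewrite subr_gt0 ltNge q3.
Qed.

Lemma analytic_ccvg (f : R[i] -> R[i]) z0 : analytic_at f z0 ->
  exists (c : nat -> R[i]) (r : R), 0 < r /\ forall z, cabs (z - z0) < r ->
    ccvg (fun N => \sum_(n < N) c n * (z - z0) ^+ n) (f z).
Proof.
move=> [c [r [r0 h]]]; exists c, r; split=> // z hz.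
have := h z; rewrite cabsE ltcR => /(_ hz) /cvg_ccvg.
by apply: ccvg_ext => N; rewrite /series /= big_mkord.
Qed.

(** Comparing real points only, a supremum replaces connectedness. At the supremum b of the points
    of disagreement the power series of f - g vanishes on an interval to the right of b, hence
    identically, so no disagreement occurs near b. *)
Lemma entire_eq (f g : R[i] -> R[i]) : entire f -> entire g ->
  (forall s, 1 < complex.Re s -> f s = g s) -> forall x : R, f x%:C = g x%:C.
Proof.
move=> hf hg h1.
have hd z0 : exists (c : nat -> R[i]) (r : R), 0 < r /\ forall z, cabs (z - z0) < r ->
    ccvg (fun N => \sum_(n < N) c n * (z - z0) ^+ n) (f z - g z).
  have [c1 [r1 [p1 k1]]] := analytic_ccvg (hf z0).
  have [c2 [r2 [p2 k2]]] := analytic_ccvg (hg z0).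
  exists (fun n => c1 n - c2 n), (Num.min r1 r2); split; first by rewrite lt_min p1.
  move=> z; rewrite lt_min => /andP[z1 z2].
  apply: ccvg_ext (ccvgB (k1 z z1) (k2 z z2)) => N.
  by rewrite -sumrB; apply: eq_bigr => n _; rewrite mulrBl.
move=> x; apply/eqP; case: eqVneq => // /eqP hx; exfalso.
pose E : set R := [set y : R | f y%:C <> g y%:C].
have Eub : has_ubound E.
  by exists 1 => y Ey; rewrite leNgt; apply/negP => y1; apply: Ey; exact: h1.
have Esup : has_sup E by split=> //; exists x.
set b := sup E.
have [c [r [r0 hc]]] := hd b%:C.
have c0 n : c n = 0.
  apply: power_series_eq0 r0 _ n => t /andP[t0 tr].
  have := hc (b%:C + t%:C); rewrite [b%:C + _ - _]addrAC subrr add0r cabs_real ger0_norm ?ltW // => /(_ tr).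
  have -> : f (b%:C + t%:C) = g (b%:C + t%:C).
    rewrite -rmorphD /=; apply: contrapT => hne.
    have := ub_le_sup Eub hne; rewrite -/b; lra.
  by rewrite subrr.
have [y Ey hy] := sup_adherent r0 Esup.
have yb : y <= b by exact: ub_le_sup.
apply: Ey; apply/eqP; rewrite -subr_eq0; apply/eqP.
apply: (@ccvg_unique R (fun=> 0) _ _ _ (ccvg_cst 0)).
have := hc y%:C; rewrite -rmorphB /= cabs_real ler0_norm ?subr_le0 // => /(_ ltac:(rewrite -/b in hy; lra)).
by apply: ccvg_ext => N; rewrite big1 // => n _; rewrite c0 mul0r.
Qed.

End IdentityTheorem.

(** * The L-function of chi and its values at negative odd integers *)

Section ChiLfunction.
Variables (R : realType) (m a : nat).
Hypothesis am : (a < m)%N.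

Local Notation Q := ((2 * m).+1).

Definition chiang (k : nat) : R := pi * (2 * k + 1)%:R / (2 * Q)%:R.

Lemma sin_chiang k : (k < Q)%N -> 0 < sin (chiang k / 2).
Proof.
move=> kQ; have p0 := pi_gt0 R; apply: sin_gt0_pi; rewrite /chiang; apply/andP; split.
  by rewrite !divr_gt0 ?mulr_gt0 ?ltr0n //; lia.
rewrite -!mulrA gtr_pMr // mulrC -invfM -natrM mulrC ltr_pdivrMr ?mul1r ?ltr_nat ?ltr0n; lia.
Qed.

Lemma ycotN (b : R) : ycot (- b) = -1 - ycot b.
Proof.
rewrite /ycot mulNr cosN sinN; simpc; congr (_ +i* _); first by field.
by rewrite invrN mulrN.
Qed.

Definition chiL (s : R[i]) : R[i] := \sum_(k < Q) (fcoef R m a k)%:C *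
  (polylog (cis (chiang k)) (ycot (chiang k)) s + polylog (cis (- chiang k)) (ycot (- chiang k)) s).

Let eY1 (k : 'I_Q) : ycot (chiang k) = cis (chiang k) * (1 + ycot (chiang k)).
Proof. by apply: ycotE; rewrite gt_eqF // sin_chiang. Qed.

Let eY2 (k : 'I_Q) : ycot (- chiang k) = cis (- chiang k) * (1 + ycot (- chiang k)).
Proof. by apply: ycotE; rewrite mulNr sinN oppr_eq0 gt_eqF // sin_chiang. Qed.

Lemma chiL_continuation : L_continuation (chi m a) chiL.
Proof.
split.
  move=> z0.
  have /choice [c1 h1] := fun k : 'I_Q => polylog_analytic (cabs_cis (chiang k)) (eY1 k) z0.
  have /choice [c2 h2] := fun k : 'I_Q => polylog_analytic (cabs_cis (- chiang k)) (eY2 k) z0.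
  exists (fun n => \sum_(k < Q) (fcoef R m a k)%:C * (c1 k n + c2 k n)), 1; split=> // z.
  rewrite cabsE ltcR => hz; apply: ccvg_cvg.
  have h : ccvg (fun N => \sum_(k < Q) (fcoef R m a k)%:C * (\sum_(n < N) c1 k n * (z - z0) ^+ n + \sum_(n < N) c2 k n * (z - z0) ^+ n)) (chiL z).
    by apply: ccvg_sum => k; apply: ccvgZ; apply: ccvgD; [exact: h1|exact: h2].
  apply: ccvg_ext h => N; rewrite /series /= big_mkord.
  under [in RHS]eq_bigr do rewrite mulr_suml.
  rewrite [in RHS]exchange_big; apply: eq_bigr => k _ /=.
  by rewrite -big_split mulr_sumr; apply: eq_bigr => n _ /=; ring.
move=> s hs; apply: ccvg_cvg.
have h : ccvg (fun N => \sum_(k < Q) (fcoef R m a k)%:C * (\sum_(n < N) cis (chiang k) ^+ n.+1 * lpow s 0 n.+1%:R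
   + \sum_(n < N) cis (- chiang k) ^+ n.+1 * lpow s 0 n.+1%:R)) (chiL s).
  apply: ccvg_sum => k; apply: ccvgZ; apply: ccvgD.
    exact: (polylog_series (cabs_cis _) (eY1 k) hs).
  exact: (polylog_series (cabs_cis _) (eY2 k) hs).
apply: ccvg_ext h => N; rewrite /series /= big_mkord.
under eq_bigr do rewrite -big_split mulr_sumr.
rewrite exchange_big; apply: eq_bigr => n _ /=.
rewrite /dirichlet_term.
have -> : (chi m a n.+1)%:~R = ((chi m a n.+1)%:~R : R)%:C :> R[i] by rewrite rmorph_int.
rewrite chi_fourier // rmorph_sum mulr_suml; apply: eq_bigr => k _.
move: (fcoef R m a k) => F; rewrite /lpow expr0 fact0 divr1 rmorph1 mulr1 -mulrDl mulrA; congr (_ * _).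
rewrite !cisX mulNr.
have -> : chiang k * n.+1%:R = pi * (2 * k + 1)%:R * n.+1%:R / (2 * Q)%:R by rewrite /chiang mulrAC.
by rewrite /cis cosN sinN; simpc; congr (_ +i* _); ring.
Qed.

(** At odd negative arguments the reflection u -> 1/u makes the two conjugate polylogarithms equal,
    and the resulting factor 2 cancels the 1/2 of [T]. *)
Lemma T_value n : T R m a n = (-1) ^+ n.+1 * \sum_(k < Q) (fcoef R m a k)%:C * (Lam R (2 * n).+1).[ycot (chiang k)].
Proof.
rewrite /T /L_function; case: xgetP => [L _ [hL1 hL2]|/(_ chiL)]; last by case; exact: chiL_continuation.
have [hE1 hE2] := chiL_continuation.
have e : - (2 * n + 1)%:R = (- (2 * n).+1%:R : R)%:C :> R[i].
  by rewrite rmorphN rmorph_nat addn1.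
rewrite e (@entire_eq _ L chiL hL1 hE1); last first.
  by move=> s hs; apply: ccvg_unique (cvg_ccvg (hL2 s hs)) (cvg_ccvg (hE2 s hs)).
rewrite -e addn1 /chiL -mulrA mulrCA; congr (_ * _).
rewrite mulr_sumr; apply: eq_bigr => k _.
rewrite (polylog_neg (cabs_cis _) (eY1 k)) (polylog_neg (cabs_cis _) (eY2 k)) ycotN horner_Lam_odd.
by field.
Qed.

End ChiLfunction.

(** * The asymptotic expansion *)

Section XasGaussSum.
Variables (R : realType) (m a N : nat).
Hypotheses (am : (a < m)%N) (N0 : (0 < N)%N).

Local Notation Q := ((2 * m).+1).
Local Notation M := (2 * (2 * Q * N))%N.
Let s := (2 * a.+1)%N.
Let E0 := (N + 2 * N ^ 2 * m.+1)%N.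
Let n0 := (Q - s)%N.
Let w := omega R N.
Local Notation g := (@gterm R M).

Let NR0 : (N%:R : R) != 0. Proof. by rewrite pnatr_eq0 -lt0n. Qed.
Let M0 : (0 < M)%N. Proof. by rewrite !muln_gt0. Qed.
Let Me : ~~ odd M. Proof. by rewrite oddM. Qed.
Let QC0 : (Q%:R : R[i]) != 0. Proof. by rewrite pnatr_eq0. Qed.

Lemma omegaN : w ^+ N = 1.
Proof. by rewrite /w omega_cis cisX divfK // cis_2pi. Qed.

(** With n = n0 + 2d, completing the square turns omega^e into a Gaussian term in n, and the factor
    e itself into (n^2 - Mn)/(8Q) plus a constant. This is where the quadratic weight comes from. *)
Lemma omega_gterm d e x : (e + N * d = E0 + x)%N -> (8 * Q * x + n0 ^ 2 = (n0 + 2 * d) ^ 2)%N ->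
  w ^+ e = g (n0 + 2 * d)%N%:Z / g n0%:Z /\
  e%:R = E0%:R + (quadw R M (n0 + 2 * d)%N%:Z - quadw R M n0%:Z) / (8 * Q%:R).
Proof.
move=> h1 h2; split.
  have -> : w ^+ e = w ^+ x.
    have : w ^+ (e + N * d) = w ^+ (E0 + x) by rewrite h1.
    have -> : (E0 = N * (1 + 2 * N * m.+1))%N by rewrite /E0; lia.
    by rewrite !exprD !exprM omegaN !expr1n mulr1 mul1r.
  rewrite /w omega_cis cisX -cisN -cisD; congr cis.
  have h3 : 8 * Q%:R * x%:R + n0%:R ^+ 2 = (n0 + 2 * d)%:R ^+ 2 :> R.
    by rewrite -!natrX -!natrM -natrD h2.
  have gen (P q n' x' y' : R) : n' != 0 -> q != 0 ->
      2 * P / n' * x' = P * (8 * q * x' + y') / (2 * (2 * q * n')) - P * y' / (2 * (2 * q * n')).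
    by move=> hn hq; field; rewrite hn hq.
  rewrite -!pmulrn -h3 (natrM _ 2) (natrM _ (2 * Q)) (natrM _ 2 Q).
  exact: gen.
apply: (mulfI (_ : 8 * Q%:R != 0 :> R[i])); first by rewrite mulf_neq0.
rewrite mulrDr (mulrC _ (_ / _)) divfK ?mulf_neq0 // !quadwE -!pmulrn.
have h3 : 8 * Q%:R * x%:R + n0%:R ^+ 2 = (n0 + 2 * d)%:R ^+ 2 :> R[i].
  by rewrite -!natrX -!natrM -natrD h2.
have h4 : e%:R + N%:R * d%:R = E0%:R + x%:R :> R[i] by rewrite -natrM -!natrD h1.
have -> : e%:R = E0%:R + x%:R - N%:R * d%:R :> R[i] by rewrite -h4 addrK.
have hM : M%:R = 2 * (2 * Q%:R * N%:R) :> R[i].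
  by rewrite (natrM _ 2 (2 * Q * N)) (natrM _ (2 * Q) N) (natrM _ 2 Q).
have hn : (n0 + 2 * d)%:R = n0%:R + 2 * d%:R :> R[i] by rewrite natrD natrM.
rewrite -h3 hM hn.
have gen (q E x' nn d' y : R[i]) : 8 * q * (E + x' - nn * d') =
    8 * q * E + (8 * q * x' + y ^+ 2 - 2 * (2 * q * nn) * (y + 2 * d') - (y ^+ 2 - 2 * (2 * q * nn) * y)).
  by ring.
exact: gen.
Qed.

Lemma qexp0_sq r : (8 * Q * qexp0 m a r + n0 ^ 2 = (n0 + 2 * (Q * r)) ^ 2)%N.
Proof.
have e : (2 * 'C(r, 2) + r = r * r)%N.
  by elim: r => // r IH; rewrite binS bin1; lia.
rewrite /qexp0 /n0 /s.
have [t et] : exists t, m = (t + a.+1)%N by exists (m - a.+1)%N; rewrite subnK.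
rewrite et addnK.
have -> : ((2 * (t + a.+1)).+1 - 2 * a.+1 = (2 * t).+1)%N by lia.
have -> : (8 * (2 * (t + a.+1)).+1 * ('C(r, 2) + r + r ^ 2 * a.+1 + (r + r ^ 2) * t) =
   4 * (2 * (t + a.+1)).+1 * ((2 * 'C(r, 2) + r) + r + 2 * (r ^ 2 * a.+1 + (r + r ^ 2) * t)))%N by ring.
by rewrite e; ring.
Qed.

Lemma X_pairs : N%:R * X R m a N = \sum_(r < N) (-1) ^+ r *
   (quadw R M (2 * Q * r + (Q - s))%N%:Z * g (2 * Q * r + (Q - s))%N%:Z
    - quadw R M (2 * Q * r + (Q + s))%N%:Z * g (2 * Q * r + (Q + s))%N%:Z) / (8 * Q%:R * g n0%:Z).
Proof.
rewrite (X_lev am N0 omegaN) (hikami_root1 N0 am omegaN).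
have h0 := hikami_root0 N0 am omegaN.
rewrite -/w in h0 *.
(* Subtracting A times [hikami_root0] removes E0 and the value of [quadw] at n0, which are common to
   all the exponents. *)
pose A : R[i] := E0%:R - quadw R M n0%:Z / (8 * Q%:R).
rewrite -[LHS]subr0 -[X in _ - X](mulr0 A) -[X in _ - _ * X]h0 mulr_sumr -sumrB; apply: eq_bigr => r _.
have rN := ltn_ord r.
have sQ : (s < Q)%N by rewrite /s; lia.
have Qb : (N * Q * r + 2 * N * a.+1 <= E0)%N by rewrite /E0; nia.
set e1 := (E0 + qexp0 m a r - N * Q * r)%N.
set e2 := (E0 + qexp0 m a r + a.+1 * (2 * r).+1 - N * Q * r - 2 * N * a.+1)%N.
have [a1 b1] := @omega_gterm (Q * r) e1 (qexp0 m a r) ltac:(rewrite /e1; lia) (qexp0_sq r).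
have h2 : (8 * Q * (qexp0 m a r + a.+1 * (2 * r).+1) + n0 ^ 2 = (n0 + 2 * (Q * r + s)) ^ 2)%N.
  have := qexp0_sq r; rewrite mulnDr addnAC => ->.
  have [n1 en] : exists n1, Q = (n1 + s)%N by exists (Q - s)%N; lia.
  by rewrite /n0 en addnK /s; ring.
have [a2 b2] := @omega_gterm (Q * r + s) e2 (qexp0 m a r + a.+1 * (2 * r).+1) ltac:(rewrite /e2 /s; lia) h2.
have -> : (2 * Q * r + (Q - s) = n0 + 2 * (Q * r))%N by rewrite /n0; lia.
have -> : (2 * Q * r + (Q + s) = n0 + 2 * (Q * r + s))%N by rewrite /n0; lia.
rewrite -/E0 -/e1 -/e2 a1 b1 a2 b2 /A.
have gn : g n0%:Z != 0 by exact: gterm_neq0.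
have gen (sg E q1 q0 q2 G1 G0 G2 c : R[i]) : G0 != 0 -> c != 0 ->
   sg * ((E + (q1 - q0) / (8 * c)) * (G1 / G0) - (E + (q2 - q0) / (8 * c)) * (G2 / G0)) -
   (E - q0 / (8 * c)) * (sg * (G1 / G0 - G2 / G0)) = sg * (q1 * G1 - q2 * G2) / (8 * c * G0).
  by move=> h3 h4; field; rewrite h3 h4.
exact: gen.
Qed.

Lemma chi_sum (f : nat -> R[i]) K :
  \sum_(n < 2 * Q * K) (chi m a n)%:~R * f n =
  \sum_(r < K) (-1) ^+ r * (f (2 * Q * r + (Q - s))%N - f (2 * Q * r + (Q + s))%N).
Proof.
have sQ : (s < Q)%N by rewrite /s; lia.
elim: K => [|K IH]; first by rewrite muln0 !big_ord0.
rewrite [RHS]big_ord_recr -[X in _ = _ X _]IH mulnSr big_split_ord; congr (_ + _).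
rewrite [nat_of_ord ord_max]/=.
rewrite (eq_bigr (fun t : 'I_(2 * Q) => (-1) ^+ K * ((nat_of_ord t == Q - s)%N%:R * f (2 * Q * K + t)%N
    - (nat_of_ord t == Q + s)%N%:R * f (2 * Q * K + t)%N))); last first.
  move=> t _; rewrite chi_block // rmorphM rmorphXn rmorphN1 rmorphB /= -mulrA mulrBl //.
rewrite -mulr_sumr sumrB; congr (_ * (_ - _)).
  have h : (Q - s < 2 * Q)%N by lia.
  rewrite (bigD1 (Ordinal h)) //= eqxx mul1r big1 ?addr0 // => t ht.
  have -> : (nat_of_ord t == Q - s)%N = false by apply/negbTE; apply: contra ht => /eqP e; apply/eqP/val_inj.
  by rewrite mul0r.
have h : (Q + s < 2 * Q)%N by lia.
rewrite (bigD1 (Ordinal h)) //= eqxx mul1r big1 ?addr0 // => t ht.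
have -> : (nat_of_ord t == Q + s)%N = false by apply/negbTE; apply: contra ht => /eqP e; apply/eqP/val_inj.
by rewrite mul0r.
Qed.

(** At 2QN the angles in [chi_fourier] are integer multiples of pi, and the cosine is symmetric
    about each of them. *)
Lemma chi_sym n : (n <= 2 * Q * N)%N -> chi m a (2 * Q * N + n) = chi m a (2 * Q * N - n).
Proof.
move=> hn; apply: (@intr_inj R); rewrite !(chi_fourier R am); apply: eq_bigr => k _; congr (_ * (_ * _)).
have -> : pi * (2 * k + 1)%:R * (2 * Q * N + n)%:R / (2 * Q)%:R = pi * ((2 * k + 1) * N)%:R + pi * (2 * k + 1)%:R * n%:R / (2 * Q)%:R :> R.
  have q2 : ((2 * Q)%:R : R) != 0 by rewrite pnatr_eq0.
  by rewrite (natrD _ (2 * Q * N)) (natrM _ (2 * Q)) (natrM _ (2 * k + 1)); move: ((2 * Q)%:R : R) q2 => x x0; field.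
have -> : pi * (2 * k + 1)%:R * (2 * Q * N - n)%:R / (2 * Q)%:R = pi * ((2 * k + 1) * N)%:R - pi * (2 * k + 1)%:R * n%:R / (2 * Q)%:R :> R.
  have q2 : ((2 * Q)%:R : R) != 0 by rewrite pnatr_eq0.
  by rewrite natrB // (natrM _ (2 * Q)) (natrM _ (2 * k + 1)); move: ((2 * Q)%:R : R) q2 => x x0; field.
have -> : sin (pi * ((2 * k + 1) * N)%:R) = 0 :> R -> forall t : R,
    cos (pi * ((2 * k + 1) * N)%:R + t) = cos (pi * ((2 * k + 1) * N)%:R - t).
  by move=> h t; rewrite cosD cosB h mul0r subr0 addr0.
by [].
elim: ((2 * k + 1) * N)%N => [|j IH]; first by rewrite mulr0 sin0.
by rewrite -natr1 mulrDr mulr1 sinDpi IH oppr0.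
Qed.

Lemma X_wsum : X R m a N = (g n0%:Z)^-1 / (2 * M%:R) *
  \sum_(k < Q) (fcoef R m a k)%:C * ((g ((2 * k + 1) * N)%N%:Z)^-1 * wsum R M ((2 * k + 1) * N)%N%:Z).
Proof.
have NC0 : (N%:R : R[i]) != 0 by rewrite pnatr_eq0 -lt0n.
have gn : g n0%:Z != 0 by exact: gterm_neq0.
pose f n : R[i] := quadw R M n%:Z * g n%:Z.
pose F n : R[i] := (chi m a n)%:~R * f n.
have e1 : N%:R * X R m a N = (\sum_(n < 2 * Q * N) F n) / (8 * Q%:R * g n0%:Z).
  by rewrite X_pairs (chi_sum f) mulr_suml.
(* [F] is symmetric about 2QN = M/2, so the half-range sum extends to a full period of the Gaussian
   term. *)
have e2 : \sum_(n < M) F n = (\sum_(n < 2 * Q * N) F n) *+ 2.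
  apply: sum_half_sym.
  - by rewrite /F /f quadw0 mul0r mulr0.
  - have -> : (2 * Q * N = 2 * Q * N + 0)%N by rewrite addn0.
    rewrite /F chi_block // /s.
    have -> : (0 == Q - 2 * a.+1)%N = false by lia.
    have -> : (0 == Q + 2 * a.+1)%N = false by lia.
    by rewrite subrr mulr0 mul0r.
  move=> n hn; rewrite /F chi_sym // /f; congr (_ * _).
  have -> : (2 * Q * N + n)%N%:Z = M%:Z - (2 * Q * N - n)%N%:Z by lia.
  rewrite quadw_sym; congr (_ * _).
  by rewrite -[LHS]gtermN opprB -[LHS](gterm_period R M0 Me) subrK.
have e3 : \sum_(n < M) F n = 2 * \sum_(k < Q) (fcoef R m a k)%:C * ((g ((2 * k + 1) * N)%N%:Z)^-1 * wsum R M ((2 * k + 1) * N)%N%:Z).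
  rewrite mulr_sumr; under [in RHS]eq_bigr => k _.
    rewrite (_ : 2 * (_ * (_ * _)) = \sum_(n < M) (fcoef R m a k)%:C * ((cis (2 * pi * (n%:Z * ((2 * k + 1) * N)%N%:Z)%:~R / M%:R)
      + cis (- (2 * pi * (n%:Z * ((2 * k + 1) * N)%N%:Z)%:~R / M%:R))) * f n)); last first.
      rewrite -mulr_sumr mulrCA; congr (_ * _).
      under eq_bigr do rewrite mulrDl !(mulrC _ (f _)).
      by rewrite /f big_split /= wsum_twist // wsum_twistN // -mulr2n mulr_natl.
    over.
  rewrite exchange_big; apply: eq_bigr => n _ /=; rewrite /F.
  have -> : (chi m a n)%:~R = ((chi m a n)%:~R : R)%:C :> R[i] by rewrite rmorph_int.
  rewrite (chi_fourier R am) rmorph_sum mulr_suml; apply: eq_bigr => k _.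
  move: (fcoef R m a k) => c; rewrite [RHS]mulrA; congr (_ * _).
  have -> : 2 * pi * (n%:Z * ((2 * k + 1) * N)%N%:Z)%:~R / M%:R = pi * (2 * k + 1)%:R * n%:R / (2 * Q)%:R :> R.
    have q2 : ((2 * Q)%:R : R) != 0 by rewrite pnatr_eq0.
    rewrite rmorphM /= -!pmulrn (natrM _ _ N) (natrM _ 2 (2 * Q * N)) (natrM _ (2 * Q) N).
    by move: ((2 * Q)%:R : R) q2 => x x0; field; rewrite x0 NR0.
  by rewrite /cis cosN sinN; simpc; congr (_ +i* _); ring.
apply: (mulfI NC0); rewrite e1.
have -> : \sum_(n < 2 * Q * N) F n = \sum_(k < Q) (fcoef R m a k)%:C * ((g ((2 * k + 1) * N)%N%:Z)^-1 * wsum R M ((2 * k + 1) * N)%N%:Z).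
  apply: (mulfI (_ : 2 != 0 :> R[i])); first by rewrite pnatr_eq0.
  by rewrite -e3 e2 mulr_natl.
rewrite (natrM _ 2 (2 * Q * N)) (natrM _ (2 * Q) N) (natrM _ 2 Q).
move: (\sum_(k < Q) _) (g _) gn (Q%:R : R[i]) QC0 (N%:R : R[i]) NC0 => S G G0 q hq n hn.
by field; rewrite G0 hq hn.
Qed.

End XasGaussSum.

Lemma antisym_sum (R : realType) m (A q : nat -> R[i]) :
  (forall k, (k <= 2 * m)%N -> A (2 * m - k)%N = - A k) ->
  \sum_(k < (2 * m).+1) A k * q k = \sum_(k < m) A k * (q k - q (2 * m - k)%N).
Proof.
move=> hA; have Am : A m = 0.
  have := hA m; have -> : (2 * m - m = m)%N by lia.
  move=> /(_ ltac:(lia)) /eqP; rewrite -subr_eq0 opprK -mulr2n mulrn_eq0 /= => /eqP //.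
have -> : ((2 * m).+1 = m + m.+1)%N by lia.
rewrite big_split_ord /= [X in _ + X](reindex_inj rev_ord_inj) big_ord_recr /=.
have -> : (m + (m.+1 - m.+1) = m)%N by lia.
rewrite Am mul0r addr0 -big_split; apply: eq_bigr => k _ /=.
have kn := ltn_ord k.
have -> : (m + (m.+1 - k.+1) = 2 * m - k)%N by lia.
rewrite hA; last by lia.
by rewrite mulrBr mulNr.
Qed.

Lemma sin_ge_mid (R : realType) (x0 x : R) : 0 <= x0 -> x0 <= x <= pi - x0 -> sin x0 <= sin x.
Proof.
move=> h0 /andP[h1 h2]; rewrite -subr_ge0.
have -> : sin x - sin x0 = 2 * cos ((x + x0) / 2) * sin ((x - x0) / 2).
  set p := (x + x0) / 2; set q := (x - x0) / 2.
  have e1 : x = p + q by rewrite /p /q; field.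
  have e2 : x0 = p - q by rewrite /p /q; field.
  by transitivity (sin (p + q) - sin (p - q)); [rewrite -e1 -e2 | rewrite sinD sinB; ring].
apply: mulr_ge0.
  by rewrite mulr_ge0 //; apply: cos_ge0_pihalf; apply/andP; split; have := pi_gt0 R; lra.
by apply: sin_ge0_pi; apply/andP; split; lra.
Qed.

Section Expansion.
Variables (R : realType) (m a : nat).
Hypothesis am : (a < m)%N.

Local Notation Q := ((2 * m).+1).
Let n0 := (2 * m - 2 * a - 1)%N.
Let cc : R := n0%:R ^+ 2 / (4 * (2 * m + 1)%:R).

Let QR0 : (Q%:R : R) != 0. Proof. by rewrite pnatr_eq0. Qed.
Let QC0 : (Q%:R : R[i]) != 0. Proof. by rewrite pnatr_eq0. Qed.

Lemma fcoef_anti k : (k <= 2 * m)%N -> fcoef R m a (2 * m - k) = - fcoef R m a k.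
Proof.
move=> hk; rewrite /fcoef.
have -> : (-1) ^+ (2 * m - k) = (-1) ^+ k :> R.
  by rewrite -signr_odd oddB // oddM /= signr_odd.
rewrite -mulNr -mulrN; congr (_ * _ / _).
have -> : pi * (2 * (2 * m - k) + 1)%:R * a.+1%:R / Q%:R = - (pi * (2 * k + 1)%:R * a.+1%:R / Q%:R) + 2 * pi * a.+1%:R :> R.
  have -> : (2 * (2 * m - k) + 1)%:R = 2 * Q%:R - (2 * k + 1)%:R :> R.
    by rewrite -natrM -natrB; [congr (_%:R); lia | lia].
  by move: (Q%:R : R) QR0 => x x0; field.
have [h1 h2] : cos (2 * pi * a.+1%:R : R) = 1 /\ sin (2 * pi * a.+1%:R : R) = 0 by have [] := cis_2pi_nat R a.+1.
by rewrite sinD h1 h2 mulr1 mulr0 addr0 sinN.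
Qed.

Lemma fcoef_le1 k : `|fcoef R m a k| <= 1.
Proof.
rewrite /fcoef !normrM normrX normrN normr1 expr1n mul1r normfV normr_nat.
rewrite ler_pdivrMr ?ltr0n // mul1r; apply: (@le_trans _ _ 1); last by rewrite ler1n.
by rewrite ler_norml sin_geN1 sin_le1.
Qed.

Section FixedN.
Variables (N T : nat).
Hypothesis N0 : (0 < N)%N.
Local Notation P := (2 * Q * N)%N.
Local Notation M := (2 * P)%N.
Local Notation g := (@gterm R M).

Let NR0 : (N%:R : R) != 0. Proof. by rewrite pnatr_eq0 -lt0n. Qed.
Let NC0 : (N%:R : R[i]) != 0. Proof. by rewrite pnatr_eq0 -lt0n. Qed.
Let MR : (M%:R : R) = 4 * Q%:R * N%:R.
Proof. by rewrite (natrM _ 2 P) (natrM _ (2 * Q) N) (natrM _ 2 Q); ring. Qed.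
Let MC : (M%:R : R[i]) = 4 * Q%:R * N%:R.
Proof. by rewrite (natrM _ 2 P) (natrM _ (2 * Q) N) (natrM _ 2 Q); ring. Qed.

Lemma gterm_jN k : g ((2 * k + 1) * N)%N%:Z = cis (N%:R * pi * ((2 * k + 1)%:R ^+ 2 / (4 * Q%:R))).
Proof.
rewrite /gterm -pmulrn MR natrM; congr cis.
by move: (Q%:R : R) QR0 => x x0; field; rewrite x0 NR0.
Qed.

Lemma gterm_anti k : (k <= 2 * m)%N -> g ((2 * (2 * m - k) + 1) * N)%N%:Z = g ((2 * k + 1) * N)%N%:Z.
Proof.
move=> hk; rewrite !gterm_jN.
have -> : (2 * (2 * m - k) + 1)%:R = 2 * Q%:R - (2 * k + 1)%:R :> R.
  by rewrite -natrM -natrB; [congr (_%:R); lia | lia].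
rewrite [X in cis X](_ : _ = N%:R * pi * ((2 * k + 1)%:R ^+ 2 / (4 * Q%:R)) + 2 * pi * ((m%:Z - k%:Z) * N%:Z)%:~R).
  by rewrite cisD cis_2pi_int mulr1.
have eQ : (Q%:R : R) = 2 * m%:R + 1 by rewrite -natr1 natrM.
rewrite rmorphM rmorphB /= -!pmulrn natrD natrM.
have -> : m%:R = (Q%:R - 1) / 2 :> R by rewrite eQ; field.
by move: (Q%:R : R) QR0 => x x0; field.
Qed.

Lemma gterm_n0 : (g n0%:Z)^-1 = cis (- (pi / N%:R * cc)).
Proof.
rewrite /gterm -cisN -pmulrn MR /cc addn1; congr cis.
by move: (Q%:R : R) QR0 => x x0; field; rewrite x0 NR0.
Qed.

Lemma main_term :
  gsum R M / (2 * M%:R) * (\sum_(k < Q) (fcoef R m a k)%:C * (g ((2 * k + 1) * N)%N%:Z)^-1 * quadw R M ((2 * k + 1) * N)%N%:Z) =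
  (2 / Num.sqrt (2 * m + 1)%:R * N%:R `^ (3 / 2))%:C * cis (pi / 4) *
  \sum_(k < m) ((-1) ^+ k * (m - k)%:R * sin (a.+1%:R * ((2 * k + 1)%:R / (2 * m + 1)%:R) * pi))%:C
     * cis (- (N%:R * pi * ((2 * k + 1)%:R ^+ 2 / (4 * (2 * m + 1)%:R)))).
Proof.
have M0 : (0 < M)%N by rewrite !muln_gt0.
have Me : ~~ odd M by rewrite oddM.
rewrite (gsumE R M0 Me) addn1.
rewrite (@antisym_sum R m (fun k => (fcoef R m a k)%:C * (g ((2 * k + 1) * N)%N%:Z)^-1) (fun k => quadw R M ((2 * k + 1) * N)%N%:Z)); last first.
  by move=> k hk; rewrite fcoef_anti // gterm_anti // rmorphN mulNr.
rewrite mulr_sumr [RHS]mulr_sumr; apply: eq_bigr => k _.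
have km := ltn_ord k.
(* Origin of the factor m - k: the change of the weight between K and its partner under k -> 2m -
   k. *)
have eq : quadw R M ((2 * k + 1) * N)%N%:Z - quadw R M ((2 * (2 * m - k) + 1) * N)%N%:Z = 8 * Q%:R * (m - k)%:R * N%:R ^+ 2.
  rewrite !quadwE -!pmulrn MC !(natrM _ _ N).
  have -> : (2 * (2 * m - k) + 1)%:R = 2 * Q%:R - (2 * k + 1)%:R :> R[i].
    by rewrite -natrM -natrB; [congr (_%:R); lia | lia].
  have -> : (m - k)%:R = (Q%:R - (2 * k + 1)%:R) / 2 :> R[i].
    rewrite -natrB; last by lia.
    have -> : (Q - (2 * k + 1) = (m - k) * 2)%N by lia.
    by rewrite natrM mulfK // pnatr_eq0.
  by move: (Q%:R : R[i]) => x; field.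
rewrite eq gterm_jN -cisN.
have esin : fcoef R m a k = (-1) ^+ k * sin (a.+1%:R * ((2 * k + 1)%:R / Q%:R) * pi) / Q%:R.
  by rewrite /fcoef; congr (_ * sin _ / _); move: (Q%:R : R) QR0 => x x0; field.
have hs : Num.sqrt M%:R = 2 * Num.sqrt Q%:R * Num.sqrt N%:R :> R.
  have -> : (M%:R : R) = 2 ^+ 2 * (Q%:R * N%:R) by rewrite MR; ring.
  by rewrite sqrtrM ?sqr_ge0 // sqrtr_sqr ger0_norm // sqrtrM ?ler0n // mulrA.
have hp : N%:R `^ (3 / 2) = N%:R * Num.sqrt N%:R :> R.
  have -> : (3 / 2 : R) = 1 + 2^-1 by field.
  rewrite powRD; last by apply/implyP => _; rewrite NR0.
  by rewrite powRr1 // powR12_sqrt.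
rewrite hs hp esin.
have sQ : Num.sqrt Q%:R != 0 :> R by rewrite gt_eqF // sqrtr_gt0 ltr0n.
have sQ2 : Num.sqrt Q%:R ^+ 2 = Q%:R :> R by rewrite sqr_sqrtr.
have sN2 : Num.sqrt N%:R ^+ 2 = N%:R :> R by rewrite sqr_sqrtr.
have -> : 2 * M%:R = (8 * Q%:R * N%:R : R)%:C :> R[i].
  by rewrite MC !rmorphM /= !rmorph_nat; ring.
have -> : 8 * Q%:R * (m - k)%:R * N%:R ^+ 2 = (8 * Q%:R * (m - k)%:R * N%:R ^+ 2 : R)%:C :> R[i].
  by rewrite rmorphM rmorphXn rmorphM rmorphM /= !rmorph_nat.
rewrite -fmorphV.
move: (cis (pi / 4)) (cis (- _)) (sin _) ((-1) ^+ k : R) => c1 c2 sn sg.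
transitivity ((2 * Num.sqrt Q%:R * Num.sqrt N%:R / (8 * Q%:R * N%:R) * (sg * sn / Q%:R) * (8 * Q%:R * (m - k)%:R * N%:R ^+ 2))%:C * (c1 * c2)).
  by rewrite !rmorphM /=; ring.
have -> : 2 * Num.sqrt Q%:R * Num.sqrt N%:R / (8 * Q%:R * N%:R) * (sg * sn / Q%:R) * (8 * Q%:R * (m - k)%:R * N%:R ^+ 2) =
   2 / Num.sqrt Q%:R * (N%:R * Num.sqrt N%:R) * (sg * (m - k)%:R * sn) :> R.
  move: (Num.sqrt Q%:R : R) sQ sQ2 (Num.sqrt N%:R : R) (N%:R : R) NR0 => x x0 <- y n hn.
  by field; rewrite x0 hn.
by rewrite !rmorphM /=; ring.
Qed.

(** Since the coefficients sum to zero, the unknown constant [wdefect] at P can be subtracted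
    freely; the difference is what [wdefect_bound] controls. *)
Definition rterm : R[i] := \sum_(k < Q) (fcoef R m a k)%:C * (g ((2 * k + 1) * N)%N%:Z)^-1 *
   (wdefect R M T ((2 * k + 1) * N)%N%:Z - wdefect R M T P%:Z) / (2 * M%:R).

Lemma vser_sum k : (g ((2 * k + 1) * N)%N%:Z)^-1 * vser R M T ((2 * k + 1) * N)%N%:Z =
  \sum_(r < T.+1) ecoef r (2 * pi / M%:R) * (Lam R (2 * r).+1).[ycot (chiang R m k)].
Proof.
rewrite /vser mulrA mulVf ?gterm_neq0 // mul1r /Aser; apply: eq_bigr => r _.
rewrite -exprS LamFXn; congr (_ * _.[ycot _]); rewrite /chiang -pmulrn MR !(natrM _ _ N) (natrM _ 2 Q).
by move: (Q%:R : R) QR0 => x x0; field; rewrite x0 NR0.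
Qed.

Lemma X_expansion : X R m a N = cis (- (pi / N%:R * cc)) *
  ((2 / Num.sqrt (2 * m + 1)%:R * N%:R `^ (3 / 2))%:C * cis (pi / 4) *
  \sum_(k < m) ((-1) ^+ k * (m - k)%:R * sin (a.+1%:R * ((2 * k + 1)%:R / (2 * m + 1)%:R) * pi))%:C
     * cis (- (N%:R * pi * ((2 * k + 1)%:R ^+ 2 / (4 * (2 * m + 1)%:R))))
  + \sum_(r < T.+1) Defs.T R m a r / (r`!)%:R * (pi%:C / (4 * (2 * m + 1)%:R * N%:R * 'i%C)) ^+ r
  + rterm).
Proof.
rewrite X_wsum //.
have -> : ((2 * m).+1 - 2 * a.+1 = n0)%N by rewrite /n0; lia.
rewrite gterm_n0 -mulrA; congr (_ * _); rewrite -main_term /rterm.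
have M1 : 2 * M%:R != 0 :> R[i] by rewrite -natrM pnatr_eq0; lia.
have M2 : (M%:R : R[i]) != 0 by rewrite pnatr_eq0; lia.
have z : \sum_(k < Q) (fcoef R m a k)%:C * (g ((2 * k + 1) * N)%N%:Z)^-1 = 0.
  have := @antisym_sum R m (fun k => (fcoef R m a k)%:C * (g ((2 * k + 1) * N)%N%:Z)^-1) (fun=> 1).
  under eq_bigr do rewrite mulr1.
  move=> ->; first by rewrite big1 // => k _; rewrite subrr mulr0.
  by move=> k hk; rewrite fcoef_anti // gterm_anti // rmorphN mulNr.
(* As 1/i = -i, the r-th power carries (-1)^r, which together with the (-1)^(r+1) of [T_value]
   leaves the overall sign -1 of [eT]. *)
have ei : pi%:C / (4 * (2 * m + 1)%:R * N%:R * 'i%C) = - ('i%C / 2 * (2 * pi / M%:R)%:C) :> R[i].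
  rewrite MR addn1 !rmorphM fmorphV !rmorphM /= !rmorph_nat.
  have i2 : 'i%C * 'i%C = -1 :> R[i] by rewrite -expr2 sqr_i.
  have i0 : 'i%C != 0 :> R[i] by apply/eqP => h; move: i2; rewrite h mul0r => /eqP; rewrite eq_sym oppr_eq0 oner_eq0.
  rewrite [X in pi%:C * X]invfM.
  have -> : ('i%C)^-1 = - 'i%C :> R[i] by apply: (mulfI i0); rewrite mulfV // mulrN i2 opprK.
  by move: (Q%:R : R[i]) QC0 => x x0; field; rewrite x0 NC0.
have eT : \sum_(r < T.+1) Defs.T R m a r / (r`!)%:R * (pi%:C / (4 * (2 * m + 1)%:R * N%:R * 'i%C)) ^+ r =
   - \sum_(k < Q) (fcoef R m a k)%:C * ((g ((2 * k + 1) * N)%N%:Z)^-1 * vser R M T ((2 * k + 1) * N)%N%:Z).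
  rewrite ei; under [in RHS]eq_bigr do rewrite vser_sum mulr_sumr.
  rewrite exchange_big -sumrN; apply: eq_bigr => r _ /=.
  rewrite T_value // [(- ('i%C / 2 * _)) ^+ _]exprNn /ecoef.
  have -> : \sum_(k < Q) (fcoef R m a k)%:C * (('i%C / 2 * (2 * pi / M%:R)%:C) ^+ r / (r`!)%:R * (Lam R (2 * r).+1).[ycot (chiang R m k)]) =
     ('i%C / 2 * (2 * pi / M%:R)%:C) ^+ r / (r`!)%:R * \sum_(k < Q) (fcoef R m a k)%:C * (Lam R (2 * r).+1).[ycot (chiang R m k)].
    by rewrite mulr_sumr; apply: eq_bigr => k _; rewrite mulrCA.
  have s2 : (-1) ^+ r.+1 * (-1) ^+ r = -1 :> R[i] by rewrite -exprD addSn addnn -mul2n exprS exprM sqrrN !expr1n mulr1.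
  move: (\sum_(k < Q) _) (('i%C / 2 * _) ^+ r) ((-1) ^+ r.+1 : R[i]) ((-1) ^+ r : R[i]) s2 => S E s1 s0 s2.
  transitivity (s1 * s0 * (E / (r`!)%:R * S)); first by ring.
  by rewrite s2 mulN1r.
rewrite eT.
have -> : \sum_(k < Q) (fcoef R m a k)%:C * (g ((2 * k + 1) * N)%N%:Z)^-1 *
   (wdefect R M T ((2 * k + 1) * N)%N%:Z - wdefect R M T P%:Z) / (2 * M%:R) =
   (\sum_(k < Q) (fcoef R m a k)%:C * (g ((2 * k + 1) * N)%N%:Z)^-1 * wdefect R M T ((2 * k + 1) * N)%N%:Z) / (2 * M%:R).
  rewrite -mulr_suml; congr (_ / _); under eq_bigr do rewrite mulrBr.
  by rewrite sumrB -[X in _ - X]mulr_suml z mul0r subr0.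
have h k : (fcoef R m a k)%:C * ((g ((2 * k + 1) * N)%N%:Z)^-1 * wsum R M ((2 * k + 1) * N)%N%:Z) =
    (fcoef R m a k)%:C * (g ((2 * k + 1) * N)%N%:Z)^-1 * wdefect R M T ((2 * k + 1) * N)%N%:Z +
    gsum R M * ((fcoef R m a k)%:C * (g ((2 * k + 1) * N)%N%:Z)^-1 * quadw R M ((2 * k + 1) * N)%N%:Z) -
    2 * M%:R * ((fcoef R m a k)%:C * ((g ((2 * k + 1) * N)%N%:Z)^-1 * vser R M T ((2 * k + 1) * N)%N%:Z)).
  rewrite /wdefect; move: (_^-1) (wsum _ _ _) (quadw _ _ _) (vser _ _ _ _) => x1 x2 x3 x4; ring.
under eq_bigr do rewrite h.
rewrite sumrB big_split /= -!mulr_sumr.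
move: (\sum_(k < Q) _) (\sum_(k < Q) _) (\sum_(k < Q) _) (gsum R M) M2 => s1 s2 s3 gs.
by move: (M%:R : R[i]) => x x0; field.
Qed.

End FixedN.
End Expansion.

Lemma rterm_bound (R : realType) m a K : exists C : R, forall N, (2 <= N)%N ->
  cabs (rterm R m a N K.+1) <= C * (pi / (2 * (2 * m).+1 * N)%:R) ^+ K.
Proof.
(* The smallest angle is e N = pi/(2Q) = 4 x0, and N >= 2 gives e <= 2 x0; hence x/2 stays within
   [x0, pi - x0] on the range that [wdefect_bound] asks for. *)
set Q := (2 * m).+1; set x0 : R := pi / (8 * Q%:R).
have p0 := pi_gt0 R.
have Q1 : 1 <= Q%:R :> R by rewrite ler1n.
have Q0 : Q%:R != 0 :> R by rewrite pnatr_eq0.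
have x0p : 0 < x0 by rewrite divr_gt0 // mulr_gt0 // ltr0n.
have x08 : x0 <= pi / 8.
  by rewrite ler_pM2l // lef_pV2 ?posrE ?mulr_gt0 ?ltr0n //; lra.
have s0 : 0 < sin x0 by apply: sin_gt0_pi; rewrite x0p /=; lra.
have [C C0 hC] := wdefect_bound K.+1 s0.
(* As e P = pi, the bound P^2 e^(K+2) is pi^2 e^K: truncating at K + 1 makes up for the double
   summation. The factor Q counts the terms. *)
exists (Q%:R * (pi ^+ 2 * C)) => N hN.
set P := (2 * Q * N)%N.
have P0 : (0 < P)%N by rewrite !muln_gt0; lia.
have PR : P%:R != 0 :> R by rewrite pnatr_eq0 -lt0n.
have NR : 2 <= N%:R :> R by rewrite ler_nat.
set e : R := pi / P%:R.
have ee : 2 * pi / (2 * P)%:R = e by rewrite natrM /e; field.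
have eN : e * N%:R = 4 * x0.
  rewrite /e /x0 /P !natrM; have n0 : N%:R != 0 :> R by lra.
  by move: (Q%:R : R) Q0 => q q0; field; rewrite q0 n0.
have e0 : 0 < e by rewrite divr_gt0 // ltr0n.
have e2 : e <= 2 * x0 by nra.
have e1 : e <= 1 by have := pihalf_lt2 R; lra.
have hk (k : 'I_Q) : cabs (wdefect R (2 * P) K.+1 ((2 * k + 1) * N)%N%:Z - wdefect R (2 * P) K.+1 P%:Z)
    <= P%:R ^+ 2 * (2 * (2 * P)%:R * C * e ^+ K.+2).
  rewrite -ee; apply: hC => //.
  - by have := ltn_ord k; rewrite /P => ?; rewrite leq_mul2r; apply/orP; right; lia.
  - by rewrite ee.
  move=> x; rewrite ee natrM mulrCA => /andP[h1 h2]; apply: sin_ge_mid; first exact: ltW.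
  have k1 : 1 <= (2 * k + 1)%:R :> R by rewrite ler1n addn1.
  have h3 : 4 * x0 <= (2 * k + 1)%:R * (e * N%:R) by rewrite eN ler_peMl // mulr_ge0 // ltW.
  by apply/andP; split; lra.
rewrite /rterm; apply: le_trans (cabs_sum _ _ _) _.
have -> : Q%:R * (pi ^+ 2 * C) * e ^+ K = \sum_(k < Q) pi ^+ 2 * C * e ^+ K.
  by rewrite sumr_const card_ord -mulrA mulr_natl.
apply: ler_sum => k _.
have M1 : cabs (2 * (2 * P)%:R : R[i]) = 2 * (2 * P)%:R by rewrite cabsM !cabs_nat.
rewrite !cabsM !cabsV M1 cabs_gterm invr1 mulr1 cabs_real.
rewrite ler_pdivrMr; last by rewrite mulr_gt0 // ltr0n muln_gt0.
apply: (@le_trans _ _ (1 * (P%:R ^+ 2 * (2 * (2 * P)%:R * C * e ^+ K.+2)))).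
  by apply: ler_pM; rewrite ?cabs_ge0 ?fcoef_le1 ?hk.
have eP : e * P%:R = pi by rewrite /e divfK.
rewrite mul1r -eP !(exprSr e); move: (e ^+ K) ((2 * P)%:R : R) (P%:R : R) => y z p.
by rewrite le_eqVlt; apply/orP; left; apply/eqP; ring.
Qed.

Theorem theorem4p3 (R : realType) (m a : nat) (hm : (0 < m)%N) (ha : (a < m)%N) :
  let c : R := (2 * m - 2 * a - 1)%:R ^+ 2 / (4 * (2 * m + 1)%:R) in
  forall K : nat, exists B : R, \forall N \near \oo,
    `| X R m a N
       - ((2 / Num.sqrt (2 * m + 1)%:R * N%:R `^ (3 / 2))%:C
          * cexp ((pi / 4 - pi / N%:R * c)%:C * 'i%C)
          * \sum_(k < m)
              ((-1) ^+ k * (m - k)%:R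
               * sin (a.+1%:R * ((2 * k + 1)%:R / (2 * m + 1)%:R) * pi))%:C
              * cexp ((- (N%:R * pi * ((2 * k + 1)%:R ^+ 2
                                       / (4 * (2 * m + 1)%:R))))%:C * 'i%C)
          + cexp ((- (pi / N%:R * c))%:C * 'i%C)
            * \sum_(n < K)
                T R m a n / (n`!)%:R
                * (pi%:C / (4 * (2 * m + 1)%:R * N%:R * 'i%C)) ^+ n) |
    <= (B / N%:R ^+ K)%:C.
Proof.
move=> c K; have [C hC] := @rterm_bound R m a K.
have p0 := pi_gt0 R.
pose kap : R := pi / (2 * (2 * m).+1)%:R.
(* The exact formula is used at order K + 1, so the terms n = K and n = K + 1 join [rterm] in the
   remainder; all three are O(N^(-K)). The threshold 2 is that of [rterm_bound]. *)
exists ((cabs (T R m a K) + cabs (T R m a K.+1) + C) * kap ^+ K); exists 2%N => // N /= hN.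
rewrite cabsE lecR (@X_expansion R m a ha N K.+1); last by lia.
under [X in _ - (_ * X + _)]eq_bigr do rewrite cexp_cis.
rewrite !cexp_cis [pi / 4 - _]addrC cisD -/c.
set u := cis _; set S := \sum_(k < m) _; set c4 := cis (pi / 4).
set z := pi%:C / _; rewrite !big_ord_recr /=.
set S' := \sum_(i < K) _; set D := (_%:C).
set tK := _ * z ^+ K; set tK1 := _ * z ^+ K.+1; set r := rterm _ _ _ _ _.
rewrite [X in cabs X](_ : _ = u * (tK + tK1 + r)); last by ring.
rewrite cabsM cabs_cis mul1r.
set e : R := pi / (2 * (2 * m).+1 * N)%:R in hC *.
have N0 : N%:R != 0 :> R by rewrite pnatr_eq0; lia.
have -> : (cabs (T R m a K) + cabs (T R m a K.+1) + C) * kap ^+ K / N%:R ^+ K =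
   (cabs (T R m a K) + cabs (T R m a K.+1) + C) * e ^+ K.
  by rewrite -mulrA -expr_div_n; congr (_ * _ ^+ _); rewrite /e /kap [in RHS]natrM invfM mulrA.
have e0 : 0 < e by rewrite divr_gt0 // ltr0n !muln_gt0; lia.
have e1 : e <= 1.
  rewrite ler_pdivrMr ?mul1r; last by rewrite ltr0n !muln_gt0; lia.
  apply: (@le_trans _ _ 4); first by have := pihalf_lt2 R; lra.
  by rewrite ler_nat; nia.
have ze : cabs z <= e.
  rewrite /z cabsM cabsV !cabsM cabs_i !cabs_nat cabs_real gtr0_norm // mulr1.
  rewrite ler_pM2l // lef_pV2 ?posrE ?ltr0n -?natrM ?ltr0n ?ler_nat ?muln_gt0; lia.
have ht j : cabs (T R m a j / (j`!)%:R * z ^+ j) <= cabs (T R m a j) * e ^+ j.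
  rewrite cabsM cabsM cabsV cabs_nat cabsX; apply: ler_pM.
  - by rewrite mulr_ge0 ?cabs_ge0 ?invr_ge0.
  - by rewrite exprn_ge0 ?cabs_ge0.
  - by rewrite ler_piMr ?cabs_ge0 // invf_le1 ?ltr0n ?fact_gt0 // ler1n fact_gt0.
  - by apply: lerXn2r => //; rewrite nnegrE ?cabs_ge0 // ltW.
apply: le_trans (cabsD _ _) _; rewrite mulrDl; apply: lerD; last exact: hC.
apply: le_trans (cabsD _ _) _; rewrite mulrDl; apply: lerD; first exact: ht.
apply: le_trans (ht _) _; rewrite exprS ler_wpM2l ?cabs_ge0 //.
by rewrite ler_piMl // exprn_ge0 // ltW.
Qed.
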